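(* Assume condition (A) (stated in the context). There exists a constant $C<\infty$ such that for any $\theta\in\Theta$, any observation sequence $y=\{y_n\}_{n\geq0}$ in $\mathcal{Y}$, any $n\geq 0$ and any $\varphi_n\in\mathrm{Osc}_1(\mathcal{X})$, the random variable $\sqrt{N}\left(\zeta^N_{\theta,n}-\zeta_{\theta,n}\right)(\varphi_n)$ converges in law, as $N\to\infty$, to the centered Gaussian random variable $$\sum_{p=0}^{n}V_{\theta,p}\left(G_{\theta,p,n}\,\frac{D_{\theta,p,n}\big(F_{\theta,n}-\mathbb{Q}_{\theta,n}(F_{\theta,n})\big)}{D_{\theta,p,n}(1)}\right)$$ whose variance is bounded above by $C$, where $$F_{\theta,n}=\big(\varphi_n-\mathbb{Q}_{\theta,n}(\varphi_n)\big)\big(T_{\theta,n}-\mathbb{Q}_{\theta,n}(T_{\theta,n})\big)$$ (here $\varphi_n$ is viewed as the function $x_{0:n}\mapsto\varphi_n(x_n)$).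
   Context: **Model.** $\mathcal{X}$, $\mathcal{Y}$ are measurable spaces with dominating measures denoted $dx$, $dy$; $\Theta\subseteq\mathbb{R}^d$ is open; $\pi_\theta(x)$ is a probability density on $\mathcal{X}$, $f_\theta(x'|x)$ a transition probability density on $\mathcal{X}$, and $g_\theta(y|x)$ a conditional probability density on $\mathcal{Y}$ given $x\in\mathcal{X}$. $\nabla$ is the gradient in $\theta$ and $|\cdot|$ is the norm on $\mathbb{R}^d$. $\nu(\varphi)=\int\nu(dx)\varphi(x)$. $z_{i:j}=(z_i,\dots,z_j)$. **Condition (A).** The dominating measures $dx$ on $\mathcal{X}$ and $dy$ on $\mathcal{Y}$ are finite, and there exist constants $0<\rho,\delta,c<\infty$ such that for all $(x,x',y,\theta)\in\mathcal{X}^2\times\mathcal{Y}\times\Theta$ the derivatives of $\pi_\theta(x)$, $f_\theta(x'|x)$, $g_\theta(y|x)$ with respect to $\theta$ exist and $\rho^{-1}\leq f_\theta(x'|x)\leq\rho$, $\delta^{-1}\leq g_\theta(y|x)\leq\delta$, and $|\nabla\log\pi_\theta(x)|\vee|\nabla\log f_\theta(x'|x)|\vee|\nabla\log g_\theta(y|x)|\leq c$. **Oscillation.** $\mathrm{Osc}_1(\mathcal{X})$ is the set of bounded measurable $\varphi:\mathcal{X}\to\mathbb{R}$ with $\sup_{x,x'}|\varphi(x)-\varphi(x')|\leq 1$. **Exact quantities.** Fix $\theta$ and $y=\{y_n\}_{n\ge0}$. Let $q_{\theta}(x_n|x_{n-1})=g_\theta(y_{n-1}|x_{n-1})f_\theta(x_n|x_{n-1})$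 (dependence on $y_{n-1}$ suppressed) and $Q_{\theta,n}(x_{n-1},dx_n)=q_\theta(x_n|x_{n-1})dx_n$ for $n>0$; $Q_{\theta,k,n}=Q_{\theta,k+1}\cdots Q_{\theta,n}$ (composition), $Q_{\theta,n,n}=Id$. $\mathbb{Q}_{\theta,n}(dx_{0:n})$ is the probability measure on $\mathcal{X}^{n+1}$ proportional to $dx_0\pi_\theta(x_0)\prod_{k=1}^n q_\theta(x_k|x_{k-1})dx_k$, and $\eta_{\theta,n}$ is its time-$n$ marginal, with $\eta_{\theta,0}(dx)=\pi_\theta(x)dx$. Let $t_{\theta,0}(x_{-1},x_0)=\nabla\log\pi_\theta(x_0)$, $t_{\theta,k}(x_{k-1},x_k)=\nabla\log\big(g_\theta(y_{k-1}|x_{k-1})f_\theta(x_k|x_{k-1})\big)$ for $k>0$, $T_{\theta,n}(x_{0:n})=\sum_{k=0}^n t_{\theta,k}(x_{k-1},x_k)$, and $$\zeta_{\theta,n}(\varphi)=\int\mathbb{Q}_{\theta,n}(dx_{0:n})\,T_{\theta,n}(x_{0:n})\big(\varphi(x_n)-\eta_{\theta,n}(\varphi)\big).$$ Potential functions: $G_{\theta,p,n}(x_p)=Q_{\theta,p,n}(1)(x_p)/\eta_{\theta,p}(Q_{\theta,p,n}(1))$. Backward kernels: $M_{\theta,n}(x_n,dx_{n-1})=\eta_{\theta,n-1}(dx_{n-1})q_\theta(x_n|x_{n-1})/\eta_{\theta,n-1}(q_\theta(x_n|\cdot))$, $n>0$. For bounded measurable $F_n$ on $\mathcal{X}^{n+1}$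 and $0\le k\le n$, $$D_{\theta,k,n}(F_n)(x_k)=\int\Big(\prod_{j=k}^{1}M_{\theta,j}(x_j,dx_{j-1})\Big)\Big(\prod_{j=k}^{n-1}Q_{\theta,j+1}(x_j,dx_{j+1})\Big)F_n(x_{0:n}),$$ with empty products equal to $1$ (for $\mathbb{R}^d$-valued $F_n$, componentwise). **Particle system.** $X_0^{(1)},\dots,X_0^{(N)}$ are i.i.d. from $\eta_{\theta,0}$; given the particles up to time $n-1$, $X_n^{(1)},\dots,X_n^{(N)}$ are i.i.d. from the density (w.r.t. $dx_n$) $\sum_{j}f_\theta(x_n|X_{n-1}^{(j)})g_\theta(y_{n-1}|X_{n-1}^{(j)})\big/\sum_{j}g_\theta(y_{n-1}|X_{n-1}^{(j)})$. The randomness is that of the particle system only ($\theta$, $y$ fixed). $\eta^N_{\theta,n}=\frac1N\sum_{i=1}^N\delta_{X_n^{(i)}}$, $M_{\theta,n}^N(x_n,dx_{n-1})=\eta^N_{\theta,n-1}(dx_{n-1})q_\theta(x_n|x_{n-1})/\eta^N_{\theta,n-1}(q_\theta(x_n|\cdot))$, $\mathbb{Q}^N_{\theta,n}(dx_{0:n})=\eta^N_{\theta,n}(dx_n)\prod_{k=n}^{1}M^N_{\theta,k}(x_k,dx_{k-1})$, and $$\zeta^N_{\theta,n}(\varphi)=\int\mathbb{Q}^N_{\theta,n}(dx_{0:n})\,T_{\theta,n}(x_{0:n})\big(\varphi(x_n)-\eta^N_{\theta,n}(\varphi)\big).$$ **Gaussian fields.** $\{V_{\theta,n}\}_{n\geq0}$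 is a sequence of independent centered Gaussian random fields (linear in the test function, indexed by bounded measurable functions on $\mathcal{X}$): for any bounded measurable $\varphi_0,\varphi_1,\dots$ and $p\ge 0$, $V_{\theta,0}(\varphi_0),\dots,V_{\theta,p}(\varphi_p)$ are independent zero-mean Gaussian with variances $\eta_{\theta,n}(\varphi_n^2)-\eta_{\theta,n}(\varphi_n)^2$. For $\mathbb{R}^d$-valued functions $V_{\theta,p}$ acts componentwise, and the variance bound is understood for each component. *)

(* Defs.v *)
From HB Require Import structures.
From mathcomp Require Import all_boot all_order all_algebra.
From mathcomp Require Import all_classical all_reals all_analysis.

Set Implicit Arguments.
Unset Strict Implicit.
Unset Printing Implicit Defensive.
Import Order.TTheory GRing.Theory Num.Theory.
Import numFieldNormedType.Exports.

Local Open Scope classical_set_scope.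
Local Open Scope ring_scope.

Section vectors.
Context (R : realType) (d : nat).

(* The norm that the library puts on row vectors is the sup norm. *)
Definition enorm (v : 'rV[R]_d) : R := Num.sqrt (\sum_(j < d) v 0 j ^+ 2).

Definition partials_exist (h : 'rV[R]_d -> R) (theta : 'rV[R]_d) : Prop :=
  forall j : 'I_d, derivable h theta (delta_mx 0 j).

Definition grad (h : 'rV[R]_d -> R) (theta : 'rV[R]_d) : 'rV[R]_d :=
  \row_(j < d) 'D_(delta_mx 0 j) h theta.

Definition componentwise (U : Type) (L : (U -> R) -> R) (F : U -> 'rV[R]_d) :
    'rV[R]_d :=
  \row_(j < d) L (fun u => F u 0 j).

End vectors.

Section test_functions.
Context (dX : measure_display) (X : measurableType dX) (R : realType).

Definition bounded_measurable (phi : X -> R) : Prop :=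
  measurable_fun setT phi /\ exists M : R, forall x, `|phi x| <= M.

Definition Osc1 (phi : X -> R) : Prop :=
  bounded_measurable phi /\ forall x x', `|phi x - phi x'| <= 1.

End test_functions.

(* [trans theta x x'] stands for f_theta(x' | x), and [obs theta x y] for
   g_theta(y | x). *)
Record densities (R : realType) (d : nat) (X Y : Type) := Densities {
  init : 'rV[R]_d -> X -> R ;
  trans : 'rV[R]_d -> X -> X -> R ;
  obs : 'rV[R]_d -> X -> Y -> R }.

Section model.
Context (R : realType) (d : nat).
Context (dX dY : measure_display) (X : measurableType dX)
  (Y : measurableType dY).
Context (mu : {measure set X -> \bar R}) (nu : {measure set Y -> \bar R}).
Context (Theta : set 'rV[R]_d) (m : densities R d X Y).

Definition is_model : Prop := forall theta, Theta theta ->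
  [/\ measurable_fun setT (init m theta) /\ (forall x, 0 <= init m theta x),
      measurable_fun setT (fun z : X * X => trans m theta z.1 z.2) /\
        (forall x x', 0 <= trans m theta x x'),
      measurable_fun setT (fun z : X * Y => obs m theta z.1 z.2) /\
        (forall x y, 0 <= obs m theta x y) &
      [/\ (\int[mu]_x (init m theta x)%:E = 1)%E,
          (forall x, \int[mu]_x' (trans m theta x x')%:E = 1)%E &
          (forall x, \int[nu]_y (obs m theta x y)%:E = 1)%E]].

(* The condition [0 < init m theta x] is implicit in the use of the logarithm
   of the initial density; for the other two densities positivity follows from
   the lower bounds. *)
Definition condition_A : Prop :=
  [/\ (mu setT < +oo)%E, (nu setT < +oo)%E &
  exists rho delta c : R, [/\ 0 < rho, 0 < delta, 0 < c &
  forall (x x' : X) (y : Y) (theta : 'rV[R]_d), Theta theta ->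
  [/\ [/\ partials_exist (fun th => init m th x) theta,
          partials_exist (fun th => trans m th x x') theta &
          partials_exist (fun th => obs m th x y) theta],
      0 < init m theta x,
      rho^-1 <= trans m theta x x' <= rho,
      delta^-1 <= obs m theta x y <= delta &
      [/\ enorm (grad (fun th => ln (init m th x)) theta) <= c,
          enorm (grad (fun th => ln (trans m th x x')) theta) <= c &
          enorm (grad (fun th => ln (obs m th x y)) theta) <= c]]]].

End model.

(* Measures are used through their action on bounded measurable functions.
   A function on X^(n+1) is encoded as a function of [x : nat -> X] that only
   reads x 0, ..., x n, and a multiple integral is computed by integrating out
   these coordinates one after the other. *)
Section flow.
Context (R : realType) (d : nat).
Context (dX dY : measure_display) (X : measurableType dX)
  (Y : measurableType dY).
Context (mu : {measure set X -> \bar R}) (m : densities R d X Y).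
Context (theta : 'rV[R]_d) (y : nat -> Y).

Implicit Types (phi : X -> R) (F : (nat -> X) -> R) (x : nat -> X).
Implicit Types (e : nat -> (X -> R) -> R).

Definition upd_coord x (k : nat) (z : X) : nat -> X :=
  fun j => if j == k then z else x j.

(* q_theta(x_(k+1) | x_k), with the observation y_k *)
Definition qdens (k : nat) (xk xk1 : X) : R :=
  obs m theta xk (y k) * trans m theta xk xk1.

(* Q_(k,k+l)(phi) *)
Fixpoint Qsg (k l : nat) phi : X -> R :=
  if l is l'.+1 then
    fun xk => \int[mu]_z (qdens k xk z * Qsg k.+1 l' phi z)
  else phi.

(* integrates out x_(k+1), ..., x_(k+l) against
   Q_(k+1)(x_k, dx_(k+1)) ... Q_(k+l)(x_(k+l-1), dx_(k+l)) *)
Fixpoint fwd (k l : nat) F : (nat -> X) -> R :=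
  if l is l'.+1 then
    fun x => \int[mu]_z (qdens k (x k) z * fwd k.+1 l' F (upd_coord x k.+1 z))
  else F.

Definition unnormalized_path (n : nat) F : R :=
  \int[mu]_z (init m theta z * fwd 0 n F (fun=> z)).

Definition Qpath (n : nat) F : R :=
  unnormalized_path n F / unnormalized_path n (fun=> 1).

Definition eta_flow (n : nat) phi : R := Qpath n (fun x => phi (x n)).

Definition score (k : nat) (xprev xk : X) : 'rV[R]_d :=
  if k is k'.+1 then
    grad (fun th => ln (obs m th xprev (y k') * trans m th xprev xk)) theta
  else grad (fun th => ln (init m th xk)) theta.

(* At k = 0 the first argument of [score], here x 0, is ignored. *)
Definition score_sum (n : nat) x : 'rV[R]_d :=
  \sum_(k < n.+1) score k (x k.-1) (x k).

Definition zeta_flow (n : nat) phi : 'rV[R]_d :=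
  componentwise (Qpath n)
    (fun x => (phi (x n) - eta_flow n phi) *: score_sum n x).

Definition Gpot (p n : nat) (xp : X) : R :=
  Qsg p (n - p) (fun=> 1) xp / eta_flow p (Qsg p (n - p) (fun=> 1)).

(* For a flow e of measures, M_(k+1)(x_(k+1), phi), where
   M_(k+1)(x_(k+1), dz) = e_k(dz) q(x_(k+1) | z) / e_k(q(x_(k+1) | .)); the
   exact kernels are obtained for e = [eta_flow], the particle ones for the
   empirical measures. *)
Definition backward_kernel e (k : nat) (xk1 : X) phi : R :=
  e k (fun z => qdens k z xk1 * phi z) / e k (fun z => qdens k z xk1).

(* integrates out x_(k-1), ..., x_0 against
   M_k(x_k, dx_(k-1)) ... M_1(x_1, dx_0) *)
Fixpoint bwd e (k : nat) F : (nat -> X) -> R :=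
  if k is k'.+1 then
    fun x => backward_kernel e k' (x k) (fun z => bwd e k' F (upd_coord x k' z))
  else F.

Definition Dop (k n : nat) F (xk : X) : R :=
  bwd eta_flow k (fwd k (n - k) F) (fun=> xk).

Definition centered_F (n : nat) phi x : 'rV[R]_d :=
  (phi (x n) - Qpath n (fun x' => phi (x' n))) *:
  (score_sum n x - componentwise (Qpath n) (score_sum n)).

(* G_(p,n) D_(p,n)(F_n - Q_n(F_n)) / D_(p,n)(1) *)
Definition limit_integrand (p n : nat) phi (xp : X) : 'rV[R]_d :=
  (Gpot p n xp / Dop p n (fun=> 1) xp) *:
  componentwise (fun H => Dop p n H xp)
    (fun x => centered_F n phi x - componentwise (Qpath n) (centered_F n phi)).

Definition Qpath_backward e (n : nat) F : R :=
  e n (fun z => bwd e n F (fun=> z)).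

Definition zeta_backward e (n : nat) phi : 'rV[R]_d :=
  componentwise (Qpath_backward e n)
    (fun x => (phi (x n) - e n phi) *: score_sum n x).

End flow.

Section particles.
Context (R : realType) (d : nat).
Context (dX dY : measure_display) (X : measurableType dX)
  (Y : measurableType dY).
Context (mu : {measure set X -> \bar R}) (m : densities R d X Y).
Context (theta : 'rV[R]_d) (y : nat -> Y).

Definition empirical (N : nat) (s : 'I_N -> X) (phi : X -> R) : R :=
  N%:R^-1 * \sum_(i < N) phi (s i).

Definition mutation_density (N : nat) (n : nat) (s : 'I_N -> X) (x : X) : R :=
  (\sum_(j < N) trans m theta (s j) x * obs m theta (s j) (y n)) /
  (\sum_(j < N) obs m theta (s j) (y n)).

Context (dO : measure_display) (O : measurableType dO) (P : probability O R).
Context (N : nat) (xi : nat -> 'I_N -> {RV P >-> X}).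

Definition past (n : nat) : set (set O) :=
  <<s [set A | exists (k : nat) (i : 'I_N) (B : set X),
         [/\ (k <= n)%N, measurable B & A = xi k i @^-1` B]] >>.

(* The second clause says that, given the particles up to time n, the product
   of the laws of density [mutation_density] is the conditional law of the
   particles at time n + 1. *)
Definition particle_system : Prop :=
  (forall B : 'I_N -> set X, (forall i, measurable (B i)) ->
    P (\bigcap_(i in [set: 'I_N]) (xi 0%N i @^-1` B i)) =
    (\prod_(i < N) \int[mu]_(x in B i) (init m theta x)%:E)%E) /\
  (forall (n : nat) (A : set O) (B : 'I_N -> set X),
    past n A -> (forall i, measurable (B i)) ->
    P (A `&` \bigcap_(i in [set: 'I_N]) (xi n.+1 i @^-1` B i)) =
    (\int[P]_(w in A) \prod_(i < N) \int[mu]_(x in B i)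
       (mutation_density n (fun j => xi n j w) x)%:E)%E).

Definition etaN (w : O) (n : nat) : (X -> R) -> R :=
  empirical (fun i => xi n i w).

Definition zetaN (n : nat) (phi : X -> R) (w : O) : 'rV[R]_d :=
  zeta_backward m theta y (etaN w) n phi.

End particles.

Section gaussian.
Context (R : realType).
Context (dO : measure_display) (O : measurableType dO) (P : probability O R).

(* [normal_prob] with a zero standard deviation is the uniform law on [0, 1],
   so that the degenerate case is treated apart. *)
Definition centered_normal (s2 : R) (B : set R) : \bar R :=
  if s2 == 0 then \d_(0 : R) B else normal_prob 0 (Num.sqrt s2) B.

Definition centered_gaussian (Z : O -> R) (s2 : R) : Prop :=
  measurable_fun setT Z /\
  forall B, measurable B -> P (Z @^-1` B) = centered_normal s2 B.

Definition centered_gaussian_vector (d : nat) (Z : O -> 'rV[R]_d) : Prop :=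
  forall a : 'rV[R]_d, exists2 s2 : R, 0 <= s2 &
    centered_gaussian (fun w => \sum_(j < d) a 0 j * Z w 0 j) s2.

Context (dX : measure_display) (X : measurableType dX).

Definition gaussian_fields (e : nat -> (X -> R) -> R)
    (V : nat -> (X -> R) -> O -> R) : Prop :=
  [/\ forall p phi, bounded_measurable phi ->
        centered_gaussian (V p phi)
          (e p (fun x => phi x ^+ 2) - (e p phi) ^+ 2),
      forall p (a : R) phi psi,
        bounded_measurable phi -> bounded_measurable psi ->
        {ae P, forall w, V p (fun x => a * phi x + psi x) w =
                         a * V p phi w + V p psi w} &
      forall (phi : nat -> X -> R) (p : nat) (B : nat -> set R),
        (forall k, bounded_measurable (phi k)) ->
        (forall k, measurable (B k)) ->
        P (\bigcap_(k in `I_p.+1) (V k (phi k) @^-1` B k)) =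
        (\prod_(k < p.+1) P (V k (phi k) @^-1` B k))%E].

End gaussian.

Definition cvg_in_law (R : realType) (d : nat)
    (dO : nat -> measure_display) (O : forall N, measurableType (dO N))
    (P : forall N, probability (O N) R) (Z : forall N, O N -> 'rV[R]_d)
    (dL : measure_display) (L : measurableType dL) (PL : probability L R)
    (Z' : L -> 'rV[R]_d) : Prop :=
  forall h : 'rV[R]_d -> R, continuous h -> (exists M, forall v, `|h v| <= M) ->
    (fun N => \int[P N]_w h (Z N w)) @ \oo --> \int[PL]_w h (Z' w).

(* Main.v *)
(* Fix a component [t] of the score. The backward recursion
   [T_(p+1) = M_(p+1)(T_p + t_(p+1))] turns the integral of
   [S_n(x_(0:n)) u(x_n) + h(x_n)], with [S_n] the sum of the scores, into
   [e_n(T_n u + h)], and the flow [e_p(T_p Q_(p,n)(u) + H_(p,n)(u,h))], times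
   its normalizer, is conserved by the prediction step, both for the exact and
   for the particle measures [e]. The error of the particle approximation is
   therefore a telescoping sum of sampling errors. Given the past, each of them
   is a centered mean of N independent terms, hence of order N^(-1/2) in L2, so
   that the random functions in it can be replaced by their limits; the cosine
   transform of the sum is then computed one generation at a time, by a second
   order expansion of the cosine in each particle. Convergence of
   [E cos(a.Z + b)] with bounded first moments gives convergence in law, since
   Bernstein polynomials in the variables [sin (v_j / K)] approximate a bounded
   continuous function by trigonometric ones. For the variance, the backward
   kernels and the Doob transforms of the [Q_(p,n)] contract oscillations at a
   fixed rate; once [T_p] is recentered at a reference point, the p-th limit
   function decays geometrically in n - p, uniformly in theta, y and phi. *)
Require Import Defs.
From HB Require Import structures.
From mathcomp Require Import all_boot all_order all_algebra.
From mathcomp Require Import all_classical all_reals all_analysis.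
From mathcomp Require Import measurable_realfun.
From mathcomp Require Import ring lra.
Set Implicit Arguments.
Unset Strict Implicit.
Unset Printing Implicit Defensive.
Import Order.TTheory GRing.Theory Num.Theory.
Import numFieldNormedType.Exports.
Local Open Scope classical_set_scope.
Local Open Scope ring_scope.

(** * Cosine expansions and trigonometric approximation *)

(** Only the variance bound has to be uniform in n, theta and y. The rates in N may depend on all of
    them, so the constants on the particle side grow freely with n (powers of [delta], factors
    [2 ^ n]), and the stability estimates concern the exact flow alone. There the obstacle is that
    the bound on [T_p] grows linearly in p while its oscillation stays bounded, whence the
    recentring. On the particle side the obstacle is that the normalizers and the backward
    statistics are random; but they are determined by the earlier generations, so that freezing them
    at their limits costs only products of two errors of order N^(-1/2). Ratios are treated in the
    same way: the offset [h] is chosen so that the exact mean of [S_n u + h] is zero, which leaves a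
    single first order term in the expansion of the empirical covariance. Cosines of a shifted phase
    keep every integral real: the shift carries the information of the sine. *)

Section cosine_expansion.
Context {R : realType}.

(** By the mean value theorem. Each Taylor inequality below has an earlier one as its derivative,
    starting from the bounds of the sine and the cosine by 1. *)
Lemma ge0_of_derive_ge0 (f df : R -> R) (x : R) :
  (forall t : R, is_derive t (1 : R) f (df t)) -> f 0 = 0 ->
  (forall t, 0 <= t -> 0 <= df t) -> 0 <= x -> 0 <= f x.
Proof.
move=> fd f0 df0 x0.
have cf : {within `[0, x], continuous f}.
  by apply: derivable_within_continuous => t _; exact: ex_derive.
have [c cx] := MVT_segment x0 (fun t _ => fd t) cf.
rewrite f0 !subr0 => ->; apply: mulr_ge0 => //; apply: df0.
by move: cx; rewrite in_itv /= => /andP[].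
Qed.

Lemma one_sub_cos_le (x : R) : 0 <= x -> 1 - cos x <= x.
Proof.
move=> x0; rewrite -subr_ge0.
apply: (@ge0_of_derive_ge0 (fun t => t - (1 - cos t)) (fun t => 1 - sin t) x _ _ _ x0).
- by move=> t; apply: is_derive_eq; ring.
- by rewrite cos0 subrr subr0.
- by move=> t _; rewrite subr_ge0; exact: sin_le1.
Qed.

Lemma sin_le_id (x : R) : 0 <= x -> sin x <= x.
Proof.
move=> x0; rewrite -subr_ge0.
apply: (@ge0_of_derive_ge0 (fun t => t - sin t) (fun t => 1 - cos t) x _ _ _ x0).
- by rewrite sin0 subrr.
- by move=> t _; rewrite subr_ge0 cos_le1.
Qed.

Lemma one_sub_cos_le_sqr (x : R) : 0 <= x -> 1 - cos x <= x ^+ 2 / 2.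
Proof.
move=> x0; rewrite -subr_ge0.
apply: (@ge0_of_derive_ge0 (fun t => t ^+ 2 / 2 - (1 - cos t))
  (fun t => t - sin t) x _ _ _ x0).
- move=> t; apply: is_derive_eq.
  by rewrite /GRing.scale /=; field.
- by rewrite cos0 expr0n /=; ring.
- by move=> t t0; rewrite subr_ge0 sin_le_id.
Qed.

Lemma id_sub_sin_le (x : R) : 0 <= x -> x - sin x <= x ^+ 2 / 2.
Proof.
move=> x0; rewrite -subr_ge0.
apply: (@ge0_of_derive_ge0 (fun t => t ^+ 2 / 2 - (t - sin t))
  (fun t => t - (1 - cos t)) x _ _ _ x0).
- move=> t; apply: is_derive_eq.
  by rewrite /GRing.scale /=; field.
- by rewrite sin0 expr0n /=; ring.
- by move=> t t0; rewrite subr_ge0 one_sub_cos_le.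
Qed.

Lemma id_sub_sin_le_cube (x : R) : 0 <= x -> x - sin x <= x ^+ 3 / 6.
Proof.
move=> x0; rewrite -subr_ge0.
apply: (@ge0_of_derive_ge0 (fun t => t ^+ 3 / 6 - (t - sin t))
  (fun t => t ^+ 2 / 2 - (1 - cos t)) x _ _ _ x0).
- move=> t; apply: is_derive_eq.
  by rewrite /GRing.scale /=; field.
- by rewrite sin0 expr0n /=; ring.
- by move=> t t0; rewrite subr_ge0 one_sub_cos_le_sqr.
Qed.

Lemma cos_sub_quadratic_le (x : R) :
  0 <= x -> cos x - 1 + x ^+ 2 / 2 <= x ^+ 3 / 6.
Proof.
move=> x0; rewrite -subr_ge0.
apply: (@ge0_of_derive_ge0 (fun t => t ^+ 3 / 6 - (cos t - 1 + t ^+ 2 / 2))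
  (fun t => t ^+ 2 / 2 - (t - sin t)) x _ _ _ x0).
- move=> t; apply: is_derive_eq.
  by rewrite /GRing.scale /=; field.
- by rewrite cos0 !expr0n /=; ring.
- by move=> t t0; rewrite subr_ge0 id_sub_sin_le.
Qed.

(** The addition formula isolates the remainders of [cos y] and [sin y], each at most [y ^+ 3 / 6].
    Negative increments follow by changing the signs of both [a] and [x]. *)
Lemma cos_expansion (a x : R) :
  `|cos (a + x) - (cos a - x * sin a - x ^+ 2 / 2 * cos a)| <= `|x| ^+ 3.
Proof.
have key (y b : R) : 0 <= y ->
    `|cos (b + y) - (cos b - y * sin b - y ^+ 2 / 2 * cos b)| <= y ^+ 3.
  move=> y0; rewrite cosD.
  have -> : cos b * cos y - sin b * sin y -
      (cos b - y * sin b - y ^+ 2 / 2 * cos b) =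
    cos b * (cos y - 1 + y ^+ 2 / 2) + sin b * (y - sin y) by ring.
  have h1 : 0 <= cos y - 1 + y ^+ 2 / 2 by have := one_sub_cos_le_sqr y0; lra.
  have h2 : 0 <= y - sin y by rewrite subr_ge0 sin_le_id.
  apply: (le_trans (ler_normD _ _)); rewrite !normrM.
  rewrite (ger0_norm h1) (ger0_norm h2).
  have : `|cos b| * (cos y - 1 + y ^+ 2 / 2) <= y ^+ 3 / 6.
    apply: le_trans (cos_sub_quadratic_le y0).
    by rewrite -[leRHS]mul1r; apply: ler_wpM2r => //; exact: cos_max.
  have : `|sin b| * (y - sin y) <= y ^+ 3 / 6.
    apply: le_trans (id_sub_sin_le_cube y0).
    by rewrite -[leRHS]mul1r; apply: ler_wpM2r => //; exact: sin_max.
  by have := exprn_ge0 3 y0; lra.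
have [x0|x0] := leP 0 x; first by rewrite (ger0_norm x0); exact: key.
have := key (- x) (- a); rewrite oppr_ge0 ltW// => /(_ isT).
by rewrite -opprD !cosN !sinN sqrrN mulrNN (ltr0_norm x0).
Qed.

Lemma cos_lipschitz (x y : R) : `|cos x - cos y| <= `|x - y|.
Proof.
wlog xy : x y / x <= y.
  move=> H; have [xy|yx] := leP x y; first exact: H.
  by rewrite distrC (distrC x); apply: H; exact: ltW.
have cf : {within `[x, y], continuous (@cos R)}.
  by apply: derivable_within_continuous => t _; exact: ex_derive.
have [c _ E] := MVT_segment xy (fun t _ => is_derive_cos t) cf.
rewrite distrC E normrM normrN (distrC x) -[leRHS]mul1r.
by apply: ler_wpM2r => //; exact: sin_max.
Qed.

End cosine_expansion.

Section trigonometric_approximation.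
Context {R : realType} {d : nat}.
Implicit Types (f g h : 'rV[R]_d -> R) (v : 'rV[R]_d).

(** The phase [b] puts the sines in the class, and convergence of [E cos (a.Z + b)] for all [a] and
    [b] passes to the whole class by linearity. *)
Inductive trigpoly : ('rV[R]_d -> R) -> Prop :=
| trigpoly_cos (a : 'rV[R]_d) (b : R) : trigpoly (fun v => cos (\sum_j a 0 j * v 0 j + b))
| trigpoly_lin (c : R) f g :
    trigpoly f -> trigpoly g -> trigpoly (fun v => c * f v + g v).

Lemma trigpoly_cst c : trigpoly (fun=> c).
Proof.
have -> : (fun=> c) = (fun v : 'rV[R]_d =>
    (c - 1) * cos (\sum_j (0 : 'rV[R]_d) 0 j * v 0 j + 0) +
    cos (\sum_j (0 : 'rV[R]_d) 0 j * v 0 j + 0)).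
  apply/funext => v; rewrite big1; last by move=> j _; rewrite mxE mul0r.
  by rewrite addr0 cos0; ring.
by do 2 constructor.
Qed.

Lemma trigpolyZ c f : trigpoly f -> trigpoly (fun v => c * f v).
Proof.
move=> tf; have -> : (fun v => c * f v) = (fun v => c * f v + (fun=> 0) v).
  by apply/funext => v; rewrite addr0.
by constructor => //; exact: trigpoly_cst.
Qed.

(** Product-to-sum formula on the generators, after an induction on each factor. *)
Lemma trigpolyM f g : trigpoly f -> trigpoly g -> trigpoly (fun v => f v * g v).
Proof.
move=> + tg; elim=> [a b|c f1 f2 _ IH1 _ IH2]; last first.
  have -> : (fun v => (c * f1 v + f2 v) * g v) =
      (fun v => c * (f1 v * g v) + f2 v * g v) by apply/funext => v; ring.
  by constructor.
elim: tg => [a' b'|c f1 f2 _ IH1 _ IH2]; last first.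
  have -> : (fun v : 'rV_d => cos (\sum_j a 0 j * v 0 j + b) * (c * f1 v + f2 v)) =
      (fun v => c * (cos (\sum_j a 0 j * v 0 j + b) * f1 v) +
        cos (\sum_j a 0 j * v 0 j + b) * f2 v) by apply/funext => v; ring.
  by constructor.
have -> : (fun v : 'rV_d => cos (\sum_j a 0 j * v 0 j + b) *
                            cos (\sum_j a' 0 j * v 0 j + b')) =
    (fun v => 2^-1 * cos (\sum_j (a + a') 0 j * v 0 j + (b + b')) +
              2^-1 * cos (\sum_j (a - a') 0 j * v 0 j + (b - b'))).
  apply/funext => v.
  have -> : \sum_j (a + a') 0 j * v 0 j + (b + b') =
      (\sum_j a 0 j * v 0 j + b) + (\sum_j a' 0 j * v 0 j + b').
    rewrite addrACA -big_split /=; congr (_ + _).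
    by apply: eq_bigr => j _; rewrite mxE mulrDl.
  have -> : \sum_j (a - a') 0 j * v 0 j + (b - b') =
      (\sum_j a 0 j * v 0 j + b) - (\sum_j a' 0 j * v 0 j + b').
    rewrite opprD addrACA -sumrB /=; congr (_ + _).
    by apply: eq_bigr => j _; rewrite !mxE mulrBl.
  set A := \sum_j _ + b; set B := \sum_j _ + b'.
  by rewrite (cosD A B) (cosB A B); field.
by constructor; [constructor|apply: trigpolyZ; constructor].
Qed.

(** A trigonometric polynomial with values in [0, 1], hence usable as a success probability in
    [bernstein]. *)
Lemma trigpoly_sin_coord c j : trigpoly (fun v => (1 + sin (c * v 0 j)) / 2).
Proof.
have -> : (fun v => (1 + sin (c * v 0 j)) / 2) = (fun v : 'rV[R]_d =>
    2^-1 * cos (\sum_i (c *: delta_mx 0 j : 'rV[R]_d) 0 i * v 0 i + (- (pi / 2))) +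
    2^-1).
  apply/funext => v; rewrite (bigD1 j)//= big1.
    by rewrite !mxE !eqxx mulr1 addr0 cosBpihalf; ring.
  by move=> i ij; rewrite !mxE (negbTE ij) mulr0 mul0r.
by constructor; [constructor|exact: trigpoly_cst].
Qed.

(* Bernstein's operator in random walk form: [bernstein u l f k] is the mean of
   f at the end of the walk that starts at k and, for each entry j of l,
   increments the coordinate j with probability [u j]. *)
Fixpoint bernstein (u : 'I_d -> R) (l : seq 'I_d) (f : ('I_d -> nat) -> R) :
    ('I_d -> nat) -> R :=
  if l is j :: l' then
    fun k => u j * bernstein u l' f (fun i => k i + (i == j))%N +
             (1 - u j) * bernstein u l' f k
  else f.

Section bernstein_theory.
Variables (u : 'I_d -> R).
Hypothesis u01 : forall j, 0 <= u j <= 1.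
Implicit Types (l : seq 'I_d) (k : 'I_d -> nat) (F G : ('I_d -> nat) -> R).

Lemma bernstein_lin l c F G k :
  bernstein u l (fun k => c * F k + G k) k =
  c * bernstein u l F k + bernstein u l G k.
Proof. by elim: l k => //= j l IH k; rewrite !IH; ring. Qed.

Lemma bernstein_cst l c k : bernstein u l (fun=> c) k = c.
Proof. by elim: l k => //= j l IH k; rewrite !IH; ring. Qed.

Lemma le_bernstein l F G k : (forall k, F k <= G k) ->
  bernstein u l F k <= bernstein u l G k.
Proof.
move=> FG; elim: l k => //= j l IH k; have /andP[u0 u1] := u01 j.
by apply: lerD; apply: ler_wpM2l => //; rewrite subr_ge0.
Qed.

Lemma bernstein_sum (I : Type) (r : seq I) l (F : I -> ('I_d -> nat) -> R) k :
  bernstein u l (fun k => \sum_(i <- r) F i k) k =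
  \sum_(i <- r) bernstein u l (F i) k.
Proof.
elim: r => [|i r IH].
  rewrite big_nil -[RHS](bernstein_cst l 0 k); congr (bernstein _ _ _ _).
  by apply/funext => k'; rewrite big_nil.
rewrite big_cons -IH -[X in X + _]mul1r -bernstein_lin.
by congr (bernstein _ _ _ _); apply/funext => k'; rewrite big_cons mul1r.
Qed.

(** Squared bias plus variance: coordinate [i] ends at [k i] plus a binomial variable with
    [count_mem i l] trials. *)
Lemma bernstein_sqr l i a k :
  bernstein u l (fun k => ((k i)%:R - a) ^+ 2) k =
  ((k i)%:R + (count_mem i l)%:R * u i - a) ^+ 2 +
  (count_mem i l)%:R * u i * (1 - u i).
Proof.
elim: l k => [|j l IH] k /=; first by rewrite !mul0r !addr0.
rewrite !IH (eq_sym j); case: (i =P j) => [->|_] /=.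
  by rewrite !natrD; move: (k j)%:R (count_mem j l)%:R => x c; ring.
by rewrite addn0 add0n; move: (k i)%:R (count_mem i l)%:R => x c; ring.
Qed.

End bernstein_theory.

Lemma trigpoly_bernstein (u : 'rV[R]_d -> 'I_d -> R) l F k :
  (forall j, trigpoly (fun v => u v j)) ->
  trigpoly (fun v => bernstein (u v) l F k).
Proof.
move=> tu; elim: l k => [|j l IH] k /=; first exact: trigpoly_cst.
have -> : (fun v => u v j * bernstein (u v) l F (fun i => k i + (i == j))%N +
              (1 - u v j) * bernstein (u v) l F k) =
   (fun v => 1 * (u v j * bernstein (u v) l F (fun i => k i + (i == j))%N) +
             ((-1 * u v j + 1) * bernstein (u v) l F k)).
  by apply/funext => v; ring.
apply: trigpoly_lin; apply: trigpolyM => //.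
by apply: trigpoly_lin => //; exact: trigpoly_cst.
Qed.

(** Compactness of the box turns the pointwise moduli of continuity into one radius. The radii are
    halved to leave room for going from a centre [v0] of the cover to [v] and then to [w], which may
    lie outside the box. *)
Lemma box_uniform_continuity h (K e : R) : continuous h -> 0 < e ->
  exists2 r : R, 0 < r & forall v w : 'rV[R]_d,
    (forall j, `|v 0 j| <= K) -> (forall j, `|v 0 j - w 0 j| < r) ->
    `|h v - h w| <= e.
Proof.
move=> ch e0.
pose B := [set v : 'rV[R]_d | forall i, `[-K, K]%classic (v ord0 i)].
have cB : compact B.
  by apply: (@rV_compact R d (fun=> `[-K, K]%classic)) => i; exact: segment_compact.
pose Pr (r : R) (v : 'rV[R]_d) := forall w : 'rV[R]_d,
   (forall j, `|v 0 j - w 0 j| < r) -> `|h v - h w| <= e.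
have H : \forall r \near 0^'+, B `<=` Pr r.
  apply: ((compact_near_coveringP B).1 cB R _ Pr) => v0 _.
  have /cvgrPdist_lt/(_ (e / 2)) := ch v0.
  have -> : 0 < e / 2 by rewrite divr_gt0.
  move=> /(_ isT)/nbhs_ballP[r /= r0 Hr].
  exists (ball v0 (r / 2), [set s | s < r / 2]) => /=.
    split; first by apply: nbhsx_ballx; rewrite divr_gt0.
    by apply: nbhs_right_lt; rewrite divr_gt0.
  move=> [v s] [/= [_ bv] sr] w vw.
  have rr : r / 2 <= r by lra.
  have h1 : `|h v0 - h v| < e / 2.
    apply: Hr; split => // i j; exact: lt_le_trans (bv i j) _.
  have h2 : `|h v0 - h w| < e / 2.
    apply: Hr; split => // i j; rewrite /ball /= ord1.
    have -> : v0 0 j - w 0 j = (v0 0 j - v 0 j) + (v 0 j - w 0 j) by ring.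
    apply: le_lt_trans (ler_normD _ _) _.
    have := bv 0 j; have := vw j; rewrite /ball /=; lra.
  have -> : h v - h w = (h v0 - h w) - (h v0 - h v) by ring.
  by apply: le_trans (ler_normB _ _) _; lra.
have [r /= r0 Hr] := H.
exists (r / 2); first by rewrite divr_gt0.
move=> v w vK vw; apply: (Hr (r / 2)) => //=.
- by rewrite sub0r normrN gtr0_norm ?divr_gt0//; lra.
- by rewrite divr_gt0.
- by move=> i; rewrite /= in_itv /= -ler_norml.
Qed.

(** Mean value theorem with [cos c >= cos 1] on [-1, 1]. It converts closeness of the sines, which
    the random walk controls, into closeness of the arguments. *)
Lemma sin_expansive (a b : R) : `|a| <= 1 -> `|b| <= 1 ->
  `|a - b| * cos 1 <= `|sin a - sin b|.
Proof.
wlog ab : a b / a <= b.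
  move=> H a1 b1; have [ab|ba] := leP a b; first exact: H.
  by rewrite distrC (distrC (sin a)); apply: H => //; exact: ltW.
move=> a1 b1.
have cf : {within `[a, b], continuous (@sin R)}.
  by apply: derivable_within_continuous => t _; exact: ex_derive.
have [c] := MVT_segment ab (fun t _ => is_derive_sin t) cf.
rewrite in_itv /= => /andP[ac cb] E.
rewrite distrC [leRHS]distrC E normrM mulrC; apply: ler_wpM2r => //.
apply: le_trans (ler_norm _); rewrite -(cos_norm c).
have c1 : `|c| <= 1.
  by move: a1 b1; rewrite !ler_norml => /andP[? ?] /andP[? ?]; apply/andP; split; lra.
have p1 : (1 : R) <= pi by apply: le_trans (pi_ge2 R); rewrite ler1n.
rewrite leNgt ltr_cos ?in_itv /= ?normr_ge0 ?ler01 ?p1 ?(le_trans c1)//.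
by rewrite -leNgt.
Qed.

End trigonometric_approximation.

Section trigonometric_approximation_of_continuous_functions.
Context {R : realType} {d : nat}.
Implicit Types (h : 'rV[R]_d -> R) (v : 'rV[R]_d).

Let s1 : R := sin 1.

Let s1_le1 : s1 <= 1. Proof. exact: sin_le1. Qed.

Let s1_ge0 : 0 <= s1.
Proof.
by apply/ltW/sin2_gt0; rewrite ltr01 ltr1n.
Qed.

Let asin_bound (y : R) : `|y| <= s1 -> `|asin y| <= 1 /\ sin (asin y) = y.
Proof.
move=> ys; have y1 : -1 <= y <= 1 by rewrite -ler_norml (le_trans ys).
have sy : sin (asin y) = y by apply: asinK; rewrite in_itv.
split => //.
have yI : asin y \in `[- (pi / 2), (pi / 2)].
  by rewrite in_itv /= asin_geNpi2// asin_lepi2.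
have p1 := pihalf_ge1 R.
have p2 : - (pi / 2) <= -1 :> R by rewrite lerN2.
have p3 : - (pi / 2) <= 1 :> R by apply: le_trans p2 _; lra.
have p4 : -1 <= pi / 2 :> R by apply: le_trans _ p1; lra.
move: ys; rewrite ler_norml => /andP[ya yb].
rewrite ler_norml; apply/andP; split; rewrite leNgt -ltr_sin ?in_itv /= ?p1 ?p2 ?p3 ?p4//.
- by rewrite sy sinN -leNgt.
- by rewrite sy -leNgt.
Qed.

(** The frequencies of the walk may leave the interval [- sin 1, sin 1], on which [asin] takes
    values in [-1, 1]; projecting onto it does not increase the distance to its points. *)
Let clamp (y : R) := Num.max (- s1) (Num.min s1 y).

Let clamp_le y : `|clamp y| <= s1.
Proof.
rewrite ler_norml /clamp le_max lexx /= ge_max ge_min lexx /= andbT.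
by have := s1_ge0; lra.
Qed.

Let clamp_near (x y : R) : `|x| <= s1 -> `|x - clamp y| <= `|x - y|.
Proof.
rewrite ler_norml => /andP[xa xb]; rewrite /clamp.
have [sy|ys] := leP s1 y.
  rewrite max_r; last by lra.
  by rewrite distrC (distrC x) !ger0_norm; lra.
have [sy|ys'] := leP (- s1) y; first by [].
by rewrite !ger0_norm; lra.
Qed.

(** Holds because [bernstein] is monotone and linear and fixes the constants. *)
Lemma bernstein_near (u : 'I_d -> R) l F G c k : (forall j, 0 <= u j <= 1) ->
  (forall k, `|F k - c| <= G k) ->
  `|bernstein u l F k - c| <= bernstein u l G k.
Proof.
move=> u01 FG.
have shift (H : _ -> R) a b : bernstein u l (fun k => a * H k + b) k =
    a * bernstein u l H k + b.
  by rewrite bernstein_lin bernstein_cst.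
rewrite ler_norml; apply/andP; split.
  have := shift G (-1) c; rewrite lerBrDr mulN1r => <-.
  apply: le_bernstein => // k'; have := FG k'.
  by rewrite ler_norml => /andP[+ _]; lra.
have := shift G 1 c; rewrite mul1r lerBlDr => <-.
apply: le_bernstein => // k'; have := FG k'.
by rewrite ler_norml => /andP[_]; lra.
Qed.

(** Bernstein's proof of the Weierstrass theorem, with Chebyshev's inequality. The bound by [M]
    holds on the whole space and not only on the box, because the approximation averages values of
    [h]; it controls the tails later. *)
Lemma trig_approx h (M K e : R) : continuous h -> (forall v, `|h v| <= M) ->
  0 < K -> 0 < e ->
  exists tau, [/\ trigpoly tau, forall v, `|tau v| <= M &
    forall v, (forall j, `|v 0 j| <= K) -> `|tau v - h v| <= e].
Proof.
move=> ch hM K0 e0.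
have e20 : 0 < e / 2 by rewrite divr_gt0.
have [r r0 Hr] := box_uniform_continuity K ch e20.
have c10 : 0 < cos 1 :> R := cos1_gt0 R.
(* Deviations of the frequencies below [rho] move the node by less than [r]: [near_w] loses the
   factor [2 * K / cos 1]. *)
pose rho := r * cos 1 / (2 * K).
have rho0 : 0 < rho by rewrite divr_gt0 ?mulr_gt0.
have M0 : 0 <= M := le_trans (normr_ge0 _) (hM 0).
(* If some frequency deviates by [rho] or more, then [D] times the sum of the squared deviations is
   at least the trivial bound [2 * M]. *)
pose D := 2 * M / rho ^+ 2.
have D0 : 0 <= D.
  by apply: divr_ge0; [exact: mulr_ge0|exact: sqr_ge0].
(* Each squared deviation has mean at most [1 / m], so the [d] coordinates contribute at most
   [D * d / m], which this choice makes at most [e / 2]. *)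
pose m := (Num.truncn (D * d%:R * 2 / e)).+1.
have m0 : 0 < m%:R :> R by rewrite ltr0n.
have mD : D * d%:R / m%:R <= e / 2.
  rewrite ler_pdivrMr//.
  by have := truncnS_gt (D * d%:R * 2 / e); rewrite ltr_pdivrMr// -/m; lra.
pose u v j := (1 + sin (K^-1 * v 0 j)) / 2.
have u01 v j : 0 <= u v j <= 1.
  by rewrite /u; have := sin_le1 (K^-1 * v 0 j); have := sin_geN1 (K^-1 * v 0 j); lra.
(* The node attached to the frequencies [k / m]: the inverse of [v |-> (1 + sin (v / K)) / 2] in
   each coordinate. *)
pose w (k : 'I_d -> nat) : 'rV[R]_d :=
  \row_j (K * asin (clamp (2 * (k j)%:R / m%:R - 1))).
pose l := flatten (nseq m (enum 'I_d)).
have cl i : count_mem i l = m.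
  rewrite /l; elim: m {m0 mD w l} => //= n IH.
  by rewrite count_cat IH count_uniq_mem ?enum_uniq// mem_enum.
exists (fun v => bernstein (u v) l (fun k => h (w k)) (fun=> 0%N)); split.
- by apply: trigpoly_bernstein => j; exact: trigpoly_sin_coord.
- move=> v; rewrite -[X in `|X|]subr0 -[leRHS](bernstein_cst (u v) l _ (fun=> 0%N)).
  by apply: bernstein_near => // k; rewrite subr0.
move=> v vK.
have near_w k j : `|v 0 j - w k 0 j| <= 2 * K / cos 1 * `|(k j)%:R / m%:R - u v j|.
  rewrite mxE; set y := 2 * _ / _ - 1.
  have [a1 sa] := asin_bound (clamp_le y).
  have b1 : `|K^-1 * v 0 j| <= 1.
    by rewrite normrM normfV (gtr0_norm K0) mulrC ler_pdivrMr// mul1r.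
  have -> : v 0 j - K * asin (clamp y) = K * (K^-1 * v 0 j - asin (clamp y)).
    by rewrite mulrBr mulVKf// gt_eqF.
  rewrite normrM (gtr0_norm K0) -(ler_pM2r c10) -mulrA.
  have -> : 2 * K / cos 1 * `|(k j)%:R / m%:R - u v j| * cos 1 =
      K * (2 * `|(k j)%:R / m%:R - u v j|) by field; rewrite gt_eqF.
  apply: ler_wpM2l; first exact: ltW.
  apply: le_trans (sin_expansive b1 a1) _; rewrite sa.
  have sb : `|sin (K^-1 * v 0 j)| <= s1.
    have p1 := pihalf_ge1 R.
    have p2 : - (pi / 2) <= -1 :> R by rewrite lerN2.
    have p3 : - (pi / 2) <= 1 :> R by apply: le_trans p2 _; lra.
    have p4 : -1 <= pi / 2 :> R by apply: le_trans _ p1; lra.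
    move: b1; rewrite ler_norml => /andP[ba bb].
    rewrite ler_norml -sinN; apply/andP; split.
      rewrite leNgt ltr_sin ?in_itv /= ?p1 ?p2 ?p3 ?p4 -?leNgt//.
      by rewrite (le_trans p2 ba) (le_trans bb p1).
    rewrite leNgt ltr_sin ?in_itv /= ?p1 ?p2 ?p3 ?p4 -?leNgt//.
    by rewrite (le_trans p2 ba) (le_trans bb p1).
  apply: le_trans (clamp_near _ sb) _.
  rewrite -[2]gtr0_norm// -normrM distrC /y /u le_eqVlt; apply/orP; left.
  by apply/eqP; congr (`| _ |); field; rewrite gt_eqF.
(* One majorant for both cases: the modulus of continuity when all frequencies are close to their
   means, Chebyshev's inequality otherwise. *)
apply: (@le_trans _ _ (bernstein (u v) l
   (fun k => D * \sum_j ((k j)%:R / m%:R - u v j) ^+ 2 + e / 2) (fun=> 0%N))).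
  apply: bernstein_near => // k.
  have [/forallP Hk|] := boolP [forall j, `|(k j)%:R / m%:R - u v j| < rho].
    apply: (@le_trans _ _ (e / 2)).
      rewrite distrC; apply: Hr => // j; apply: le_lt_trans (near_w k j) _.
      rewrite -ltr_pdivlMl ?divr_gt0 ?mulr_gt0//; apply: lt_le_trans (Hk j) _.
      by rewrite /rho invf_div; lra.
    by rewrite lerDr mulr_ge0// sumr_ge0// => j _; exact: sqr_ge0.
  rewrite negb_forall => /existsP[j]; rewrite -leNgt => Hj.
  apply: (@le_trans _ _ (2 * M)).
    by apply: le_trans (ler_normB _ _) _; rewrite mulr2n mulrDl mul1r lerD.
  rewrite -[leLHS]addr0; apply: lerD; last exact: ltW.
  rewrite /D -mulrA; apply: ler_peMr; first by rewrite mulr_ge0.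
  rewrite mulrC ler_pdivlMr ?exprn_gt0// mul1r (bigD1 j)//=.
  rewrite -[leLHS]addr0; apply: lerD; last by apply: sumr_ge0 => i _; exact: sqr_ge0.
  by rewrite -[leRHS]real_normK ?num_real// lerXn2r ?nnegrE// ltW.
rewrite bernstein_lin bernstein_cst bernstein_sum.
suff H : D * \sum_j bernstein (u v) l (fun k => ((k j)%:R / m%:R - u v j) ^+ 2)
     (fun=> 0%N) <= D * d%:R / m%:R by lra.
rewrite -mulrA; apply: ler_wpM2l => //.
have -> : d%:R / m%:R = \sum_(j < d) m%:R^-1 :> R.
  by rewrite sumr_const card_ord mulr_natl.
apply: ler_sum => j _.
have -> : (fun k : 'I_d -> nat => ((k j)%:R / m%:R - u v j) ^+ 2) =
    (fun k => m%:R ^- 2 * ((k j)%:R - m%:R * u v j) ^+ 2 + (fun=> 0) k).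
  by apply/funext => k; rewrite addr0; field; rewrite gt_eqF.
rewrite bernstein_lin bernstein_cst bernstein_sqr cl addr0 mulr0n add0r subrr.
rewrite expr0n add0r mulrA; have /andP[ua ub] := u01 v j.
have -> : m%:R ^- 2 * (m%:R * u v j) * (1 - u v j) =
  m%:R^-1 * (u v j * (1 - u v j)) by field; rewrite gt_eqF.
rewrite -[leRHS]mulr1; apply: ler_wpM2l; first by rewrite invr_ge0 ltW.
by nra.
Qed.

End trigonometric_approximation_of_continuous_functions.

(** * Bounded measurable functions, densities and kernels *)

Section densities_of_measures.
Context d (T : measurableType d) (R : realType).
Variable m : {measure set T -> \bar R}.

Section density_measure.
Variable w : T -> \bar R.
Hypotheses (mw : measurable_fun setT w) (w0 : forall x, (0 <= w x)%E).

(** The two proofs are arguments so that the structure of measure can be attached to this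
    function. *)
Definition density_measure (_ : measurable_fun setT w)
  (_ : forall x, (0 <= w x)%E) (A : set T) := (\int[m]_(x in A) w x)%E.

Let density0 : density_measure mw w0 set0 = 0%E.
Proof. by rewrite /density_measure integral_set0. Qed.

Let density_ge0 A : (0 <= density_measure mw w0 A)%E.
Proof. exact: integral_ge0. Qed.

Let density_sigma_additive : semi_sigma_additive (density_measure mw w0).
Proof. exact: semi_sigma_additive_nng_induced. Qed.

HB.instance Definition _ := isMeasure.Build _ _ _
  (density_measure mw w0) density0 density_ge0 density_sigma_additive.

End density_measure.

Import HBNNSimple.
Local Open Scope ereal_scope.

Lemma ge0_integral_density (m1 : {measure set T -> \bar R}) (w : T -> R)
    (f : T -> \bar R) :
  measurable_fun setT w -> (forall x, 0 <= w x)%R ->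
  (forall A, measurable A -> m1 A = \int[m]_(x in A) (w x)%:E) ->
  measurable_fun setT f -> (forall x, 0 <= f x) ->
  \int[m1]_x f x = \int[m]_x (f x * (w x)%:E).
Proof.
move=> mw' w0' m1E mf f0.
have mw : measurable_fun setT (EFin \o w) by exact/measurable_EFinP.
have w0 x : 0 <= (w x)%:E by rewrite lee_fin.
have indicE (A : set T) : measurable A ->
    \int[m1]_x (\1_A x)%:E = \int[m]_x ((\1_A x)%:E * (w x)%:E).
  move=> mA; rewrite integral_indic// setIT m1E// integral_mkcond.
  apply: eq_integral => x _; rewrite patchE indicE.
  by case: ifPn => xA; rewrite /= ?mul1e ?mul0e.
have sfunE (h : {nnsfun T >-> R}) :
    \int[m1]_x (h x)%:E = \int[m]_x ((h x)%:E * (w x)%:E).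
  transitivity (\sum_(r \in range h) r%:E * \int[m1]_x (\1_(h @^-1` [set r]) x)%:E).
    under eq_integral do rewrite fimfunE -fsumEFin//.
    rewrite ge0_integral_fsum//; last 2 first.
    - by move=> r; exact/measurable_EFinP/measurable_funM.
    - by move=> r x _; rewrite EFinM nnfun_muleindic_ge0.
    by apply: eq_fsbigr => r _; rewrite integralZl_indic_nnsfun.
  transitivity (\int[m]_x (\sum_(r \in range h)
      (r%:E * ((\1_(h @^-1` [set r]) x)%:E * (w x)%:E)))).
    rewrite ge0_integral_fsum//; last 2 first.
    - move=> r; apply: measurable_funeM; apply: emeasurable_funM => //.
      exact/measurable_EFinP.
    - move=> r x _; rewrite muleA; apply: mule_ge0 => //.
      by rewrite nnfun_muleindic_ge0.
    apply: eq_fsbigr => r _; rewrite indicE//.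
    have [r0|r0] := leP 0%R r.
      rewrite ge0_integralZl//.
        by apply: emeasurable_funM => //; exact/measurable_EFinP.
      by move=> x _; apply: mule_ge0 => //; rewrite lee_fin.
    (* A negative value of a nonnegative simple function has an empty level set. *)
    rewrite integral0_eq ?mule0; last first.
      by move=> x _; rewrite preimage_nnfun0// indic0 mul0e.
    by rewrite integral0_eq// => x _; rewrite preimage_nnfun0// indic0 mul0e mule0.
  apply: eq_integral => x _; rewrite [in RHS]fimfunE -fsumEFin//.
  rewrite ge0_mule_fsuml; last by move=> r; rewrite EFinM nnfun_muleindic_ge0.
  by apply: eq_fsbigr => r _; rewrite EFinM muleA.
pose f_ := nnsfun_approx measurableT mf.
have nd_f x : {homo (fun n => (f_ n x)%:E) : a b / (a <= b)%N >-> a <= b}.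
  by move=> a b ab; rewrite lee_fin; exact/lefP/nd_nnsfun_approx.
transitivity (\int[m1]_x (lim ((f_ n x)%:E @[n --> \oo]))).
  by apply/eq_integral => x _; apply/esym/cvg_lim => //=; exact: cvg_nnsfun_approx.
rewrite monotone_convergence//; last 2 first.
  by move=> n; exact/measurable_EFinP.
  by move=> n x _; rewrite lee_fin.
under eq_fun do rewrite sfunE.
rewrite -monotone_convergence//; last 3 first.
- by move=> n; apply: emeasurable_funM => //; exact/measurable_EFinP.
- by move=> n x _; apply: mule_ge0 => //; rewrite lee_fin.
- by move=> x _ a b ab; apply: lee_wpmul2r => //; exact: nd_f.
apply: eq_integral => x _; apply/cvg_lim => //.
have H : (f_ n x)%:E @[n --> \oo] --> f x by exact: cvg_nnsfun_approx.
by apply: cvgeZr.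
Qed.

End densities_of_measures.

Section bounded_measurable_functions.
Context d (T : measurableType d) (R : realType).
Implicit Types f g : T -> R.

Lemma bm_measurable f : bounded_measurable f -> measurable_fun setT f.
Proof. by case. Qed.

Lemma bm_bound f : bounded_measurable f ->
  exists2 M, 0 <= M & forall x, `|f x| <= M.
Proof.
by move=> [_ [M fM]]; exists M => //; exact: le_trans (fM point).
Qed.

Lemma bm_cst c : bounded_measurable (fun _ : T => c : R).
Proof. by split; [exact: measurable_cst|exists `|c|]. Qed.

Lemma bmD f g : bounded_measurable f -> bounded_measurable g ->
  bounded_measurable (fun x => f x + g x).
Proof.
move=> [mf [M fM]] [mg [K gK]]; split; first exact: measurable_funD.
exists (M + K) => x; exact: le_trans (ler_normD _ _) (lerD (fM x) (gK x)).
Qed.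

Lemma bmN f : bounded_measurable f -> bounded_measurable (fun x => - f x).
Proof.
move=> [mf [M fM]]; split; first exact: measurable_funN.
by exists M => x; rewrite normrN.
Qed.

Lemma bmB f g : bounded_measurable f -> bounded_measurable g ->
  bounded_measurable (fun x => f x - g x).
Proof. by move=> bf bg; apply: bmD => //; exact: bmN. Qed.

Lemma bmM f g : bounded_measurable f -> bounded_measurable g ->
  bounded_measurable (fun x => f x * g x).
Proof.
move=> [mf [M fM]] [mg [K gK]]; split; first exact: measurable_funM.
by exists (M * K) => x; rewrite normrM; apply: ler_pM.
Qed.

Lemma bmZ c f : bounded_measurable f -> bounded_measurable (fun x => c * f x).
Proof. by move=> bf; apply: bmM => //; exact: bm_cst. Qed.

Lemma bmX f n : bounded_measurable f -> bounded_measurable (fun x => f x ^+ n).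
Proof.
move=> bf; elim: n => [|n IH].
  by under eq_fun do rewrite expr0; exact: bm_cst.
by under eq_fun do rewrite exprS; exact: bmM.
Qed.

Lemma bm_sum (I : Type) (r : seq I) (F : I -> T -> R) :
  (forall i, bounded_measurable (F i)) ->
  bounded_measurable (fun x => \sum_(i <- r) F i x).
Proof.
move=> bF; elim: r => [|i r IH].
  by under eq_fun do rewrite big_nil; exact: bm_cst.
by under eq_fun do rewrite big_cons; exact: bmD.
Qed.

Lemma bm_norm f : bounded_measurable f -> bounded_measurable (fun x => `|f x|).
Proof.
move=> [mf [M fM]]; split; first exact: measurableT_comp.
by exists M => x; rewrite normr_id.
Qed.

Lemma measurable_funV f : measurable_fun setT f -> (forall x, 0 < f x) ->
  measurable_fun setT (fun x => (f x)^-1).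
Proof.
move=> mf f0; rewrite (_ : (fun x => _) = fun x => f x `^ (-1)).
  by apply: (@measurableT_comp _ _ _ _ _ _ (fun r => powR r (-1))) => //; exact: measurable_powR.
by apply/funext => x; rewrite powR_inv1// ltW.
Qed.

Lemma bm_div f g b : bounded_measurable f -> measurable_fun setT g -> 0 < b ->
  (forall x, b <= g x) -> bounded_measurable (fun x => f x / g x).
Proof.
move=> bf mg b0 gb; apply: bmM => //; split.
  by apply: measurable_funV => // x; exact: lt_le_trans (gb x).
exists b^-1 => x; have gx0 : 0 < g x := lt_le_trans b0 (gb x).
rewrite ger0_norm; first by rewrite lef_pV2.
by rewrite invr_ge0 ltW.
Qed.

Lemma bm_cos f : measurable_fun setT f -> bounded_measurable (fun x => cos (f x)).
Proof.
move=> mf; split; last by exists 1 => x; exact: cos_max.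
apply: measurableT_comp => //; apply: continuous_measurable_fun.
exact: continuous_cos.
Qed.

End bounded_measurable_functions.

Lemma bm_comp d d' (T : measurableType d) (T' : measurableType d') (R : realType)
  (f : T' -> R) (g : T -> T') : bounded_measurable f -> measurable_fun setT g ->
  bounded_measurable (fun x => f (g x)).
Proof.
move=> [mf [M fM]] mg; split; first exact: measurableT_comp mg.
by exists M => x.
Qed.

Section Rintegral_of_bounded_measurable.
Context d (T : measurableType d) (R : realType).

Lemma Rintegral_lin (m : {measure set T -> \bar R}) (a : R) (f g : T -> R) :
  m.-integrable setT (EFin \o f) -> m.-integrable setT (EFin \o g) ->
  \int[m]_x (a * f x + g x) = a * \int[m]_x f x + \int[m]_x g x.
Proof.
move=> intf intg; rewrite RintegralD// ?RintegralZl//.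
have -> : (EFin \o (fun x => a * f x)) = (fun x => a%:E * (EFin \o f) x)%E by [].
exact: integrableZl.
Qed.

Lemma integrable_weight (m : {measure set T -> \bar R}) (w f : T -> R) :
  m.-integrable setT (EFin \o w) -> bounded_measurable f ->
  m.-integrable setT (EFin \o (fun x => w x * f x)).
Proof.
move=> iw [mf [M fM]].
have -> : EFin \o (fun x => w x * f x) = ((EFin \o w) \* (EFin \o f))%E by [].
apply: integrableMl => //; exists M; split; first exact: num_real.
by move=> r Mr x _; exact: le_trans (fM x) (ltW Mr).
Qed.

Variable m : {finite_measure set T -> \bar R}.
Implicit Types f g : T -> R.

Lemma bm_integrable f : bounded_measurable f -> m.-integrable setT (EFin \o f).
Proof.
move=> [mf [M fM]]; apply: measurable_bounded_integrable => //.
  by rewrite ltey_eq fin_num_measure.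
exists M; split; first exact: num_real.
by move=> r Mr x _; exact: le_trans (fM x) (ltW Mr).
Qed.

Lemma bm_RintegralD f g : bounded_measurable f -> bounded_measurable g ->
  \int[m]_x (f x + g x) = \int[m]_x f x + \int[m]_x g x.
Proof. by move=> *; apply: RintegralD => //; exact: bm_integrable. Qed.

Lemma bm_RintegralB f g : bounded_measurable f -> bounded_measurable g ->
  \int[m]_x (f x - g x) = \int[m]_x f x - \int[m]_x g x.
Proof. by move=> *; apply: RintegralB => //; exact: bm_integrable. Qed.

Lemma bm_RintegralZ a f : bounded_measurable f ->
  \int[m]_x (a * f x) = a * \int[m]_x f x.
Proof. by move=> *; apply: RintegralZl => //; exact: bm_integrable. Qed.

Lemma bm_Rintegral_sum (I : Type) (r : seq I) (F : I -> T -> R) :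
  (forall i, bounded_measurable (F i)) ->
  \int[m]_x (\sum_(i <- r) F i x) = \sum_(i <- r) \int[m]_x F i x.
Proof.
move=> bF; elim: r => [|i r IH].
  under eq_Rintegral do rewrite big_nil.
  by rewrite big_nil Rintegral_cst// mul0r.
under eq_Rintegral do rewrite big_cons.
by rewrite big_cons bm_RintegralD// ?IH//; exact: bm_sum.
Qed.

Lemma bm_le_Rintegral f g : bounded_measurable f -> bounded_measurable g ->
  (forall x, f x <= g x) -> \int[m]_x f x <= \int[m]_x g x.
Proof. by move=> *; apply: le_Rintegral => //; exact: bm_integrable. Qed.

Lemma bm_norm_Rintegral f : bounded_measurable f ->
  `|\int[m]_x f x| <= \int[m]_x `|f x|.
Proof. by move=> ?; apply: le_normr_Rintegral => //; exact: bm_integrable. Qed.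

End Rintegral_of_bounded_measurable.

Section probability_expectation.
Context d (T : measurableType d) (R : realType) (P : probability T R).
Implicit Types f g : T -> R.

Lemma Rintegral_prob_cst (c : R) : \int[P]_x c = c.
Proof.
have P1 : (P : {measure set T -> \bar R}) setT = 1%E := probability_setT P.
by rewrite /Rintegral integral_cst// P1 mule1. Qed.

Lemma expectation_norm_le f M : bounded_measurable f -> (forall x, `|f x| <= M) ->
  `|\int[P]_x f x| <= M.
Proof.
move=> bf fM; apply: le_trans (bm_norm_Rintegral P bf) _.
rewrite -[leRHS]Rintegral_prob_cst; apply: bm_le_Rintegral => //.
- exact: bm_norm.
- exact: bm_cst.
Qed.

End probability_expectation.

Section weighted_kernel.
Context d d' (S : measurableType d) (X : measurableType d') (R : realType).
Variables (mu : {sigma_finite_measure set X -> \bar R}) (k : S * X -> R) (B : R).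
Hypotheses (mk : measurable_fun setT k) (k0 : forall z, 0 <= k z).
Hypothesis kB : forall s, (\int[mu]_x (k (s, x))%:E <= B%:E)%E.
Implicit Types f g : S * X -> R.

(** [f] sees the state [s] as well: with [s] the past and [k] a conditional density, this is the
    conditional expectation of a function of the past and of the new variable. *)
Definition wkernel f (s : S) : R := \int[mu]_x (k (s, x) * f (s, x)).

Lemma bm_section f s : bounded_measurable f -> bounded_measurable (fun x => f (s, x)).
Proof. by move=> bf; apply: bm_comp bf _; exact: pair1_measurable. Qed.

Lemma wkernel_weight_integrable s :
  mu.-integrable setT (EFin \o (fun x => k (s, x))).
Proof.
apply/integrableP; split.
  by apply/measurable_EFinP; apply: measurableT_comp mk _; exact: pair1_measurable.
apply: le_lt_trans (ltry B); apply: le_trans (kB s).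
by rewrite le_eqVlt; apply/orP; left; apply/eqP/eq_integral => x _ /=; rewrite ger0_norm.
Qed.

Lemma wkernel_integrable f s : bounded_measurable f ->
  mu.-integrable setT (EFin \o (fun x => k (s, x) * f (s, x))).
Proof.
move=> bf; apply: integrable_weight; first exact: wkernel_weight_integrable.
exact: bm_section.
Qed.

Lemma wkernel_lin a f g s : bounded_measurable f -> bounded_measurable g ->
  wkernel (fun z => a * f z + g z) s = a * wkernel f s + wkernel g s.
Proof.
move=> bf bg; rewrite /wkernel -Rintegral_lin; [|exact: wkernel_integrable..].
by apply: eq_Rintegral => x _; ring.
Qed.

Lemma le_wkernel f g s : bounded_measurable f -> bounded_measurable g ->
  (forall x, f (s, x) <= g (s, x)) -> wkernel f s <= wkernel g s.
Proof.
move=> bf bg fg; apply: le_Rintegral => //; [exact: wkernel_integrable..|].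
by move=> x _; apply: ler_wpM2l.
Qed.

Lemma wkernel_1 s : 0 <= wkernel (fun=> 1) s <= B.
Proof.
rewrite /wkernel; under eq_Rintegral do rewrite mulr1.
rewrite Rintegral_ge0//= -lee_fin fineK//.
exact: (integrable_fin_num measurableT (wkernel_weight_integrable s)).
Qed.

Lemma wkernel_norm_le f s M : bounded_measurable f ->
  (forall x, `|f (s, x)| <= M) -> `|wkernel f s| <= M * B.
Proof.
move=> bf fM; have M0 : 0 <= M := le_trans (normr_ge0 _) (fM point).
apply: (@le_trans _ _ (M * wkernel (fun=> 1) s)); last first.
  by apply: ler_wpM2l => //; have /andP[] := wkernel_1 s.
have E c : wkernel (fun=> c) s = c * wkernel (fun=> 1) s.
  have -> : (fun=> c) = (fun z : S * X => c * (fun=> 1) z + (fun=> 0) z).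
    by apply/funext => z; rewrite mulr1 addr0.
  rewrite wkernel_lin; [|exact: bm_cst..].
  by rewrite [X in _ + X]/wkernel; under [X in _ + X]eq_Rintegral do rewrite mulr0;
    rewrite Rintegral_cst// mul0r addr0.
rewrite ler_norml -mulNr -!E; apply/andP; split.
  apply: le_wkernel => //; first exact: bm_cst.
  by move=> x; have := fM x; rewrite ler_norml => /andP[].
apply: le_wkernel => //; first exact: bm_cst.
by move=> x; have := fM x; rewrite ler_norml => /andP[].
Qed.

Lemma bm_wkernel f : bounded_measurable f -> bounded_measurable (wkernel f).
Proof.
move=> bf; split; last first.
  have [M M0 fM] := bm_bound bf; exists (M * B) => s.
  exact: wkernel_norm_le.
have pos h : bounded_measurable h -> (forall z, 0 <= h z) ->
    measurable_fun setT (wkernel h).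
  move=> bh h0; apply: (@measurableT_comp _ _ _ _ _ _ fine) => //.
  apply: (measurable_fun_fubini_tonelli_F (m2 := mu)
    (fun z => (k z * h z)%:E)) => //.
    by apply/measurable_EFinP/measurable_funM => //; exact: bm_measurable.
  by move=> z; rewrite lee_fin mulr_ge0.
have [M M0 fM] := bm_bound bf.
(* Tonelli's theorem gives measurability for nonnegative integrands only, hence the shift by the
   bound [M]. *)
have -> : wkernel f = (fun s => wkernel (fun z => f z + M) s - M * wkernel (fun=> 1) s).
  apply/funext => s; have -> : (fun z => f z + M) = (fun z => M * (fun=> 1) z + f z).
    by apply/funext => z; rewrite mulr1 addrC.
  by rewrite wkernel_lin//; [ring|exact: bm_cst].
apply: measurable_funB.
  apply: pos; first by apply: bmD => //; exact: bm_cst.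
  by move=> z; have := fM z; rewrite ler_norml => /andP[+ _]; lra.
by apply: measurable_funM => //; apply: pos; first exact: bm_cst.
Qed.

End weighted_kernel.

Section weighted_fubini.
Context d1 d2 (T1 : measurableType d1) (T2 : measurableType d2) (R : realType).
Variables (m1 : {sigma_finite_measure set T1 -> \bar R}).
Variables (m2 : {finite_measure set T2 -> \bar R}) (w : T1 -> R).
Hypotheses (iw : m1.-integrable setT (EFin \o w)) (w0 : forall x, 0 <= w x).
Implicit Types f : T1 * T2 -> R.

Let mw : measurable_fun setT w.
Proof. by apply/measurable_EFinP; exact: measurable_int iw. Qed.

Lemma weight_integrable_section f y : bounded_measurable f ->
  m1.-integrable setT (EFin \o (fun x => w x * f (x, y))).
Proof.
by move=> bf; apply: integrable_weight iw _; apply: bm_comp bf _; exact: pair2_measurable.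
Qed.

Lemma bm_Rintegral_snd f : bounded_measurable f ->
  bounded_measurable (fun x => \int[m2]_y f (x, y)).
Proof.
move=> bf.
have kB (x : T1) : (\int[m2]_y (1 : R)%:E <= (fine (m2 setT))%:E)%E.
  by rewrite integral_cst// mul1e fineK// fin_num_measure.
have := @bm_wkernel _ _ _ _ _ m2 (fun=> 1) _ (@measurable_cst _ _ _ _ setT (1 : R)) (fun=> ler01) kB f bf.
have -> // : wkernel m2 (fun=> 1) f = (fun x => \int[m2]_y f (x, y)).
by apply/funext => x; apply: eq_Rintegral => y _; rewrite mul1r.
Qed.

(** Tonelli's theorem for the nonnegative functions [f + M] and [M], then subtraction; the shift
    stays integrable because [m2] is finite and [w] integrable. *)
Lemma weighted_fubini f : bounded_measurable f ->
  \int[m1]_x (w x * \int[m2]_y f (x, y)) = \int[m2]_y \int[m1]_x (w x * f (x, y)).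
Proof.
have pos g : bounded_measurable g -> (forall z, 0 <= g z) ->
    \int[m1]_x (w x * \int[m2]_y g (x, y)) = \int[m2]_y \int[m1]_x (w x * g (x, y)).
  move=> bg g0; congr fine.
  transitivity (\int[m1]_x \int[m2]_y (w x * g (x, y))%:E)%E.
    apply: eq_integral => x _.
    have ig : m2.-integrable setT (EFin \o (fun y => g (x, y))).
      by apply: bm_integrable; exact: bm_section.
    rewrite -RintegralZl// fineK//; apply: (integrable_fin_num measurableT).
    have -> : (fun y => (w x * g (x, y))%:E) =
        (fun y => (w x)%:E * (EFin \o (fun y => g (x, y))) y)%E by [].
    exact: integrableZl.
  rewrite (fubini_tonelli (fun z => (w z.1 * g z)%:E)); first last.
  - by move=> z; rewrite lee_fin mulr_ge0.
  - apply/measurable_EFinP/measurable_funM; last exact: bm_measurable.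
    by apply: measurableT_comp => //; exact: measurable_fst.
  apply: eq_integral => y _; rewrite fineK//.
  by apply: (integrable_fin_num measurableT); exact: weight_integrable_section.
move=> bf; have [M M0 fM] := bm_bound bf.
have b1 : bounded_measurable (fun z : T1 * T2 => M) by exact: bm_cst.
have E : f = (fun z => (f z + M) - M) by apply/funext => z; rewrite addrK.
have E1 := pos _ (bmD bf b1) _; have E2 := pos _ b1 _.
have split_in x : \int[m2]_y f (x, y) =
    \int[m2]_y (f (x, y) + M) - \int[m2]_y M.
  rewrite -bm_RintegralB//; last 2 first.
  - by apply: bmD; [exact: bm_section|exact: bm_cst].
  - exact: bm_cst.
  by apply: eq_Rintegral => y _; rewrite addrK.
have split_out y : \int[m1]_x (w x * f (x, y)) =
    \int[m1]_x (w x * (f (x, y) + M)) - \int[m1]_x (w x * M).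
  rewrite -RintegralB//; last 2 first.
  - exact: (weight_integrable_section y (bmD bf b1)).
  - exact: (weight_integrable_section y b1).
  by apply: eq_Rintegral => x _; ring.
have bmw (g : T1 * T2 -> R) : bounded_measurable g ->
    bounded_measurable (fun y => \int[m1]_x (w x * g (x, y))).
  move=> bg; have mg' : bounded_measurable (fun z : T2 * T1 => g (z.2, z.1)).
    by apply: bm_comp bg _; apply: measurable_fun_pair; [exact: measurable_snd|exact: measurable_fst].
  have [B wB] : exists B, (\int[m1]_x (w x)%:E <= B%:E)%E.
    exists (fine (\int[m1]_x (w x)%:E)); rewrite fineK//.
    exact: (integrable_fin_num measurableT iw).
  apply: (@bm_wkernel _ _ _ _ _ m1 (fun z => w z.2) B _ _ _ _ mg') => //.
  by apply: measurableT_comp => //; exact: measurable_snd.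
under eq_Rintegral do rewrite split_in mulrBr.
under [RHS]eq_Rintegral do rewrite split_out.
rewrite RintegralB//; last 2 first.
- by apply: integrable_weight iw _; apply: (bm_Rintegral_snd (bmD bf b1)).
- by apply: integrable_weight iw _; apply: (bm_Rintegral_snd b1).
rewrite bm_RintegralB; [|exact: (bmw _ (bmD bf b1))|exact: (bmw _ b1)].
by rewrite E1 ?E2// => z; have := fM z; rewrite ler_norml => /andP[+ _]; rewrite -lerBlDr sub0r.
Qed.

End weighted_fubini.

Section conditional_density.
Context dO (O : measurableType dO) (R : realType) (P : probability O R).
Context dS dX (S : measurableType dS) (X : measurableType dX).
Variables (mu : {sigma_finite_measure set X -> \bar R}) (k : S * X -> R).
Variables (H : O -> S) (xi : O -> X).
Hypotheses (mH : measurable_fun setT H) (mxi : measurable_fun setT xi).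
Hypotheses (mk : measurable_fun setT k) (k0 : forall z, 0 <= k z).
Hypothesis k1 : forall s, (\int[mu]_x (k (s, x))%:E = 1)%E.
Hypothesis rectE : forall A B, measurable A -> measurable B ->
  P (H @^-1` A `&` xi @^-1` B) =
  (\int[P]_(w in H @^-1` A) \int[mu]_(x in B) (k (H w, x))%:E)%E.

Let mpair : measurable_fun setT (fun w => (H w, xi w)).
Proof. exact: measurable_fun_pair. Qed.

Let Hm : {mfun O >-> S} := HB.pack H (isMeasurableFun.Build _ _ _ _ H mH).

Let pairm : {mfun O >-> (S * X)%type} :=
  HB.pack (fun w => (H w, xi w)) (isMeasurableFun.Build _ _ _ _ _ mpair).

Let PH : probability S R := distribution P Hm.

Let PHx : probability (S * X)%type R := distribution P pairm.

Let mkE : measurable_fun setT (EFin \o k).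
Proof. exact/measurable_EFinP. Qed.

Let k0E z : (0 <= (EFin \o k) z)%E.
Proof. by rewrite lee_fin. Qed.

Let integral_prod (h : S * X -> \bar R) : measurable_fun setT h ->
  (forall z, 0 <= h z)%E ->
  (\int[PH \x mu]_z h z = \int[P]_w \int[mu]_x h (H w, x))%E.
Proof.
move=> mh h0; rewrite fubini_tonelli1//.
rewrite (@ge0_integral_distribution _ _ _ _ _ P Hm)//.
  exact: measurable_fun_fubini_tonelli_F.
by move=> s; apply: integral_ge0.
Qed.

(** The rectangles form a pi-system that generates the product, and on them [rectE] says that the
    joint law has density [k] with respect to the law of [H] times [mu]. *)
Let PHxE (C : set (S * X)) : measurable C ->
  PHx C = (\int[PH \x mu]_(z in C) (k z)%:E)%E.
Proof.
pose G := [set A `*` B | A in @measurable _ S & B in @measurable _ X].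
apply: (@measure_unique _ _ _ G (fun=> setT) _ _ _ _ PHx
  (@density_measure _ _ _ (PH \x mu)%E _ mkE k0E)) => //.
- by rewrite measurable_prod_measurableType.
- move=> _ _ [A mA [B mB <-]] [A' mA' [B' mB' <-]]; rewrite -setXI.
  by exists (A `&` A'); [exact: measurableI|exists (B `&` B'); [exact: measurableI|]].
- by move=> _; exists setT => //; exists setT => //; rewrite setXTT.
- by rewrite bigcup_const.
- move=> _ [A mA [B mB <-]]; rewrite /density_measure /=.
  transitivity (P (H @^-1` A `&` xi @^-1` B)); first by [].
  rewrite rectE// [RHS]integral_mkcond integral_prod; last 2 first.
  + apply/(measurable_restrictT _ _).1 => //; first exact: measurableX.
    exact: measurable_funTS.
  + by move=> z; apply: erestrict_ge0 => *; rewrite lee_fin.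
  rewrite integral_mkcond; apply: eq_integral => w _; rewrite patchE.
  have [HA|HA] := pselect (A (H w)).
    rewrite mem_set// integral_mkcond; apply: eq_integral => x _; rewrite !patchE.
    have -> // : ((H w, x) \in A `*` B) = (x \in B).
    by apply/idP/idP; rewrite !inE /= => // -[].
  rewrite memNset// integral0_eq// => x _.
  by rewrite patchE memNset// => -[].
- by move=> _; rewrite (le_lt_trans (probability_le1 PHx measurableT))// ltry.
Qed.

Lemma ge0_conditional_density (f : S * X -> \bar R) : measurable_fun setT f ->
  (forall z, 0 <= f z)%E ->
  (\int[P]_w f (H w, xi w) = \int[P]_w \int[mu]_x (f (H w, x) * (k (H w, x))%:E))%E.
Proof.
move=> mf f0.
transitivity (\int[PHx]_z f z)%E.
  by rewrite (@ge0_integral_distribution _ _ _ _ _ P pairm).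
rewrite (ge0_integral_density mk k0 PHxE mf f0) integral_prod//.
  exact: emeasurable_funM.
by move=> z; apply: mule_ge0 => //; rewrite lee_fin.
Qed.

Let kle1 s : (\int[mu]_x (k (s, x))%:E <= 1%:E)%E. Proof. by rewrite k1. Qed.

Lemma conditional_density_expectation (f : S * X -> R) : bounded_measurable f ->
  \int[P]_w f (H w, xi w) = \int[P]_w wkernel mu k f (H w).
Proof.
have pos g : bounded_measurable g -> (forall z, 0 <= g z) ->
    \int[P]_w g (H w, xi w) = \int[P]_w wkernel mu k g (H w).
  move=> bg g0; congr fine; rewrite (@ge0_conditional_density (EFin \o g)).
  - apply: eq_integral => w _; rewrite /wkernel fineK.
      by apply: eq_integral => x _; rewrite /= -EFinM mulrC.
    apply: (integrable_fin_num measurableT).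
    exact: (wkernel_integrable mk k0 kle1).
  - by apply/measurable_EFinP; exact: bm_measurable.
  - by move=> z; rewrite lee_fin.
move=> bf; have [M M0 fM] := bm_bound bf.
have bM : bounded_measurable (fun z : S * X => M) by exact: bm_cst.
have E1 := pos _ (bmD bf bM) _; have E2 := pos _ bM (fun=> M0).
have bw g : bounded_measurable g -> bounded_measurable (fun w => wkernel mu k g (H w)).
  by move=> bg; apply: bm_comp mH; exact: (bm_wkernel mk k0 kle1).
have lhs : \int[P]_w f (H w, xi w) =
    \int[P]_w (f (H w, xi w) + M) - \int[P]_w M.
  rewrite -bm_RintegralB; [|by apply: bmD; [exact: bm_comp bf mpair|exact: bm_cst]|exact: bm_cst].
  by apply: eq_Rintegral => w _; rewrite addrK.
rewrite lhs E1 ?E2; last by move=> z; have := fM z; rewrite ler_norml => /andP[+ _]; rewrite -lerBlDr sub0r.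
rewrite -bm_RintegralB; [|by apply: bw; exact: bmD|exact: bw].
apply: eq_Rintegral => w _.
have -> : (fun z => f z + M) = (fun z => 1 * f z + (fun=> M) z).
  by apply/funext => z; rewrite mul1r.
by rewrite (wkernel_lin mk k0 kle1)// mul1r addrK.
Qed.

End conditional_density.

(** * Conditionally independent blocks *)

Section sub_sigma_algebras.
Context d (O : measurableType d).
Implicit Types G : set (set O).

Lemma g_sigma_measurable G A : (forall B, G B -> measurable B) ->
  <<s G >> A -> measurable A.
Proof.
by move=> mG; apply: smallest_sub A; first exact: sigma_algebra_measurable.
Qed.

Lemma g_sigma_sub G1 G2 A : (forall B, G1 B -> <<s G2 >> B) ->
  <<s G1 >> A -> <<s G2 >> A.
Proof. by move=> mG; apply: smallest_sub A. Qed.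

(** A sub-sigma-algebra is represented by a second measurable structure on the same set, so that a
    variable known from [G] is a measurable function on [g_sigma_algebraType G]; composition with
    this identity map brings it back to [O]. *)
Lemma measurable_id_g_sigma G : (forall A, G A -> measurable A) ->
  measurable_fun setT (fun w : O => w : g_sigma_algebraType G).
Proof. by move=> mG _ A sA; rewrite setTI; exact: g_sigma_measurable sA. Qed.

Lemma measurable_id_sub_g_sigma G1 G2 : (forall A, G1 A -> <<s G2 >> A) ->
  measurable_fun setT
    (fun w : g_sigma_algebraType G2 => w : g_sigma_algebraType G1).
Proof. by move=> mG _ A sA; rewrite setTI; exact: g_sigma_sub sA. Qed.

End sub_sigma_algebras.

Section conditionally_independent_chain.
Context dO (O : measurableType dO) (R : realType) (P : probability O R).
Context dX (X : measurableType dX).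
Variables (G : set (set O)) (N : nat) (xi : 'I_N -> O -> X).
Variable mu : 'I_N -> {sigma_finite_measure set X -> \bar R}.
Notation S := (g_sigma_algebraType G).
Variable k : 'I_N -> S * X -> R.
Hypotheses (mG : forall A, G A -> measurable A)
  (mxi : forall i, measurable_fun setT (xi i))
  (mk : forall i, measurable_fun setT (k i)) (k0 : forall i z, 0 <= k i z)
  (k1 : forall i s, (\int[mu i]_x (k i (s, x))%:E = 1)%E).
Hypothesis chain_prodE : forall (A : set O) (B : 'I_N -> set X),
  <<s G >> A -> (forall i, measurable (B i)) ->
  P (A `&` \bigcap_(i in [set: 'I_N]) (xi i @^-1` B i)) =
  (\int[P]_(w in A) \prod_(i < N) \int[mu i]_(x in B i) (k i (w, x))%:E)%E.

(** Past events intersected with rectangles in the first [i] variables. They are stable by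
    intersection, so that finite measures that agree on them agree on the sigma-algebra that they
    generate. *)
Definition chain_gens (i : nat) : set (set O) :=
  [set D | exists (A : set O) (B : 'I_N -> set X),
    [/\ <<s G >> A, forall j, measurable (B j) &
     D = A `&` \bigcap_(j in [set j : 'I_N | (j < i)%N]) (xi j @^-1` B j)]].

Notation Sc i := (g_sigma_algebraType (chain_gens i)).

Let mxiB i B : measurable B -> measurable (xi i @^-1` B).
Proof. by move=> mB; rewrite -[X in measurable X]setTI; exact: mxi. Qed.

Lemma chain_gens_measurable i D : chain_gens i D -> measurable D.
Proof.
move=> [A [B [GA mB ->]]]; apply: measurableI; first exact: (g_sigma_measurable mG).
by apply: fin_bigcap_measurable => // j _; exact: mxiB.
Qed.

Lemma chain_gens_past i A : <<s G >> A -> <<s (chain_gens i) >> A.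
Proof.
move=> GA; apply: sub_sigma_algebra; exists A, (fun=> setT); split => //.
by apply/seteqP; split => [w Aw|w []].
Qed.

Lemma chain_gens_coord i (j : 'I_N) B : (j < i)%N -> measurable B ->
  <<s (chain_gens i) >> (xi j @^-1` B).
Proof.
move=> ji mB; apply: sub_sigma_algebra.
exists setT, (fun l => if l == j then B else setT); split => //.
- exact: (@measurableT _ S).
- by move=> l; case: ifP.
rewrite setTI; apply/seteqP; split => w /=.
  by move=> Bw l _ /=; case: eqP => // ->.
by move=> /(_ j ji) /=; rewrite eqxx.
Qed.

Lemma chain_gens_setI i : setI_closed (chain_gens i).
Proof.
move=> _ _ [A [B [GA mB ->]]] [A' [B' [GA' mB' ->]]].
exists (A `&` A'), (fun j => B j `&` B' j); split.
- exact: (@measurableI _ S).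
- by move=> j; exact: measurableI.
- by rewrite setIACA -bigcapI.
Qed.

Definition condprob (i : 'I_N) (B : set X) (s : S) : R :=
  fine (\int[mu i]_(x in B) (k i (s, x))%:E).

Let condprobE i B s : measurable B ->
  (condprob i B s)%:E = (\int[mu i]_(x in B) (k i (s, x))%:E)%E.
Proof.
move=> mB; rewrite /condprob fineK// ge0_fin_numE; last first.
  by apply: integral_ge0 => x _; rewrite lee_fin.
apply: (@le_lt_trans _ _ 1%E); last exact: ltry.
rewrite -(k1 i s); apply: ge0_subset_integral => //.
  by apply/measurable_EFinP; apply: measurableT_comp (mk i) _; exact: pair1_measurable.
by move=> x _; rewrite lee_fin.
Qed.

Let condprob_ge0 i B s : 0 <= condprob i B s.
Proof. by apply/fine_ge0/integral_ge0 => x _; rewrite lee_fin. Qed.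

Let measurable_condprob i B : measurable B -> measurable_fun setT (condprob i B).
Proof.
move=> mB; apply: (@measurableT_comp _ _ _ _ _ _ fine) => //.
have -> : (fun s => \int[mu i]_(x in B) (k i (s, x))%:E)%E =
    (fun s => \int[mu i]_x (k i (s, x) * \1_B x)%:E)%E.
  apply/funext => s; rewrite integral_mkcond; apply: eq_integral => x _.
  by rewrite patchE indicE; case: ifP; rewrite ?mulr1 ?mulr0.
apply: (measurable_fun_fubini_tonelli_F (m2 := mu i)
    (fun z : S * X => (k i z * \1_B z.2)%:E)).
  apply/measurable_EFinP/measurable_funM => //.
  have m1B : measurable_fun setT (\1_B : X -> R) by exact: measurable_indic.
  exact: measurableT_comp m1B measurable_snd.
by move=> z; rewrite lee_fin mulr_ge0.
Qed.

Let mid : measurable_fun setT (fun w : O => w : S).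
Proof. exact: measurable_id_g_sigma. Qed.

Let idm : {mfun O >-> S} :=
  HB.pack (fun w : O => w : S) (isMeasurableFun.Build _ _ _ _ _ mid).

Let prodprob (i : nat) (B : 'I_N -> set X) (s : S) : R :=
  \prod_(j < N | (j < i)%N) condprob j (B j) s.

(* The law of the block given the past, extended from past events to past
   weights. *)
Let past_weight (i : nat) (B : 'I_N -> set X) (f : S -> \bar R) :
  (forall j, measurable (B j)) -> measurable_fun setT f -> (forall s, 0 <= f s)%E ->
  (\int[P]_(w in \bigcap_(j in [set j : 'I_N | (j < i)%N]) (xi j @^-1` B j)) f w =
   \int[P]_w (f w * (prodprob i B w)%:E))%E.
Proof.
move=> mB mf f0; set E := \bigcap_(j in _) _.
have mE : measurable E by apply: fin_bigcap_measurable => // j _; exact: mxiB.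
(* Restricted to the block event and pushed to the past sigma-algebra, [P] has density [prodprob]
   with respect to the law of the past: this is [chain_prodE] with full sets for the variables from
   [i] on. *)
pose PE : {measure set S -> \bar R} :=
  measure_function_pushforward__canonical__measure_function_Measure
    (mrestr P mE) mid.
have mw : measurable_fun setT (prodprob i B).
  rewrite /prodprob; under eq_fun do rewrite -big_filter.
  by apply: measurable_prod => j _; exact: measurable_condprob.
have w0 s : 0 <= prodprob i B s by apply: prodr_ge0.
have PEE (A : set S) : measurable A ->
    PE A = (\int[distribution P idm]_(s in A) (prodprob i B s)%:E)%E.
  move=> mA; rewrite (ge0_integral_pushforward mid)//; first last.
  - by move=> s _; rewrite lee_fin.
  - by apply/measurable_EFinP; exact: measurable_funTS.
  rewrite /PE /= /pushforward /mrestr.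
  pose B' (j : 'I_N) := if (j < i)%N then B j else setT.
  transitivity (P (A `&` \bigcap_(j in [set: 'I_N]) (xi j @^-1` B' j))).
    congr (P (_ `&` _)); apply/seteqP; split => w Ew j /= ji.
      by rewrite /B'; case: ifP => // ?; exact: Ew.
    by have := Ew j Logic.I; rewrite /= /B' ji.
  rewrite chain_prodE//; last by move=> j; rewrite /B'; case: ifP.
  apply: eq_integral => w _; rewrite /prodprob -prodEFin [RHS]big_mkcond /=.
  apply: eq_bigr => j _; rewrite /B'.
  by case: ifP => _; [rewrite condprobE|rewrite k1].
transitivity (\int[PE]_s f s)%E.
  rewrite (ge0_integral_pushforward mid)//=.
  have mfO : measurable_fun setT (f : O -> \bar R) by exact: measurableT_comp mf mid.
  have m1E : measurable_fun setT (\1_E : O -> R) by exact: measurable_indic.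
  rewrite (@ge0_integral_density _ _ _ P (mrestr P mE) \1_E)//.
    rewrite [LHS]integral_mkcond; apply: eq_integral => w _; rewrite patchE indicE.
    by case: ifP => _; rewrite ?mule1 ?mule0.
  by move=> A mA; rewrite integral_indic// setIC.
rewrite (ge0_integral_density mw w0 PEE mf f0) ge0_integral_distribution//.
  by apply: emeasurable_funM => //; exact/measurable_EFinP.
by move=> s; apply: mule_ge0 => //; rewrite lee_fin.
Qed.

(** Given the past, the variables revealed before [i] bring no information on variable [i]. It
    suffices to compare the two sides, as measures in [D], on [chain_gens i], where both reduce to
    the product formula. *)
Lemma chainE (i : 'I_N) (D : set O) (B : set X) :
  <<s (chain_gens i) >> D -> measurable B ->
  P (D `&` xi i @^-1` B) = (\int[P]_(w in D) \int[mu i]_(x in B) (k i (w, x))%:E)%E.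
Proof.
move=> sD mB.
have mcB : measurable_fun setT (fun w : O => (condprob i B w)%:E).
  by apply/measurable_EFinP; exact: measurableT_comp (@measurable_condprob i _ mB) mid.
have cB0 (w : O) : (0 <= (condprob i B w)%:E)%E by rewrite lee_fin.
transitivity (mrestr P (mxiB i mB) D); first by [].
transitivity (@density_measure _ _ _ P _ mcB cB0 D); last first.
  by apply: eq_integral => w _; rewrite condprobE.
apply: (g_sigma_algebra_measure_unique (chain_gens i) _ (fun=> setT) _ _
  (mrestr P (mxiB i mB)) (@density_measure _ _ _ P _ mcB cB0)) => //.
- exact: chain_gens_measurable.
- move=> _; exists setT, (fun=> setT); split => //; first exact: (@measurableT _ S).
  by apply/seteqP; split => [w _|].
- by rewrite bigcup_const.
- exact: chain_gens_setI.
- move=> _ [A [C [GA mC ->]]]; rewrite /mrestr /density_measure.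
  have mA := g_sigma_measurable mG GA.
  set E := \bigcap_(j in _) _.
  have mE : measurable E by apply: fin_bigcap_measurable => // j _; exact: mxiB.
  pose C' (j : 'I_N) := if (j < i)%N then C j else if j == i then B else setT.
  transitivity (P (A `&` \bigcap_(j in [set: 'I_N]) (xi j @^-1` C' j))).
    congr (P _); rewrite -setIA; congr (_ `&` _); apply/seteqP; split => w /=.
      move=> [Ew Bw] j _ /=; rewrite /C'; case: ifP => [ji|_]; first exact: Ew.
      by case: eqP => // ->.
    move=> Cw; split => [j /= ji|]; first by have := Cw j Logic.I; rewrite /= /C' ji.
    by have := Cw i Logic.I; rewrite /= /C' ltnn eqxx.
  rewrite chain_prodE//; last by move=> j; rewrite /C'; case: ifP => // _; case: ifP.
  transitivity (\int[P]_(w in A) ((condprob i B w)%:E * (prodprob i C w)%:E))%E.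
    apply: eq_integral => w _.
    rewrite (bigD1 i)//= {1}/C' ltnn eqxx -condprobE//; congr (_ * _)%E.
    rewrite /prodprob (bigID (fun j : 'I_N => (j < i)%N))/= [X in (_ * X)%E]big1 ?mule1.
      rewrite -prodEFin; apply: eq_big => [j|j /andP[_ ji]].
        by case: ltnP => //= ji; rewrite ?andbF// andbT; apply: contraTneq ji => ->; rewrite ltnn.
      by rewrite /C' ji condprobE.
    by move=> j /andP[ji ij]; rewrite /C' (negbTE ij) (negbTE ji) k1.
  transitivity (\int[P]_(w in E `&` A) (condprob i B w)%:E)%E; last by rewrite setIC.
  rewrite integral_mkcondr.
  pose fB : S -> \bar R := fun s => (condprob i B s)%:E.
  have mSA : measurable_fun (setT : set S) (fB \_ (A : set S)).
    apply/(measurable_restrictT _ _).1 => //; apply: measurable_funTS.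
    by apply/measurable_EFinP; exact: (@measurable_condprob i _ mB).
  (* The conditional probability for variable [i] is a past weight, so its integral over the block
     event acquires the conditional probabilities of the earlier variables as a factor. *)
  rewrite (past_weight _ mC mSA); last first.
    by move=> s; rewrite patchE; case: ifP => // _; rewrite lee_fin.
  rewrite [LHS]integral_mkcond. apply: eq_integral => w _.
  by rewrite !patchE; case: ifP; rewrite ?mul0e.
- by move=> _; rewrite /mrestr (le_lt_trans (probability_le1 P _)) ?ltry// setTI; exact: mxiB.
Qed.

Lemma measurable_id_chain i :
  measurable_fun setT (fun w : Sc i => w : S).
Proof.
apply: measurable_id_sub_g_sigma => A GA; apply: chain_gens_past.
exact: sub_sigma_algebra.
Qed.

Lemma measurable_chain_coord i (j : 'I_N) : (j < i)%N ->
  measurable_fun setT (fun w : Sc i => xi j w).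
Proof. by move=> ji _ B mB; rewrite setTI; exact: chain_gens_coord. Qed.

Let measurable_fst_past i : measurable_fun setT (fun z : Sc i * X => z.1 : S).
Proof.
move=> _ A sA; apply: (@measurable_fst _ _ (Sc i) X) => //.
exact: chain_gens_past.
Qed.

Let mid_chain_pair i : measurable_fun setT (fun z : Sc i * X => z : S * X).
Proof.
have -> : (fun z : Sc i * X => z : S * X) = (fun z => (z.1 : S, z.2)).
  by apply/funext => -[].
apply: measurable_fun_pair; last exact: measurable_snd.
exact: measurable_fst_past.
Qed.

Lemma chain_expectation (i : 'I_N) (f : Sc i * X -> R) : bounded_measurable f ->
  \int[P]_w f (w, xi i w) = \int[P]_w wkernel (mu i) (k i : Sc i * X -> R) f w.
Proof.
move=> bf.
apply: (@conditional_density_expectation _ _ _ P _ _ (Sc i) X (mu i) (k i)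
  (fun w => w) (xi i)) => //.
- by apply: measurable_id_g_sigma; exact: chain_gens_measurable.
- exact: (measurableT_comp (mk i) (@mid_chain_pair i)).
- by move=> A B mA mB; exact: chainE.
Qed.

End conditionally_independent_chain.

Section conditionally_independent_block.
Context dO (O : measurableType dO) (R : realType) (P : probability O R).
Context dX (X : measurableType dX) (mu : {sigma_finite_measure set X -> \bar R}).
Variables (G : set (set O)) (N : nat) (xi : 'I_N -> O -> X).
Notation S := (g_sigma_algebraType G).
Variable k : S * X -> R.
Hypotheses (mG : forall A, G A -> measurable A)
  (mxi : forall i, measurable_fun setT (xi i))
  (mk : measurable_fun setT k) (k0 : forall z, 0 <= k z)
  (k1 : forall s, (\int[mu]_x (k (s, x))%:E = 1)%E).
Hypothesis blockE : forall (A : set O) (B : 'I_N -> set X),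
  <<s G >> A -> (forall i, measurable (B i)) ->
  P (A `&` \bigcap_(i in [set: 'I_N]) (xi i @^-1` B i)) =
  (\int[P]_(w in A) \prod_(i < N) \int[mu]_(x in B i) (k (w, x))%:E)%E.

Notation Sc i := (g_sigma_algebraType (chain_gens G xi i)).

Let mid : measurable_fun setT (fun w : O => w : S).
Proof. exact: measurable_id_g_sigma. Qed.

Let id_chain i : measurable_fun setT (fun w : Sc i => w : S).
Proof. exact: measurable_id_chain. Qed.

Let kle1 s : (\int[mu]_x (k (s, x))%:E <= 1%:E)%E. Proof. by rewrite k1. Qed.

Lemma block_kernel_cst c s : wkernel mu k (fun=> c) s = c.
Proof.
rewrite /wkernel RintegralZr//; last exact: (wkernel_weight_integrable mk k0 kle1).
by rewrite /Rintegral k1 mul1r.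
Qed.

Lemma block_kernel_norm_le f s M : bounded_measurable f ->
  (forall x, `|f (s, x)| <= M) -> `|wkernel mu k f s| <= M.
Proof. by move=> bf fM; rewrite -[M]mulr1; exact: (wkernel_norm_le mk k0 kle1). Qed.

Lemma bm_block_kernel f : bounded_measurable f -> bounded_measurable (wkernel mu k f).
Proof. exact: (bm_wkernel mk k0 kle1). Qed.

Let block_kernel_lin := wkernel_lin mk k0 kle1.

Let measurable_fst_past i : measurable_fun setT (fun z : Sc i * X => z.1 : S).
Proof.
move=> _ A sA; apply: (@measurable_fst _ _ (Sc i) X) => //.
exact: chain_gens_past.
Qed.

Let mid_chain_pair i : measurable_fun setT (fun z : Sc i * X => z : S * X).
Proof.
have -> : (fun z : Sc i * X => z : S * X) = (fun z => (z.1 : S, z.2)).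
  by apply/funext => -[].
apply: measurable_fun_pair; last exact: measurable_snd.
exact: measurable_fst_past.
Qed.

Lemma block_expectation (i : 'I_N) (f : Sc i * X -> R) : bounded_measurable f ->
  \int[P]_w f (w, xi i w) = \int[P]_w wkernel mu (k : Sc i * X -> R) f w.
Proof. by move=> bf; exact: (@chain_expectation _ _ _ P _ X G N xi (fun=> mu) (fun=> k)). Qed.

(** Martingale increment when the variables of the block are revealed one at a time: the conditional
    mean involves the past alone. *)
Definition innovation (f : S * X -> R) (i : 'I_N) (w : O) : R :=
  f (w, xi i w) - wkernel mu k f w.

Let bm_chain_fst i (U : S -> R) : bounded_measurable U ->
  bounded_measurable (fun z : Sc i * X => U z.1).
Proof.
by move=> bU; exact: bm_comp bU (@measurable_fst_past i).
Qed.

Let bm_chain (f : S * X -> R) i : bounded_measurable f ->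
  bounded_measurable (fun z : Sc i * X => f z).
Proof. by move=> bf; exact: bm_comp bf (@mid_chain_pair i). Qed.

(** [U] may depend on the past and on the variables revealed before [i]; given these, the increment
    has mean zero. *)
Lemma innovation_orthogonal (i : 'I_N) (U : Sc i -> R) f :
  bounded_measurable U -> bounded_measurable f ->
  \int[P]_w (U w * innovation f i w) = 0.
Proof.
move=> bU bf.
rewrite (@block_expectation i (fun z => U z.1 * (f z - wkernel mu k f z.1))).
  rewrite -[RHS](Rintegral_prob_cst P 0); apply: eq_Rintegral => w _.
  transitivity (wkernel mu k (fun z => U w * f z + - (U w * wkernel mu k f w)) w).
    by apply: eq_Rintegral => x _ /=; rewrite mulrBr.
  by rewrite block_kernel_lin//; [rewrite block_kernel_cst subrr|exact: bm_cst].
apply: bmM.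
  by apply: bm_comp bU _; exact: measurable_fst.
apply: bmB; first exact: bm_chain.
by apply: bm_chain_fst; exact: bm_block_kernel.
Qed.

Lemma innovation_variance (i : 'I_N) f : bounded_measurable f ->
  \int[P]_w (innovation f i w) ^+ 2 =
  \int[P]_w (wkernel mu k (fun z => f z ^+ 2) w - wkernel mu k f w ^+ 2).
Proof.
move=> bf; have bKf := bm_block_kernel bf.
rewrite (@block_expectation i (fun z => (f z - wkernel mu k f z.1) ^+ 2)).
  apply: eq_Rintegral => w _; set c := wkernel mu k f w.
  transitivity (wkernel mu k (fun z => 1 * f z ^+ 2 + (- 2 * c * f z + c ^+ 2)) w).
    by apply: eq_Rintegral => x _ /=; rewrite -/c; ring.
  have b2 : bounded_measurable (fun z : S * X => - 2 * c * f z + c ^+ 2).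
    by apply: bmD; [exact: bmZ|exact: bm_cst].
  rewrite block_kernel_lin//; last exact: bmX.
  by rewrite block_kernel_lin//; [rewrite block_kernel_cst -/c; ring|exact: bm_cst].
apply: bmX; apply: bmB; first exact: bm_chain.
exact: bm_chain_fst.
Qed.

Definition partial_innovation f (i : nat) (w : O) : R :=
  \sum_(j < N | (j < i)%N) innovation f j w.

Lemma bm_partial_innovation f i : bounded_measurable f ->
  bounded_measurable (partial_innovation f i : Sc i -> R).
Proof.
move=> bf; rewrite (_ : partial_innovation f i = fun w =>
    \sum_(j < N) if (j < i)%N then innovation f j w else 0); last first.
  by apply/funext => w; exact: big_mkcond.
apply: (@bm_sum _ (Sc i) R _ _
  (fun (j : 'I_N) (w : Sc i) => if (j < i)%N then innovation f j w else 0)) => j.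
have [ji|ji] := ltnP j i; last exact: bm_cst.
apply: bmB; last exact: (bm_comp (bm_block_kernel bf) (@id_chain i)).
apply: bm_comp bf _; apply: measurable_fun_pair; first exact: id_chain.
exact: measurable_chain_coord.
Qed.

Lemma partial_innovationS f (i : 'I_N) w :
  partial_innovation f i.+1 w = partial_innovation f i w + innovation f i w.
Proof.
rewrite /partial_innovation (bigD1 i)//= addrC; congr (_ + _).
by apply: eq_bigl => j; rewrite ltnS leq_eqVlt -val_eqE /=; case: ltngtP.
Qed.

Lemma bm_from_chain i (U : Sc i -> R) : bounded_measurable U ->
  bounded_measurable (U : O -> R).
Proof.
move=> bU; apply: bm_comp bU _; apply: measurable_id_g_sigma.
exact: chain_gens_measurable.
Qed.

Lemma bm_from_past (U : S -> R) : bounded_measurable U ->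
  bounded_measurable (U : O -> R).
Proof. by move=> bU; exact: bm_comp bU mid. Qed.

Lemma bm_innovation f i : bounded_measurable f -> bounded_measurable (innovation f i).
Proof.
move=> bf; apply: bmB; last by apply: bm_from_past; exact: bm_block_kernel.
by apply: bm_comp bf _; exact: measurable_fun_pair.
Qed.

(** The increments are orthogonal, and the conditional variance of each is at most the conditional
    mean of [f ^ 2]. *)
Lemma block_second_moment f : bounded_measurable f ->
  \int[P]_w (\sum_(i < N) innovation f i w) ^+ 2 <=
  N%:R * \int[P]_w wkernel mu k (fun z => f z ^+ 2) w.
Proof.
move=> bf; set v := \int[P]_w wkernel mu k _ w.
have bf2 := bm_block_kernel (bmX 2 bf).
have step (n : nat) : (n <= N)%N ->
    \int[P]_w (partial_innovation f n w) ^+ 2 <= n%:R * v.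
  elim: n => [_|n IH nN].
    rewrite mul0r; under eq_Rintegral do
      rewrite /partial_innovation big_pred0_eq expr0n.
    by rewrite Rintegral_prob_cst.
  pose i := Ordinal nN.
  have bM := bm_partial_innovation n bf; have bMO := bm_from_chain bM.
  have bi := bm_innovation i bf.
  have -> : \int[P]_w (partial_innovation f n.+1 w) ^+ 2 =
      \int[P]_w ((partial_innovation f n w) ^+ 2 +
       (2 * (partial_innovation f n w * innovation f i w) + innovation f i w ^+ 2)).
    by apply: eq_Rintegral => w _; rewrite (partial_innovationS f i); ring.
  have b1 := bmX 2 bMO; have b2 := bmZ 2 (bmM bMO bi); have b3 := bmX 2 bi.
  rewrite bm_RintegralD//; last exact: bmD.
  rewrite bm_RintegralD// bm_RintegralZ; last exact: bmM.
  rewrite (innovation_orthogonal (i := i) bM bf) mulr0 add0r innovation_variance//.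
  rewrite -natr1 mulrDl mul1r lerD ?IH// 1?ltnW//.
  apply: bm_le_Rintegral.
  - by apply: bmB; apply: bm_from_past => //; apply: bmX; exact: bm_block_kernel.
  - exact: bm_from_past.
  - by move=> w; rewrite lerBlDr lerDl sqr_ge0.
have := step N (leqnn N); congr (_ <= _).
by apply: eq_Rintegral => w _; congr (_ ^+ 2); apply: eq_bigl => j; rewrite ltn_ord.
Qed.

Section central_limit.
Variables (psi : X -> R) (M s2 : R).
Hypotheses (bpsi : bounded_measurable psi) (psiM : forall x, `|psi x| <= M).
Hypotheses (N0 : (0 < N)%N) (s2_ge0 : 0 <= s2) (s2M : s2 <= 4 * M ^+ 2).

Let f (z : S * X) : R := psi z.2.

Let bf : bounded_measurable f.
Proof. by apply: bm_comp bpsi _; exact: measurable_snd. Qed.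

Let M0 : 0 <= M. Proof. exact: le_trans (normr_ge0 _) (psiM point). Qed.

Let sN : R := Num.sqrt N%:R.

Let NR0 : 0 < N%:R :> R. Proof. by rewrite ltr0n. Qed.

Let sN0 : 0 < sN. Proof. by rewrite sqrtr_gt0. Qed.

Let sN2 : sN ^+ 2 = N%:R. Proof. by rewrite sqr_sqrtr// ltW. Qed.

Definition block_variance (w : S) : R :=
  wkernel mu k (fun z => psi z.2 ^+ 2) w - wkernel mu k (fun z => psi z.2) w ^+ 2.

Lemma bm_block_variance : bounded_measurable block_variance.
Proof.
apply: bmB; first by apply: bm_block_kernel; exact: (bmX 2 bf).
by apply: bmX; exact: (bm_block_kernel bf).
Qed.

Let block_mean_le w : `|wkernel mu k f w| <= M.
Proof. exact: block_kernel_norm_le. Qed.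

(** Second order expansion around [a]: the increment is centered, so the first order term vanishes,
    and the second order term gives the conditional variance. *)
Let cos_step (a : R) (w : S) :
  `|wkernel mu k (fun z => cos (a + (psi z.2 - wkernel mu k f w) / sN)) w -
    (1 - block_variance w / (2 * N%:R)) * cos a| <= 8 * M ^+ 3 / sN ^+ 3.
Proof.
set m := wkernel mu k f w.
pose y (z : S * X) := (psi z.2 - m) / sN.
have by_ : bounded_measurable y.
  by apply: bmM; [apply: bmB; [exact: bf|exact: bm_cst]|exact: bm_cst].
pose g z := cos a - y z * sin a - y z ^+ 2 / 2 * cos a.
have bg : bounded_measurable g.
  apply: bmB; first apply: bmB; first exact: bm_cst.
    by apply: bmM by_ _; exact: bm_cst.
  by apply: bmM; [apply: bmM; [exact: bmX|]|]; exact: bm_cst.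
have bc : bounded_measurable (fun z => cos (a + y z)).
  by apply: bm_cos; apply: measurable_funD => //; exact: bm_measurable.
have gE : wkernel mu k g w = (1 - block_variance w / (2 * N%:R)) * cos a.
  pose c2 := - (cos a / (2 * N%:R)).
  pose c1 := m * cos a / N%:R - sin a / sN.
  pose c0 := cos a + m * sin a / sN - m ^+ 2 / (2 * N%:R) * cos a.
  have -> : g = (fun z => c2 * psi z.2 ^+ 2 + (c1 * f z + c0)).
    apply/funext => z; rewrite /g /y /c0 /c1 /c2 /f -sN2; field.
    by rewrite gt_eqF.
  have b0 : bounded_measurable (fun z : S * X => c1 * f z + c0).
    by apply: bmD; [exact: bmZ|exact: bm_cst].
  rewrite block_kernel_lin//; last exact: (bmX 2 bf).
  rewrite block_kernel_lin//; last exact: bm_cst.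
  rewrite block_kernel_cst /block_variance -/f -/m /c0 /c1 /c2 -sN2.
  by field; rewrite gt_eqF.
rewrite -gE.
have -> : wkernel mu k (fun z => cos (a + y z)) w - wkernel mu k g w =
    wkernel mu k (fun z => (-1) * g z + cos (a + y z)) w.
  by rewrite block_kernel_lin//; ring.
apply: block_kernel_norm_le => [|x].
  by apply: bmD => //; exact: bmZ.
rewrite mulN1r addrC; apply: le_trans (cos_expansion _ _) _.
rewrite /y /= normrM normfV (gtr0_norm sN0) expr_div_n.
apply: ler_wpM2r; first by rewrite invr_ge0 exprn_ge0// ltW.
(* [psi] and its conditional mean are both bounded by [M], so the increment is bounded by
   [2 * M]. *)
have -> : 8 * M ^+ 3 = (2 * M) ^+ 3 by ring.
apply: lerXn2r; rewrite ?nnegrE ?mulr_ge0//.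
apply: le_trans (ler_normB _ _) _; have := psiM x; have := block_mean_le w.
by rewrite -/m; lra.
Qed.

(** The limit factor contributed by one variable; its [N]-th power is [exp (- s2 / 2)]. *)
Let r : R := expR (- (s2 / (2 * N%:R))).

Let r_near w : `|(1 - block_variance w / (2 * N%:R)) - r| <=
  `|block_variance w - s2| / (2 * N%:R) + 4 * M ^+ 4 / N%:R ^+ 2.
Proof.
set t := s2 / (2 * N%:R).
have t0 : 0 <= t by apply: divr_ge0 => //; apply: mulr_ge0 => //; exact: ltW.
have t1 : 1 - t <= r by have := expR_ge1Dx (- t).
(* From [r * (1 + t) <= 1], a form of [exp t >= 1 + t]. *)
have t2 : r <= 1 - t + t ^+ 2.
  have r0 : 0 < r := expR_gt0 _.
  have h : r * (1 + t) <= 1.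
    rewrite -[leRHS](expR0 R) -(addNr t) expRD; apply: ler_wpM2l; first exact: ltW.
    exact: expR_ge1Dx.
  have : 0 <= t * (1 - r * (1 + t)) + t ^+ 3 by rewrite addr_ge0 ?mulr_ge0 ?exprn_ge0 ?subr_ge0.
  by nra.
have tM : t ^+ 2 <= 4 * M ^+ 4 / N%:R ^+ 2.
  have -> : 4 * M ^+ 4 / N%:R ^+ 2 = (2 * M ^+ 2 / N%:R) ^+ 2.
    by field; rewrite gt_eqF.
  have p0 : 0 <= 2 * M ^+ 2 / N%:R.
    by apply: divr_ge0; [apply: mulr_ge0 => //; exact: sqr_ge0|exact: ltW].
  apply: lerXn2r; rewrite ?nnegrE//.
  rewrite /t invfM mulrA; apply: ler_wpM2r; first by rewrite invr_ge0 ltW.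
  by have := s2M; lra.
have -> : 1 - block_variance w / (2 * N%:R) - r =
   (s2 - block_variance w) / (2 * N%:R) + (1 - t - r).
  by rewrite /t; field; rewrite gt_eqF.
apply: le_trans (ler_normD _ _) _; apply: lerD.
  by rewrite normrM distrC normfV (gtr0_norm (x := 2 * _)) ?mulr_gt0.
by rewrite ler_norml; apply/andP; split; lra.
Qed.

Let partial_phase (al : S -> R) (i : nat) (w : O) : R :=
  al w + partial_innovation f i w / sN.

Let measurable_partial_phase al i : measurable_fun setT al ->
  measurable_fun setT (partial_phase al i : Sc i -> R).
Proof.
move=> mal; apply: measurable_funD.
  exact: (measurableT_comp mal (@id_chain i)).
by apply: measurable_funM => //; apply: bm_measurable; exact: bm_partial_innovation.
Qed.

Let step_error := 8 * M ^+ 3 / sN ^+ 3 + (4 * M ^+ 4 / N%:R ^+ 2 +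
  (\int[P]_w `|block_variance w - s2|) / (2 * N%:R)).

Let bm_phase_chain al i : measurable_fun setT al ->
  bounded_measurable (fun w : Sc i => cos (partial_phase al i w)).
Proof. by move=> mal; apply: bm_cos; exact: measurable_partial_phase. Qed.

Let phase_step al (i : 'I_N) : measurable_fun setT al ->
  `|\int[P]_w cos (partial_phase al i.+1 w) -
    r * \int[P]_w cos (partial_phase al i w)| <= step_error.
Proof.
move=> mal.
have bV := bm_from_past bm_block_variance.
have bph := bm_from_chain (@bm_phase_chain _ i mal).
pose F (z : Sc i * X) : R :=
  cos (partial_phase al i z.1 + (psi z.2 - wkernel mu k f z.1) / sN).
have bF : bounded_measurable F.
  apply: bm_cos; apply: measurable_funD.
    exact: measurableT_comp (@measurable_partial_phase _ i mal) measurable_fst.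
  apply: measurable_funM => //; apply: measurable_funB.
    exact: measurableT_comp (bm_measurable bpsi) measurable_snd.
  exact: bm_measurable (bm_chain_fst i (bm_block_kernel bf)).
have -> : \int[P]_w cos (partial_phase al i.+1 w) = \int[P]_w F (w, xi i w).
  apply: eq_Rintegral => w _; rewrite /F /partial_phase partial_innovationS.
  by rewrite mulrDl addrA.
rewrite block_expectation//.
have bKF : bounded_measurable (fun w : O => wkernel mu (k : Sc i * X -> R) F w).
  apply: (@bm_from_chain i); apply: bm_wkernel bF => //.
  exact: (measurableT_comp mk (@mid_chain_pair i)).
have bB : bounded_measurable (fun w : O => `|block_variance w - s2|).
  by apply: bm_norm; apply: bmB => //; exact: bm_cst.
rewrite -bm_RintegralZ// -bm_RintegralB//; last exact: bmZ.
apply: le_trans (bm_norm_Rintegral _ _) _; first by apply: bmB => //; exact: bmZ.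
have -> : step_error = \int[P]_w ((2 * N%:R)^-1 * `|block_variance w - s2| +
    (8 * M ^+ 3 / sN ^+ 3 + 4 * M ^+ 4 / N%:R ^+ 2)).
  rewrite bm_RintegralD; [|exact: bmZ|exact: bm_cst].
  by rewrite bm_RintegralZ// Rintegral_prob_cst /step_error; ring.
apply: bm_le_Rintegral.
- by apply: bm_norm; apply: bmB => //; exact: bmZ.
- by apply: bmD; [exact: bmZ|exact: bm_cst].
move=> w; set a := partial_phase al i w.
have -> : wkernel mu (k : Sc i * X -> R) F w - r * cos a =
   (wkernel mu k (fun z => cos (a + (psi z.2 - wkernel mu k f w) / sN)) w -
    (1 - block_variance w / (2 * N%:R)) * cos a) +
   ((1 - block_variance w / (2 * N%:R)) - r) * cos a.
  have -> : wkernel mu (k : Sc i * X -> R) F w =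
    wkernel mu k (fun z => cos (a + (psi z.2 - wkernel mu k f w) / sN)) w by [].
  by ring.
apply: le_trans (ler_normD _ _) _.
have h1 := cos_step a w.
have h2 : `|((1 - block_variance w / (2 * N%:R)) - r) * cos a| <=
   `|block_variance w - s2| / (2 * N%:R) + 4 * M ^+ 4 / N%:R ^+ 2.
  apply: le_trans _ (r_near w); rewrite normrM ler_piMr//; exact: cos_max.
apply: le_trans (lerD h1 h2) _.
by rewrite (mulrC _^-1) addrCA -addrA.
Qed.

(** Iterates [phase_step] over the block; since [0 <= r <= 1], the [N] one-step errors simply add.
    The phase [al] is any function of the past, which lets the estimate be chained over the
    generations. *)
Lemma block_clt (al : S -> R) : measurable_fun setT al ->
  `|\int[P]_w cos (al w + (\sum_(i < N) innovation f i w) / sN) -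
    expR (- (s2 / 2)) * \int[P]_w cos (al w)| <=
  (8 * M ^+ 3 + 4 * M ^+ 4) / sN + (\int[P]_w `|block_variance w - s2|) / 2.
Proof.
move=> mal; set v := \int[P]_w `|_|.
have r01 : 0 <= r <= 1.
  rewrite expR_ge0 /= -(expR0 R) ler_expR oppr_le0.
  by apply: divr_ge0 => //; apply: mulr_ge0 => //; exact: ltW.
have iter (n : nat) : (n <= N)%N ->
    `|\int[P]_w cos (partial_phase al n w) - r ^+ n * \int[P]_w cos (al w)| <=
    n%:R * step_error.
  elim: n => [_|n IH nN].
    rewrite mul0r expr0 mul1r (_ : \int[P]_w cos (partial_phase al 0 w) = \int[P]_w cos (al w)) ?subrr ?normr0//.
    apply: eq_Rintegral => w _; rewrite /partial_phase /partial_innovation.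
    by rewrite big_pred0_eq mul0r addr0.
  have h := phase_step (Ordinal nN) mal; have := IH (ltnW nN).
  set e0 := \int[P]_w cos (al w); set en := \int[P]_w cos (partial_phase al n w).
  move: h => /=; set en1 := \int[P]_w cos (partial_phase al n.+1 w) => h {}IH.
  have -> : en1 - r ^+ n.+1 * e0 = (en1 - r * en) + r * (en - r ^+ n * e0).
    by rewrite exprS; ring.
  apply: le_trans (ler_normD _ _) _; rewrite -natr1 mulrDl mul1r addrC.
  apply: lerD => //; apply: le_trans _ IH.
  case/andP: r01 => ra rb.
  by rewrite normrM (ger0_norm ra) ler_piMl.
have := iter N (leqnn N).
have -> : r ^+ N = expR (- (s2 / 2)).
  by rewrite /r -expRM_natl; congr expR; field; rewrite gt_eqF.
have -> : \int[P]_w cos (partial_phase al N w) =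
    \int[P]_w cos (al w + (\sum_(i < N) innovation f i w) / sN).
  apply: eq_Rintegral => w _; rewrite /partial_phase /partial_innovation.
  by congr (cos (_ + _ / _)); apply: eq_bigl => j; rewrite ltn_ord.
move=> h; apply: le_trans h _.
(* With this, [1 / N <= 1 / sqrt N] and the two deterministic errors merge. *)
have sN1 : 1 <= sN by rewrite -sqrtr1 ler_sqrt// ler1n.
have -> : N%:R * step_error = 8 * M ^+ 3 / sN + 4 * M ^+ 4 / sN ^+ 2 + v / 2.
  rewrite /step_error -/v -sN2; field; rewrite gt_eqF//.
rewrite lerD2r [leRHS]mulrDl lerD2l; apply: ler_wpM2l; first by rewrite mulr_ge0 ?exprn_ge0.
by rewrite lef_pV2 ?posrE ?exprn_gt0// expr2 ler_peMl// ltW.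
Qed.

End central_limit.

End conditionally_independent_block.

(** * Gaussian laws and cosine transforms *)

Section gaussian_cosine.
Context {R : realType}.
Notation leb := (@lebesgue_measure R).

(** Fundamental theorem of calculus on [- (n + 1), n + 1], then dominated convergence. *)
Lemma Rintegral_derivative_eq0 (F f : R -> R) :
  (forall x : R, is_derive x (1 : R) F (f x)) -> continuous f ->
  leb.-integrable setT (EFin \o f) ->
  F n%:R @[n --> \oo] --> (0 : R) -> F (- n%:R) @[n --> \oo] --> (0 : R) ->
  \int[leb]_x f x = 0.
Proof.
move=> dF cf intf F1 F2.
have mf : measurable_fun setT f by apply/measurable_EFinP; exact: measurable_int intf.
pose A (n : nat) := `[- n.+1%:R, n.+1%:R]%classic : set R.
have FTC n : (\int[leb]_(x in A n) (f x)%:E = (F n.+1%:R)%:E - (F (- n.+1%:R))%:E)%E.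
  apply: continuous_FTC2.
  - by have := ltr0Sn R n; lra.
  - exact: continuous_subspaceT.
  - have cF : continuous F.
      by move=> x; apply: differentiable_continuous; apply/derivable1_diffP; exact: ex_derive.
    split.
    + by move=> x _; exact: ex_derive.
    + exact: cvg_at_right_filter (cF _).
    + exact: cvg_at_left_filter (cF _).
  - by move=> x _; rewrite derive1E; exact: derive_val.
have cvg1 : (\int[leb]_(x in A n) (f x)%:E)%E @[n --> \oo] --> (\int[leb]_x (f x)%:E)%E.
  rewrite [X in X @ _ --> _](_ : _ =
      (fun n => \int[leb]_x ((EFin \o f) \_ (A n)) x)%E); last first.
    by apply/funext => n; rewrite integral_mkcond.
  have [] := @dominated_convergence _ _ _ leb setT measurableT
    (fun n => (EFin \o f) \_ (A n)) (EFin \o f) (fun x => `|(f x)%:E|)%E.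
  - move=> n; apply/(measurable_restrictT _ _).1; first exact: measurable_itv.
    by apply: measurable_funTS; exact/measurable_EFinP.
  - exact/measurable_EFinP.
  - apply: aeW => x _; apply: cvg_near_cst; near=> n.
    rewrite patchE mem_set// /A /= in_itv /= -ler_norml.
    apply: le_trans (ltW (archi_boundP (normr_ge0 x))) _; rewrite ler_nat ltnW// ltnS.
    by near: n; exact: nbhs_infty_ge.
  - exact: integrable_abse.
  - by apply: aeW => x n _; rewrite patchE; case: ifP => // _; rewrite abse0 abse_ge0.
  - by [].
have cvg2 : (\int[leb]_(x in A n) (f x)%:E)%E @[n --> \oo] --> (0 : R)%:E.
  under eq_fun do rewrite FTC -EFinB.
  apply: cvg_EFin; first exact: nearW.
  rewrite -[X in _ --> X](subr0 (0 : R)); apply: (@cvgB _ R^o).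
    by rewrite (cvg_shiftS (fun n => F n%:R)).
  by rewrite (cvg_shiftS (fun n => F (- n%:R))).
by rewrite /Rintegral (cvg_unique _ cvg1 cvg2).
Unshelve. all: by end_near. Qed.

Section centered_normal_density.
Variable s : R.
Hypothesis s0 : 0 < s.
Notation n_ := (normal_pdf 0 s).

Let sn0 : s != 0. Proof. by rewrite gt_eqF. Qed.

Lemma is_derive_normal_pdf (x : R) : is_derive x (1 : R) n_ (- x / s ^+ 2 * n_ x).
Proof.
rewrite normal_pdfE//.
have d1 : is_derive x (1 : R) (fun y => - (y - 0) ^+ 2 / (s ^+ 2 *+ 2)) (- x / s ^+ 2).
  apply: is_derive_eq; rewrite /GRing.scale /=. field.
  exact: sn0.
have := is_deriveZ (normal_peak s) (is_derive1_comp (is_derive_expR _) d1).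
by move=> H; apply: is_derive_eq H _; rewrite /normal_fun /GRing.scale /=; ring.
Qed.

Let n0 x : 0 <= n_ x. Proof. exact: normal_pdf_ge0. Qed.

Lemma normal_pdf_integrable_weight (f : R -> R) M : measurable_fun setT f ->
  (forall x, `|f x| <= M) -> leb.-integrable setT (EFin \o (fun x => n_ x * f x)).
Proof.
move=> mf fM; apply: integrable_weight; first exact: integrable_normal_pdf.
by split => //; exists M.
Qed.

(** With [u = x ^ 2 / (4 s ^ 2)], one has [|x| <= s (1 + u) <= s exp u], and half of the Gaussian
    exponent absorbs [exp u]. The bound gives both an integrable majorant and the decay at
    infinity. *)
Lemma abs_mul_normal_pdf_le (x : R) : `|x| * n_ x <= s * normal_peak s *
  normal_fun 0 (s * Num.sqrt 2) x.
Proof.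
rewrite normal_pdfE// mulrCA [s * _]mulrC -mulrA; apply: ler_wpM2l.
  exact: normal_peak_ge0.
rewrite /normal_fun !subr0 exprMn sqr_sqrtr//.
set u := x ^+ 2 / (s ^+ 2 * 2 *+ 2).
have -> : - x ^+ 2 / (s ^+ 2 * 2 *+ 2) = - u by rewrite mulNr.
have -> : - x ^+ 2 / (s ^+ 2 *+ 2) = - u + - u by rewrite /u; field.
rewrite expRD mulrA; apply: ler_wpM2r; first exact: expR_ge0.
rewrite -ler_pdivlMr ?expR_gt0// -expRN opprK.
apply: le_trans (ler_wpM2l (ltW s0) (expR_ge1Dx u)).
have -> : s * (1 + u) = s + x ^+ 2 / (4 * s) by rewrite /u; field.
rewrite -real_normK ?num_real//; have : 0 <= (`|x| - 2 * s) ^+ 2 by exact: sqr_ge0.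
move=> h; rewrite -subr_ge0.
have -> : s + `|x| ^+ 2 / (4 * s) - `|x| = (`|x| - 2 * s) ^+ 2 / (4 * s) by field.
by rewrite divr_ge0// mulr_ge0// ltW.
Qed.

Lemma integrable_abs_mul_normal_pdf :
  leb.-integrable setT (EFin \o (fun x => `|x| * n_ x)).
Proof.
have s20 : s * Num.sqrt 2 != 0 by rewrite mulf_neq0// gt_eqF// sqrtr_gt0.
have i2 : leb.-integrable setT (EFin \o normal_pdf 0 (s * Num.sqrt 2)).
  exact: integrable_normal_pdf.
pose c := s * normal_peak s / normal_peak (s * Num.sqrt 2).
have ic : leb.-integrable setT
    (fun x => c%:E * (EFin \o normal_pdf 0 (s * Num.sqrt 2)) x)%E.
  exact: integrableZl.
apply: le_integrable ic => //.
  apply/measurable_EFinP/measurable_funM; last exact: measurable_normal_pdf.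
  by apply: continuous_measurable_fun => x; exact: (@norm_continuous _ R^o).
move=> x _ /=; rewrite lee_fin ger0_norm ?mulr_ge0//.
apply: le_trans _ (ler_norm _); apply: le_trans (abs_mul_normal_pdf_le x) _.
rewrite normal_pdfE// le_eqVlt; apply/orP; left; apply/eqP; rewrite /c.
by field; rewrite gt_eqF// normal_peak_gt0.
Qed.

Lemma normal_pdf_cvg0 (u : R^nat) (M : R) (f : R -> R) :
  (forall n, `|u n| = n%:R) -> (forall x, `|f x| <= M) ->
  f (u n) * n_ (u n) @[n --> \oo] --> (0 : R).
Proof.
move=> un fM.
have M0 : 0 <= M := le_trans (normr_ge0 _) (fM 0).
pose K := M * (s * normal_peak s).
have bound n : `|f (u n.+1) * n_ (u n.+1)| <= K / n.+1%:R.
  rewrite ler_pdivlMr ?ltr0n// normrM (ger0_norm (n0 _)) -mulrA.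
  apply: ler_pM => //; first by rewrite mulr_ge0.
  rewrite mulrC -(un n.+1); apply: le_trans (abs_mul_normal_pdf_le _) _.
  have p0 : 0 <= s * normal_peak s.
    by apply: mulr_ge0; [exact: ltW|exact: normal_peak_ge0].
  apply: ler_piMr => //; rewrite /normal_fun -[leRHS](expR0 R) ler_expR mulNr oppr_le0.
  by apply: divr_ge0; [exact: sqr_ge0|rewrite mulrn_wge0// sqr_ge0].
rewrite -(cvg_shiftS (fun n => f (u n) * n_ (u n))) /=.
apply: norm_cvg0.
apply: (@squeeze_cvgr _ _ _ _ (fun=> 0) (fun n => K * (n.+1%:R)^-1)).
- by apply: nearW => n; rewrite normr_ge0 bound.
- exact: cvg_cst.
- by rewrite -(mulr0 K); apply: cvgMr; exact: cvg_harmonic.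
Qed.

(** Integration by parts: the derivative of [sin (a + t x) n_(x)] has integral zero. *)
Lemma normal_sin_mul (a t : R) :
  \int[leb]_x (x * sin (a + t * x) * n_ x) =
  s ^+ 2 * t * \int[leb]_x (n_ x * cos (a + t * x)).
Proof.
have i1 : leb.-integrable setT (EFin \o (fun x => n_ x * cos (a + t * x))).
  apply: (@normal_pdf_integrable_weight _ 1); last by move=> x; exact: cos_max.
  by apply: bm_measurable; apply: bm_cos; apply: measurable_funD => //; exact: measurable_funM.
have msin : measurable_fun setT (fun x => sin (a + t * x)).
  apply: (@measurableT_comp _ _ _ _ _ _ sin); first by apply: continuous_measurable_fun; exact: continuous_sin.
  by apply: measurable_funD => //; exact: measurable_funM.
have i2 : leb.-integrable setT (EFin \o (fun x => x * sin (a + t * x) * n_ x)).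
  apply: le_integrable integrable_abs_mul_normal_pdf => //.
    apply/measurable_EFinP; apply: measurable_funM; last exact: measurable_normal_pdf.
    exact: measurable_funM.
  move=> x _ /=; rewrite lee_fin !normrM normr_id; apply: ler_wpM2r => //.
  by rewrite -[leRHS]mulr1; apply: ler_wpM2l => //; exact: sin_max.
pose f x := t * (n_ x * cos (a + t * x)) + - s ^- 2 * (x * sin (a + t * x) * n_ x).
have if_ : leb.-integrable setT (EFin \o f).
  have -> : EFin \o f = (fun x => t%:E * (EFin \o (fun x => (n_ x * cos (a + t * x))%R)) x
     + (- s ^- 2)%:E * (EFin \o (fun x => (x * sin (a + t * x) * n_ x)%R)) x)%E.
    by apply/funext => x; rewrite /f /= EFinD !EFinM.
  by apply: integrableD => //; exact: integrableZl.
have : \int[leb]_x f x = 0.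
  apply: (@Rintegral_derivative_eq0 (fun x => sin (a + t * x) * n_ x)) => //.
  - move=> x; have dn := is_derive_normal_pdf x.
    by apply: is_derive_eq; rewrite /f /GRing.scale /=; field.
  - move=> x; have dn := is_derive_normal_pdf x.
    by apply: differentiable_continuous; apply/derivable1_diffP; exact: ex_derive.
  - apply: (@normal_pdf_cvg0 (fun n => n%:R) 1 (fun x => sin (a + t * x))).
      by move=> n; rewrite ger0_norm.
    by move=> x; exact: sin_max.
  - apply: (@normal_pdf_cvg0 (fun n => - n%:R) 1 (fun x => sin (a + t * x))).
      by move=> n; rewrite normrN ger0_norm.
    by move=> x; exact: sin_max.
rewrite /f Rintegral_lin; last 2 first.
- exact: i1.
- have -> : EFin \o (fun x => - s ^- 2 * (x * sin (a + t * x) * n_ x)) =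
    (fun x => (- s ^- 2)%:E * (EFin \o (fun x => (x * sin (a + t * x) * n_ x)%R)) x)%E.
    by [].
  exact: integrableZl.
rewrite RintegralZl// mulNr => /subr0_eq E.
by rewrite -mulrA E mulrA divff ?mul1r// expf_neq0.
Qed.

(** As a function of [t] the integral solves [F' = - s ^ 2 t F], by differentiation under the
    integral and [normal_sin_mul], so that [exp (s ^ 2 t ^ 2 / 2) F] is constant. *)
Lemma normal_cos (a t : R) :
  \int[leb]_x (n_ x * cos (a + t * x)) = expR (- (s ^+ 2 * t ^+ 2 / 2)) * cos a.
Proof.
pose F (t : R) := \int[leb]_x (n_ x * cos (a + t * x)).
have dF (u : R) : is_derive u (1 : R) F (- (s ^+ 2 * u * F u)).
  pose f (v x : R) := n_ x * cos (a + v * x).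
  have df (v x : R) : is_derive v (1 : R) (f ^~ x) (- (x * sin (a + v * x) * n_ x)).
    by apply: is_derive_eq; rewrite /GRing.scale /=; ring.
  have Iu : [set` `]u - 1, u + 1[%R] u by rewrite /= in_itv /=; lra.
  have intf v : [set` `]u - 1, u + 1[%R] v -> leb.-integrable setT (EFin \o f v).
    move=> _; apply: (@normal_pdf_integrable_weight _ 1); last by move=> x; exact: cos_max.
    by apply: bm_measurable; apply: bm_cos; apply: measurable_funD => //; exact: measurable_funM.
  have der v y : [set` `]u - 1, u + 1[%R] v -> setT y -> derivable (f ^~ y) v 1.
    by move=> _ _; exact: ex_derive.
  have G0 (x : R) : 0 <= `|x| * n_ x by rewrite mulr_ge0.
  have Gub v y : [set` `]u - 1, u + 1[%R] v -> setT y ->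
      `|partial1of2 f v y| <= `|y| * n_ y.
    move=> _ _; rewrite partial1of2E (@derive_val _ _ _ _ _ _ _ (df v y)).
    rewrite normrN !normrM (ger0_norm (n0 _)); apply: ler_wpM2r => //.
    by rewrite -[leRHS]mulr1; apply: ler_wpM2l => //; exact: sin_max.
  have E := @differentiation_under_integral _ _ _ leb f setT measurableT u _ _ Iu
    intf der _ G0 integrable_abs_mul_normal_pdf Gub.
  have D := @derivable_under_integral _ _ _ leb f setT measurableT u _ _ Iu
    intf der _ G0 integrable_abs_mul_normal_pdf Gub.
  apply: DeriveDef => //; rewrite -derive1E E -normal_sin_mul.
  rewrite -[RHS]mulN1r -RintegralZl//; last first.
    apply: le_integrable integrable_abs_mul_normal_pdf => //.
      apply/measurable_EFinP; apply: measurable_funM; last exact: measurable_normal_pdf.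
      apply: measurable_funM => //.
      apply: (@measurableT_comp _ _ _ _ _ _ sin); first by apply: continuous_measurable_fun; exact: continuous_sin.
      by apply: measurable_funD => //; exact: measurable_funM.
    move=> x _ /=; rewrite lee_fin !normrM normr_id; apply: ler_wpM2r => //.
    by rewrite -[leRHS]mulr1; apply: ler_wpM2l => //; exact: sin_max.
  apply: eq_Rintegral => x _.
  by rewrite partial1of2E (@derive_val _ _ _ _ _ _ _ (df u x)) mulN1r.
pose H (u : R) := expR (s ^+ 2 * u ^+ 2 / 2) * F u.
have dH (u : R) : is_derive u (1 : R) H 0.
  have d1 : is_derive u (1 : R) (fun u => s ^+ 2 * u ^+ 2 / 2) (s ^+ 2 * u).
    by apply: is_derive_eq; rewrite /GRing.scale /=; field.
  have d2 := is_derive1_comp (is_derive_expR _) d1.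
  have := is_deriveM d2 (dF u) => dd.
  by apply: is_derive_eq dd _; rewrite /GRing.scale /=; ring.
have E : H t = H 0 by apply: is_derive_0_is_cst.
have F0 : F 0 = cos a.
  rewrite /F; under eq_Rintegral do rewrite mul0r addr0.
  rewrite RintegralZr//; last exact: integrable_normal_pdf.
  by rewrite /Rintegral integral_normal_pdf mul1r.
move: E; rewrite /H F0 expr0n /= mulr0 mul0r expR0 mul1r -/(F t) => <-.
by rewrite mulrA -expRD addNr expR0 mul1r.
Qed.

End centered_normal_density.

End gaussian_cosine.

Section laws_of_random_variables.
Context d (O : measurableType d) (R : realType) (P : probability O R).

Lemma Rintegral_distribution d' (T : measurableType d') (Z : {mfun O >-> T})
    (h : T -> R) : bounded_measurable h ->
  \int[distribution P Z]_x h x = \int[P]_w h (Z w).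
Proof.
move=> bh; rewrite /Rintegral integral_distribution//.
  by apply/measurable_EFinP; exact: bm_measurable.
by apply: bm_integrable; exact: bm_comp bh (measurable_funP Z).
Qed.

Lemma centered_gaussian_cos (Z : O -> R) (s2 a t : R) : 0 <= s2 ->
  centered_gaussian P Z s2 ->
  \int[P]_w cos (a + t * Z w) = expR (- (s2 * t ^+ 2 / 2)) * cos a.
Proof.
move=> s20 [mZ lawZ].
have mZ' : measurable_fun setT (Z : O -> measurableTypeR R) by exact: mZ.
pose Zm : {mfun O >-> measurableTypeR R} :=
  HB.pack (Z : O -> measurableTypeR R) (isMeasurableFun.Build _ _ _ _ _ mZ').
have bh : bounded_measurable (fun x : measurableTypeR R => cos (a + t * x)).
  by apply: bm_cos; apply: measurable_funD => //; exact: measurable_funM.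
rewrite -(Rintegral_distribution Zm bh).
have [s2E|s2N] := eqVneq s2 0.
  rewrite s2E mul0r mul0r oppr0 expR0 mul1r /Rintegral.
  rewrite (eq_measure_integral (dirac (0 : measurableTypeR R))); last first.
    by move=> A mA _; have := lawZ A mA; rewrite /centered_normal s2E eqxx.
  rewrite integral_dirac//; last by apply/measurable_EFinP; exact: bm_measurable.
  by rewrite diracT mul1e /= mulr0 addr0.
have s2p : 0 < s2 by rewrite lt_neqAle eq_sym s2N.
have sp : 0 < Num.sqrt s2 by rewrite sqrtr_gt0.
transitivity (\int[normal_prob 0 (Num.sqrt s2)]_x cos (a + t * x)).
  congr fine; apply: (@eq_measure_integral _ _ _ setT (normal_prob 0 (Num.sqrt s2))
    (distribution P Zm)) => A mA _.
  by have := lawZ A mA; rewrite /centered_normal (negbTE s2N).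
have -> : s2 * t ^+ 2 / 2 = Num.sqrt s2 ^+ 2 * t ^+ 2 / 2 by rewrite sqr_sqrtr.
rewrite -normal_cos//.
set nu := normal_prob 0 (Num.sqrt s2); pose n_ : measurableTypeR R -> R := normal_pdf 0 (Num.sqrt s2).
have pos (h : measurableTypeR R -> R) : bounded_measurable h -> (forall x, 0 <= h x) ->
    \int[nu]_x h x = \int[lebesgue_measure]_x (n_ x * h x).
  move=> bh' h0; congr fine.
  have mhE : measurable_fun setT (EFin \o h).
    by apply/measurable_EFinP; exact: bm_measurable.
  have h0E x : (0 <= (EFin \o h) x)%E by rewrite lee_fin.
  have nE A : measurable A -> nu A = (\int[lebesgue_measure]_(x in A) (n_ x)%:E)%E by [].
  have mn : measurable_fun setT n_ by exact: measurable_normal_pdf.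
  have n0 x : 0 <= n_ x by exact: normal_pdf_ge0.
  rewrite (ge0_integral_density mn n0 nE mhE h0E).
  by apply: eq_integral => x _; rewrite -EFinM mulrC.
have b1 : bounded_measurable (fun _ : measurableTypeR R => 1 : R) by exact: bm_cst.
have in_ : (@lebesgue_measure R).-integrable setT (EFin \o n_).
  exact: integrable_normal_pdf.
have E := pos _ (bmD bh b1) _.
(* The change of density is stated for nonnegative functions, hence the added 1. *)
transitivity (\int[nu]_x (cos (a + t * x) + 1) - \int[nu]_x 1).
  rewrite -bm_RintegralB//; last exact: bmD.
  by apply: eq_Rintegral => x _; rewrite addrK.
rewrite E; last by move=> x; have := cos_geN1 (a + t * x); lra.
rewrite (pos _ b1)// -RintegralB//; [|exact: integrable_weight in_ (bmD bh b1)|exact: integrable_weight in_ b1].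
by apply: eq_Rintegral => x _; rewrite /n_ mulrDr mulr1 addrK.
Qed.

Lemma trivial_sigma_algebra (A : set O) : <<s set0 >> A -> A = set0 \/ A = setT.
Proof.
apply: (@smallest_sub _ (sigma_algebra setT) set0 [set A | A = set0 \/ A = setT]) => //.
split => /=; first by left.
- by move=> B [->|->]; [right; rewrite setD0|left; rewrite setDv].
- move=> F HF; have [[n Fn]|H] := pselect (exists n, F n = setT).
    by right; rewrite -subTset => w _; exists n => //; rewrite Fn.
  left; apply/seteqP; split => // w [n _ Fnw].
  by have [F0|FT] := HF n; [move: Fnw; rewrite F0|case: H; exists n].
Qed.

Section independent_sum.
Variables (N : nat) (Y : 'I_N -> O -> R) (v : 'I_N -> R).
Hypothesis mY : forall i, measurable_fun setT (Y i).
Hypothesis indepY : forall B : 'I_N -> set R, (forall i, measurable (B i)) ->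
  P (\bigcap_(i in [set: 'I_N]) (Y i @^-1` B i)) = (\prod_(i < N) P (Y i @^-1` B i))%E.
Hypothesis cosY : forall i a t, \int[P]_w cos (a + t * Y i w) =
  expR (- (v i * t ^+ 2 / 2)) * cos a.

Let Ym i : {mfun O >-> R} := HB.pack (Y i) (isMeasurableFun.Build _ _ _ _ (Y i) (mY i)).

Let law (i : 'I_N) : {sigma_finite_measure set R -> \bar R} := distribution P (Ym i).

(** Independent variables form a conditionally independent chain over the trivial past: the
    reference measure of each is its own law, and the density is 1. *)
Let one (i : 'I_N) (z : g_sigma_algebraType (set0 : set (set O)) * R) : R := 1.

Let measurable_one i : measurable_fun setT (one i).
Proof. exact: measurable_cst. Qed.

Let one_law i (B : set R) : measurable B ->
  (\int[law i]_(x in B) (1 : R)%:E)%E = P (Y i @^-1` B).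
Proof. by move=> mB; rewrite integral_cst// mul1e. Qed.

Let one_prod (A : set O) (B : 'I_N -> set R) :
  <<s set0 >> A -> (forall i, measurable (B i)) ->
  P (A `&` \bigcap_(i in [set: 'I_N]) (Y i @^-1` B i)) =
  (\int[P]_(w in A) \prod_(i < N) \int[law i]_(x in B i) (one i (w, x))%:E)%E.
Proof.
move=> /trivial_sigma_algebra[->|->] mB.
  by rewrite set0I measure0 integral_set0.
rewrite setTI indepY//.
transitivity (\int[P]_w (cst (\prod_(i < N) P (Y i @^-1` B i)) w))%E.
  rewrite integral_cst//.
  rewrite (_ : (P : {measure set O -> \bar R}) setT = 1%E) ?mule1//.
  exact: probability_setT.
by apply: eq_integral => w _; apply: eq_bigr => i _; rewrite one_law.
Qed.

Lemma independent_sum_cos (a t : R) :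
  \int[P]_w cos (a + t * \sum_(i < N) Y i w) =
  expR (- ((\sum_(i < N) v i) * t ^+ 2 / 2)) * cos a.
Proof.
have step (n : nat) : (n <= N)%N ->
    \int[P]_w cos (a + t * \sum_(i < N | (i < n)%N) Y i w) =
    expR (- ((\sum_(i < N | (i < n)%N) v i) * t ^+ 2 / 2)) * cos a.
  elim: n => [_|n IH nN].
    rewrite big_pred0_eq !mul0r oppr0 expR0 mul1r -[RHS](Rintegral_prob_cst P).
    by apply: eq_Rintegral => w _; rewrite big_pred0_eq mulr0 addr0.
  pose i := Ordinal nN.
  have recr (u : 'I_N -> R) : \sum_(j < N | (j < n.+1)%N) u j =
      \sum_(j < N | (j < n)%N) u j + u i.
    rewrite (bigD1 i)//= addrC; congr (_ + _).
    by apply: eq_bigl => j; rewrite ltnS leq_eqVlt -val_eqE /=; case: ltngtP.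
  pose Sc := g_sigma_algebraType (chain_gens (set0 : set (set O)) Y i).
  pose A (w : Sc) : R := a + t * \sum_(j < N | (j < n)%N) Y j w.
  have mA : measurable_fun setT A.
    apply: measurable_funD => //; apply: measurable_funM => //.
    rewrite (_ : (fun w => _) = (fun w : Sc => \sum_(j < N) if (j < n)%N then Y j w else 0)); last first.
      by apply/funext => w; rewrite big_mkcond.
    apply: measurable_sum => j; have [ji|ji] := ltnP j n; last exact: measurable_cst.
    exact: measurable_chain_coord.
  have bF : bounded_measurable (fun z : Sc * R => cos (A z.1 + t * z.2)).
    apply: bm_cos; apply: measurable_funD.
      exact: measurableT_comp mA measurable_fst.
    by apply: measurable_funM => //; exact: measurable_snd.
  have E := @chain_expectation _ _ _ P _ _ _ N Y law one _ mY measurable_one _ _ one_prod i _ bF.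
  transitivity (\int[P]_w cos (A w + t * Y i w)).
    by apply: eq_Rintegral => w _; rewrite recr mulrDr addrA.
  rewrite E//=; first last.
  - by move=> j s; rewrite one_law// preimage_setT probability_setT.
  transitivity (\int[P]_w (expR (- (v i * t ^+ 2 / 2)) * cos (A w))).
    apply: eq_Rintegral => w _; rewrite -cosY /wkernel.
    rewrite -(Rintegral_distribution (Ym i) (h := fun x => cos (A w + t * x))).
      by apply: eq_Rintegral => x _; rewrite mul1r.
    by apply: bm_cos; apply: measurable_funD => //; exact: measurable_funM.
  rewrite bm_RintegralZ; last first.
    apply: bm_cos; apply: measurable_funD => //; apply: measurable_funM => //.
    rewrite (_ : (fun w => _) = (fun w : O => \sum_(j < N) if (j < n)%N then Y j w else 0)); last first.
      by apply/funext => w; rewrite big_mkcond.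
    by apply: measurable_sum => j; have [_|_] := ltnP j n.
  rewrite IH; last exact: ltnW.
  rewrite recr mulrA; set V := \sum_(j < N | _) v j; move: V (v i) => V vi.
  by rewrite -expRD; congr (expR _ * _); ring.
have := step N (leqnn N).
rewrite (eq_bigl xpredT); last by move=> j; rewrite ltn_ord.
move=> <-; apply: eq_Rintegral => w _; congr (cos (_ + _ * _)).
by apply: eq_bigl => j; rewrite ltn_ord.
Qed.

End independent_sum.

End laws_of_random_variables.

Section integrable_real_functions.
Context d (T : measurableType d) (R : realType) (m : {measure set T -> \bar R}).
Implicit Types f g : T -> R.

Lemma integrable_RD f g : m.-integrable setT (EFin \o f) ->
  m.-integrable setT (EFin \o g) ->
  m.-integrable setT (EFin \o (fun x => f x + g x)).
Proof. exact: integrableD. Qed.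

Lemma integrable_RZ c f : m.-integrable setT (EFin \o f) ->
  m.-integrable setT (EFin \o (fun x => c * f x)).
Proof. exact: integrableZl. Qed.

End integrable_real_functions.

Section bounded_continuous_functions_of_random_vectors.
Context d0 (O : measurableType d0) (R : realType) (d : nat) (Z : O -> 'rV[R]_d).
Hypothesis mZ : forall j, measurable_fun setT (fun w => Z w 0 j).

Lemma bm_trigpoly (tau : 'rV[R]_d -> R) : trigpoly tau ->
  bounded_measurable (fun w => tau (Z w)).
Proof.
elim=> [a b|c f g _ IHf _ IHg]; last by apply: bmD => //; exact: bmZ.
apply: bm_cos; apply: measurable_funD => //; apply: measurable_sum => j.
exact: measurable_funM.
Qed.

(** Only the coordinates of [Z] are assumed measurable. [h (Z w)] is the pointwise limit of
    trigonometric polynomials that approximate [h] within [1 / (n + 1)] on the box of radius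
    [n + 1]. *)
Lemma bm_continuous (h : 'rV[R]_d -> R) (M : R) : continuous h ->
  (forall v, `|h v| <= M) -> bounded_measurable (fun w => h (Z w)).
Proof.
move=> ch hM; split; last by exists M.
have /choice[tau tauP] (n : nat) : exists tau, [/\ trigpoly tau, forall v : 'rV[R]_d, `|tau v| <= M &
    forall v : 'rV[R]_d, (forall j, `|v 0 j| <= n.+1%:R) -> `|tau v - h v| <= (n.+1%:R : R)^-1].
  by apply: trig_approx => //; rewrite ?invr_gt0.
apply: (@measurable_fun_cvg _ _ _ setT (fun n w => tau n (Z w))).
- by move=> n; have [tt _ _] := tauP n; exact: bm_measurable (bm_trigpoly tt).
- move=> w _; apply/cvgrPdist_le => e e0; near=> n.
  have [_ _ H] := tauP n; rewrite distrC; apply: le_trans (H _ _) _.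
    move=> j; apply: le_trans (_ : \sum_i `|Z w 0 i| <= _).
      by rewrite (bigD1 j)//= lerDl sumr_ge0.
    apply: le_trans (ltW (archi_boundP _)) _; first exact: sumr_ge0.
    by rewrite ler_nat; apply: leqW; near: n; exact: nbhs_infty_ge.
  rewrite -[e]invrK lef_pV2 ?posrE ?invr_gt0//.
  apply: le_trans (ltW (archi_boundP _)) _; first by rewrite invr_ge0 ltW.
  by rewrite ler_nat; apply: leqW; near: n; exact: nbhs_infty_ge.
Unshelve. all: by end_near. Qed.

(** On the box the two functions differ by at most [e]. Outside, some [|Z_j|] exceeds [K], and the
    trivial bound [2 * M] is at most [2 * M / K] times the sum of the [|Z_j|]. *)
Lemma trigpoly_approx_expectation (P : probability O R) (h tau : 'rV[R]_d -> R)
    (M K C e : R) : continuous h -> trigpoly tau ->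
  (forall v, `|h v| <= M) -> (forall v, `|tau v| <= M) ->
  (forall v : 'rV[R]_d, (forall j, `|v 0 j| <= K) -> `|tau v - h v| <= e) -> 0 < K -> 0 <= e ->
  (forall j, P.-integrable setT (EFin \o (fun w => Z w 0 j))) ->
  (forall j, \int[P]_w `|Z w 0 j| <= C) ->
  `|\int[P]_w tau (Z w) - \int[P]_w h (Z w)| <= e + 2 * M * (d%:R * (C / K)).
Proof.
move=> ch tt hM tM th K0 e0 iZ ZC.
have M0 : 0 <= M := le_trans (normr_ge0 _) (hM 0).
have bt := bm_trigpoly tt; have bh := bm_continuous ch hM.
rewrite -bm_RintegralB//; apply: le_trans (bm_norm_Rintegral _ (bmB bt bh)) _.
have iS (r : seq 'I_d) : P.-integrable setT (EFin \o (fun w => \sum_(j <- r) `|Z w 0 j|)) /\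
    \int[P]_w (\sum_(j <- r) `|Z w 0 j|) = \sum_(j <- r) \int[P]_w `|Z w 0 j|.
  elim: r => [|j r [IH1 IH2]].
    rewrite big_nil (_ : (fun w => _) = fun=> 0); last by apply/funext => w; rewrite big_nil.
    by split; [apply: bm_integrable; exact: bm_cst|exact: Rintegral_prob_cst].
  rewrite big_cons (_ : (fun w => _) = fun w => `|Z w 0 j| + \sum_(j <- r) `|Z w 0 j|); last first.
    by apply/funext => w; rewrite big_cons.
  have inj : P.-integrable setT (EFin \o (fun w => `|Z w 0 j|)) by exact: integrable_norm (iZ j).
  split; last by rewrite RintegralD// IH2.
  exact: integrable_RD.
have [iS1 iS2] := iS (index_enum 'I_d).
have ie : P.-integrable setT (EFin \o (fun=> e)) by apply: bm_integrable; exact: bm_cst.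
have iSK : P.-integrable setT (EFin \o (fun w => 2 * M / K * \sum_j `|Z w 0 j|)).
  exact: integrable_RZ.
apply: (@le_trans _ _ (\int[P]_w (2 * M / K * \sum_j `|Z w 0 j| + e))); last first.
  rewrite Rintegral_lin// iS2 Rintegral_prob_cst addrC lerD2l.
  have -> : 2 * M * (d%:R * (C / K)) = 2 * M / K * \sum_(j < d) C.
    by rewrite sumr_const card_ord -mulr_natl; ring.
  apply: ler_wpM2l; first by apply: divr_ge0; [rewrite mulr_ge0|exact: ltW].
  exact: ler_sum.
apply: le_Rintegral => //.
- by apply: bm_integrable; apply: bm_norm; exact: bmB.
- exact: integrable_RD.
move=> w _; have S0 : 0 <= \sum_j `|Z w 0 j| by exact: sumr_ge0.
have [/forallP Hk|] := boolP [forall j, `|Z w 0 j| <= K].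
  by apply: le_trans (th _ Hk) _; rewrite lerDr mulr_ge0// divr_ge0 ?mulr_ge0// ltW.
rewrite negb_forall => /existsP[j]; rewrite -ltNge => Kj.
apply: le_trans (ler_normB _ _) _.
apply: le_trans (lerD (tM _) (hM _)) _; rewrite -[leLHS]addr0; apply: lerD => //.
set S := \sum_i _; have -> : 2 * M / K * S = 2 * M * (K^-1 * S) by rewrite mulrA.
have -> : M + M = 2 * M * 1 by ring.
apply: ler_wpM2l; first exact: mulr_ge0.
rewrite ler_pdivlMl// mulr1 /S.
by apply: le_trans (ltW Kj) _; rewrite (bigD1 j)//= lerDl sumr_ge0.
Qed.

End bounded_continuous_functions_of_random_vectors.

(** * Convergence in law from cosine transforms *)

Section cosine_transform_convergence.
Context (R : realType) (d : nat).
Context (dO : nat -> measure_display) (O : forall N, measurableType (dO N))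
  (P : forall N, probability (O N) R) (Z : forall N, O N -> 'rV[R]_d)
  (dL : measure_display) (L : measurableType dL) (PL : probability L R)
  (Z' : L -> 'rV[R]_d) (C : R).
Hypothesis mZ : forall N j, measurable_fun setT (fun w => @Z N w 0 j).
Hypothesis mZ' : forall j, measurable_fun setT (fun w => Z' w 0 j).
Hypothesis iZ : forall N j, (P N).-integrable setT (EFin \o (fun w => @Z N w 0 j)).
Hypothesis iZ' : forall j, PL.-integrable setT (EFin \o (fun w => Z' w 0 j)).
Hypothesis ZC : forall N j, \int[P N]_w `|@Z N w 0 j| <= C.
Hypothesis ZC' : forall j, \int[PL]_w `|Z' w 0 j| <= C.
Hypothesis cosZ : forall (a : 'rV[R]_d) (b : R),
  (fun N => \int[P N]_w cos (\sum_j a 0 j * @Z N w 0 j + b)) @ \oo -->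
  \int[PL]_w cos (\sum_j a 0 j * Z' w 0 j + b).

(** The uniform bound on the first moments plays the part of tightness: it makes the error of the
    trigonometric approximation outside a large box small uniformly in [N]. *)
Lemma cvg_in_law_of_cos : cvg_in_law P Z PL Z'.
Proof.
move=> h ch [M0 hM0].
pose M := M0 + 1.
have M00 : 0 <= M0 := le_trans (normr_ge0 _) (hM0 0).
have Mp : 0 < M by rewrite ltr_wpDl.
have hM v : `|h v| <= M by apply: le_trans (hM0 v) _; rewrite lerDl.
apply/cvgrPdist_le => e e0.
pose D := `|C| + 1; have Dp : 0 < D by rewrite ltr_wpDl.
have CD : C <= D by apply: le_trans (ler_norm C) _; rewrite lerDl.
(* Chosen so that the tail term of [trigpoly_approx_expectation] is at most [e / 8]; the comparisons
   below then add up to [5 e / 8]. *)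
pose K := 16 * M * (d%:R + 1) * D / e.
have d1 : 0 < d%:R + 1 :> R by rewrite ltr_wpDl.
have Kp : 0 < K by rewrite /K divr_gt0// !mulr_gt0.
have e8 : 0 < e / 8 by rewrite divr_gt0.
have [tau [tt tM th]] := trig_approx ch hM Kp e8.
have small : 2 * M * (d%:R * (D / K)) <= e / 8.
  have -> : 2 * M * (d%:R * (D / K)) = e / 8 * (d%:R / (d%:R + 1)).
    by rewrite /K; field; rewrite !gt_eqF.
  by apply: ler_piMr; [exact: ltW|rewrite ler_pdivrMr// mul1r lerDl].
have tauC : (fun N => \int[P N]_w tau (@Z N w)) @ \oo --> \int[PL]_w tau (Z' w).
  move: tt => {tM th} tt; elim: tt => [a b|c f g tf IHf tg IHg]; first exact: cosZ.
  have -> : (fun N => \int[P N]_w (c * f (@Z N w) + g (@Z N w))) =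
     (fun N => c * \int[P N]_w f (@Z N w) + \int[P N]_w g (@Z N w)).
    apply/funext => N; apply: Rintegral_lin; apply: bm_integrable;
      exact: (bm_trigpoly (@mZ N)).
  rewrite Rintegral_lin; [|by apply: bm_integrable; exact: (bm_trigpoly mZ')..].
  by apply: (@cvgD _ R^o) => //; apply: (@cvgMr _ _ _ _ (fun N => \int[P N]_w f (@Z N w))).
have lim_near := @trigpoly_approx_expectation _ L _ _ Z' mZ' PL h tau M K D (e / 8)
  ch tt hM tM th Kp (ltW e8) iZ' (fun j => le_trans (ZC' j) CD).
near=> N.
have N_near := @trigpoly_approx_expectation _ (O N) _ _ (@Z N) (@mZ N) (P N) h tau M K D (e / 8)
  ch tt hM tM th Kp (ltW e8) (@iZ N) (fun j => le_trans (@ZC N j) CD).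
have tau_near : `|\int[PL]_w tau (Z' w) - \int[P N]_w tau (@Z N w)| <= e / 8.
  near: N; move/cvgrPdist_le : tauC; exact.
set x := \int[PL]_w h (Z' w); set y := \int[P N]_w h (@Z N w).
set x' := \int[PL]_w tau (Z' w) in lim_near tau_near.
set y' := \int[P N]_w tau (@Z N w) in N_near tau_near.
have -> : x - y = (x' - y') - (x' - x) + (y' - y) by ring.
apply: le_trans (ler_normD _ _) _.
apply: le_trans (lerD (ler_normB _ _) (lexx _)) _.
by rewrite -/x in lim_near; rewrite -/y in N_near; lra.
Unshelve. all: by end_near. Qed.

End cosine_transform_convergence.

Section gaussian_second_moment.
Context d (O : measurableType d) (R : realType) (P : probability O R).
Variables (Z : O -> R) (s2 : R).
Hypothesis mZ : measurable_fun setT Z.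
Hypothesis cosZ : forall t, \int[P]_w cos (t * Z w) = expR (- (s2 * t ^+ 2 / 2)).

Let t (n : nat) : R := n.+1%:R^-1.

Let t0 n : 0 < t n. Proof. by rewrite /t invr_gt0. Qed.

(* [2 (1 - cos (t z)) / t ^ 2 <= z ^ 2] tends to [z ^ 2] as [t] tends to 0. *)
Let g (n : nat) (w : O) : R := 2 / t n ^+ 2 * (1 - cos (t n * Z w)).

Let bc n : bounded_measurable (fun w => cos (t n * Z w)).
Proof. by apply: bm_cos; exact: measurable_funM. Qed.

Let bg n : bounded_measurable (g n).
Proof. by apply: bmZ; apply: bmB; [exact: bm_cst|exact: bc]. Qed.

Let g0 n w : 0 <= g n w.
Proof.
by apply: mulr_ge0; [rewrite divr_ge0// ltW// exprn_gt0|rewrite subr_ge0 cos_le1].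
Qed.

Let g_cvg w : (fun n => g n w) @ \oo --> Z w ^+ 2.
Proof.
apply: (@squeeze_cvgr _ _ _ _ (fun n => Z w ^+ 2 - t n * (2 * `|Z w| ^+ 3))
  (fun n => Z w ^+ 2 + t n * (2 * `|Z w| ^+ 3))).
- near=> n; have tn := t0 n.
  have := cos_expansion 0 (t n * Z w); rewrite add0r cos0 sin0 mulr0 subr0 mulr1.
  have gE : cos (t n * Z w) = 1 - g n w * t n ^+ 2 / 2.
    by rewrite /g; field; rewrite gt_eqF.
  rewrite gE normrM (gtr0_norm tn).
  have -> : 1 - g n w * t n ^+ 2 / 2 - (1 - (t n * Z w) ^+ 2 / 2) =
    (t n) ^+ 2 / 2 * (Z w ^+ 2 - g n w) by ring.
  have -> : (t n * `|Z w|) ^+ 3 = (t n) ^+ 2 / 2 * (t n * (2 * `|Z w| ^+ 3)) by field.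
  rewrite normrM gtr0_norm ?divr_gt0 ?exprn_gt0//.
  rewrite ler_pM2l ?divr_gt0 ?exprn_gt0// ler_norml => /andP[a b].
  by apply/andP; split; lra.
- rewrite -[X in _ --> X]subr0 -(mul0r (2 * `|Z w| ^+ 3)).
  by apply: cvgB; [exact: cvg_cst|apply: cvgMl; exact: cvg_harmonic].
- rewrite -[X in _ --> X]addr0 -(mul0r (2 * `|Z w| ^+ 3)).
  by apply: cvgD; [exact: cvg_cst|apply: cvgMl; exact: cvg_harmonic].
Unshelve. all: by end_near. Qed.

Let g_int n : \int[P]_w g n w <= s2.
Proof.
rewrite /g bm_RintegralZ; last by apply: bmB; [exact: bm_cst|exact: bc].
rewrite bm_RintegralB//; last exact: bm_cst.
rewrite Rintegral_prob_cst cosZ; have tn := t0 n.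
have := expR_ge1Dx (- (s2 * t n ^+ 2 / 2)) => h.
rewrite mulrAC ler_pdivrMr ?exprn_gt0//; lra.
Qed.

(** Fatou's lemma for the functions [g n], whose integrals follow from the cosine transform and are
    at most [s2] because [exp (- v) >= 1 - v]. *)
Lemma gaussian_sqr_integral : (\int[P]_w (Z w ^+ 2)%:E <= s2%:E)%E.
Proof.
have H := @fatou _ _ _ P setT measurableT (fun n w => (g n w)%:E)
  (fun n => (measurable_EFinP _ _).2 (bm_measurable (bg n))) (fun n w _ => g0 n w).
have -> : (\int[P]_w (Z w ^+ 2)%:E = \int[P]_w limn_einf (fun n => (g n w)%:E))%E.
  apply: eq_integral => w _; apply/esym; apply: (cvg_limn_einf_sup _).1.
  apply: cvg_EFin; first exact: nearW.
  exact: g_cvg.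
apply: le_trans H _; apply: le_trans (limn_einf_sup _) _.
rewrite limn_esup_lim; apply: lime_le; first exact: is_cvg_esups.
apply: nearW => n; apply: ge_ereal_sup => _ [k _ <-].
apply: le_trans (_ : (\int[P]_w g k w)%:E <= _)%E; last by rewrite lee_fin; exact: g_int.
rewrite /Rintegral fineK//.
exact: (integrable_fin_num measurableT (bm_integrable P (bg k))).
Qed.

Let mZ2 : measurable_fun setT (fun w => Z w ^+ 2).
Proof. exact: measurable_funX. Qed.

Let iZ2 : P.-integrable setT (EFin \o (fun w => Z w ^+ 2)).
Proof.
apply/integrableP; split; first exact/measurable_EFinP.
apply: le_lt_trans (ltry s2); apply: le_trans gaussian_sqr_integral.
rewrite le_eqVlt; apply/orP; left; apply/eqP/eq_integral => w _ /=.
by rewrite ger0_norm ?sqr_ge0.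
Qed.

Lemma gaussian_integrable : P.-integrable setT (EFin \o Z).
Proof.
have i1 : P.-integrable setT (EFin \o (fun w => 1 + Z w ^+ 2)).
  by apply: integrable_RD => //; apply: bm_integrable; exact: bm_cst.
apply: (le_integrable measurableT _ _ i1); first exact/measurable_EFinP.
move=> w _ /=; rewrite lee_fin [leRHS]ger0_norm ?addr_ge0 ?sqr_ge0//.
by rewrite -(real_normK (num_real (Z w))); have := sqr_ge0 (`|Z w| - 1); nra.
Qed.

Lemma gaussian_abs_le : \int[P]_w `|Z w| <= 1 + s2.
Proof.
apply: (@le_trans _ _ (\int[P]_w (1 + Z w ^+ 2))).
  apply: le_Rintegral => //.
  - exact: integrable_norm gaussian_integrable.
  - by apply: integrable_RD => //; apply: bm_integrable; exact: bm_cst.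
  move=> w _; rewrite -(real_normK (num_real (Z w))).
  by have := sqr_ge0 (`|Z w| - 1); nra.
rewrite RintegralD//; last by apply: bm_integrable; exact: bm_cst.
rewrite Rintegral_prob_cst lerD2l -lee_fin fineK//; first exact: gaussian_sqr_integral.
exact: (integrable_fin_num measurableT iZ2).
Qed.

Lemma gaussian_variance : ('V_P[Z] <= s2%:E)%E.
Proof.
have Z2 : Z \in Lfun P 2%:E.
  rewrite inE; apply/andP; split; rewrite inE//= /finite_norm unlock.
  apply: poweR_lty; apply: le_lt_trans (ltry s2); apply: le_trans gaussian_sqr_integral.
  rewrite le_eqVlt; apply/orP; left; apply/eqP/eq_integral => w _ /=.
  by rewrite powR_mulrn// real_normK// num_real.
rewrite varianceE//.
apply: (@le_trans _ _ ('E_P[Z ^+ 2])%E).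
  rewrite leeBlDr ?expe_ge0//; first by rewrite leeDl// sqre_ge0.
  by rewrite fin_numX// expectation_fin_num// Lfun_subset12// fin_num_measure.
by rewrite unlock; apply: le_trans gaussian_sqr_integral.
Qed.

End gaussian_second_moment.

Section laws_determined_by_cosines.
Context (R : realType).
Context d (O : measurableType d) (P : probability O R) (Z : O -> R).
Context d' (O' : measurableType d') (P' : probability O' R) (Z' : O' -> R).
Hypotheses (mZ : measurable_fun setT Z) (mZ' : measurable_fun setT Z').
Hypotheses (iZ : P.-integrable setT (EFin \o Z))
  (iZ' : P'.-integrable setT (EFin \o Z')).
Hypothesis cosZ : forall a t,
  \int[P]_w cos (a + t * Z w) = \int[P']_w cos (a + t * Z' w).

Let vec d0 (O0 : measurableType d0) (Y : O0 -> R) (w : O0) : 'rV[R]_1 := \row__ Y w.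

Let vecE d0 (O0 : measurableType d0) (Y : O0 -> R) (j : 'I_1) :
  (fun w => vec Y w 0 j) = Y.
Proof. by apply/funext => w; rewrite mxE. Qed.

(** Convergence in law of a constant sequence, in dimension 1. *)
Lemma continuous_expectation_eq (h : R -> R) (M : R) : continuous h ->
  (forall v, `|h v| <= M) -> \int[P]_w h (Z w) = \int[P']_w h (Z' w).
Proof.
move=> ch hM.
have ch' : continuous (fun v : 'rV[R]_1 => h (v 0 0)).
  by move=> v; apply: continuous_comp; [exact: coord_continuous|exact: ch].
have H : cvg_in_law (fun=> P) (fun=> vec Z) P' (vec Z').
  apply: (@cvg_in_law_of_cos R 1 (fun=> d) (fun=> O) (fun=> P) (fun=> vec Z) d' O' P' (vec Z')
    (Num.max (\int[P]_w `|Z w|) (\int[P']_w `|Z' w|))).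
  - by move=> _ j; rewrite vecE.
  - by move=> j; rewrite vecE.
  - by move=> _ j; rewrite vecE.
  - by move=> j; rewrite vecE.
  - by move=> _ j; under eq_Rintegral do rewrite mxE; rewrite le_max lexx.
  - by move=> j; under eq_Rintegral do rewrite mxE; rewrite le_max lexx orbT.
  move=> a b; have E d0 (O0 : measurableType d0) (P0 : probability O0 R) (Y : O0 -> R) :
      \int[P0]_w cos (\sum_j a 0 j * vec Y w 0 j + b) = \int[P0]_w cos (b + a 0 0 * Y w).
    by apply: eq_Rintegral => w _; rewrite big_ord1 mxE addrC.
  by rewrite E cosZ -E; exact: cvg_cst.
have := H _ ch' (ex_intro _ M (fun v => hM _)).
have E d0 (O0 : measurableType d0) (P0 : probability O0 R) (Y : O0 -> R) :
    \int[P0]_w h (vec Y w 0 0) = \int[P0]_w h (Y w).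
  by apply: eq_Rintegral => w _; rewrite mxE.
rewrite !E => /(cvg_lim (@Rhausdorff R)) <-; apply/esym.
by rewrite (_ : (fun _ : nat => _) = cst (\int[P]_w h (Z w))) ?lim_cst.
Qed.

(** Continuous approximations, from above, of the indicator of the closed half-line that starts at
    [x]. *)
Let ramp (x : R) (n : nat) (v : R) : R :=
  Num.min 1 (Num.max 0 (n%:R * (v - x) + 1)).

Let ramp_continuous x n : continuous (ramp x n).
Proof.
move=> v.
apply: (@continuous_min R R (fun=> 1) (fun v => Num.max 0 (n%:R * (v - x) + 1)) v).
  exact: cst_continuous.
apply: (@continuous_max R R (fun=> 0) (fun v => n%:R * (v - x) + 1) v).
  exact: cst_continuous.
apply: cvgD; last exact: cvg_cst.
by apply: cvgM; [exact: cvg_cst|apply: cvgB; [exact: cvg_id|exact: cvg_cst]].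
Qed.

Let ramp_bound x n v : `|ramp x n v| <= 1.
Proof.
rewrite ger0_norm; first by rewrite ge_min lexx.
by rewrite le_min ler01 le_max lexx.
Qed.

Let ray_expectation d0 (O0 : measurableType d0) (P0 : probability O0 R) (Y : O0 -> R) (x : R) :
  measurable_fun setT Y ->
  (fun n => (\int[P0]_w ramp x n (Y w))%:E) @ \oo --> P0 (Y @^-1` `[x, +oo[%classic).
Proof.
move=> mY.
have mB : measurable (Y @^-1` `[x, +oo[%classic).
  by rewrite -[X in measurable X]setTI; exact: mY.
have br n : bounded_measurable (fun w => ramp x n (Y w)).
  split; last by exists 1 => w; exact: ramp_bound.
  apply: measurableT_comp mY; apply: continuous_measurable_fun; exact: ramp_continuous.
rewrite (_ : (fun n => _) = (fun n => \int[P0]_w (ramp x n (Y w))%:E)%E); last first.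
  apply/funext => n; rewrite /Rintegral fineK//.
  exact: (integrable_fin_num measurableT (bm_integrable P0 (br n))).
rewrite (_ : P0 _ = \int[P0]_w (\1_(Y @^-1` `[x, +oo[%classic) w)%:E)%E; last first.
  by rewrite integral_indic// setIT.
have := @dominated_convergence _ _ _ P0 setT measurableT
  (fun n w => (ramp x n (Y w))%:E)
  (fun w => (\1_(Y @^-1` `[x, +oo[%classic) w)%:E) (fun=> 1%E).
case => //.
- by move=> n; apply/measurable_EFinP; exact: bm_measurable.
- by apply/measurable_EFinP; exact: measurable_indic.
- apply/aeW => w _; apply: cvg_EFin; first exact: nearW.
  rewrite indicE; have [xY|Yx] := leP x (Y w).
    rewrite mem_set /=; last by rewrite in_itv/= xY.
    rewrite (_ : _ \o _ = fun=> 1); first exact: cvg_cst.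
    apply/funext => n /=; apply/min_idPl; rewrite le_max; apply/orP; right.
    by rewrite lerDr mulr_ge0// subr_ge0.
  rewrite memNset /=; last by rewrite in_itv/= andbT => /(lt_le_trans Yx); rewrite ltxx.
  apply: (@cvg_trans _ ((fun=> 0 : R) @ \oo)); last exact: cvg_cst.
  apply: near_eq_cvg; near=> n => /=; apply/esym.
  rewrite /ramp (_ : Num.max _ _ = 0) ?min_r//; apply/max_idPl.
  have d0' : 0 < x - Y w by rewrite subr_gt0.
  have : (x - Y w)^-1 <= n%:R.
    apply: le_trans (ltW (archi_boundP _)) _; first by rewrite invr_ge0 ltW.
    by rewrite ler_nat; near: n; exact: nbhs_infty_ge.
  by rewrite -[leLHS]mul1r ler_pdivrMr//; lra.
- exact: (bm_integrable P0 (@bm_cst _ O0 R 1) : P0.-integrable setT (EFin \o (fun=> 1))).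
- by apply/aeW => w n _; rewrite lee_fin.
Unshelve. all: by end_near. Qed.

(** The closed half-lines form a pi-system that generates the Borel sets, and their probabilities
    are limits of expectations of ramps. *)
Lemma law_eq_of_cos (B : set R) : measurable B -> P (Z @^-1` B) = P' (Z' @^-1` B).
Proof.
move=> mB.
pose Zm : {mfun O >-> R} := HB.pack Z (isMeasurableFun.Build _ _ _ _ Z mZ).
pose Zm' : {mfun O' >-> R} := HB.pack Z' (isMeasurableFun.Build _ _ _ _ Z' mZ').
apply: (@measure_unique _ R R (@RGenCInfty.G R) (fun n => `[- n%:R, +oo[%classic)
  _ _ _ _ (distribution P Zm) (distribution P' Zm')) => //.
- exact: RGenCInfty.measurableE.
- move=> _ _ [x ->] [x' ->]; exists (Num.max x x'); apply/seteqP; split => u /=.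
    by rewrite !in_itv/= !andbT ge_max => -[-> ->].
  by rewrite !in_itv/= !andbT ge_max => /andP[-> ->].
- by move=> i; exists (- i%:R).
- apply/seteqP; split => // u _; exists (Num.bound `|u|) => //=.
  rewrite in_itv/= andbT; have := archi_boundP (normr_ge0 u); have := ler_norm (- u).
  by rewrite normrN; lra.
- move=> _ [x ->]; have H := @ray_expectation _ _ P Z x mZ.
  have H' := @ray_expectation _ _ P' Z' x mZ'.
  apply: (cvg_unique _ H); first exact: ereal_hausdorff.
  rewrite (_ : (fun n => _) = (fun n => (\int[P']_w ramp x n (Z' w))%:E))//.
  by apply/funext => n; congr EFin; apply: (@continuous_expectation_eq (ramp x n) 1).
- by move=> k; apply: le_lt_trans (probability_le1 _ _) (ltry _).
Qed.

End laws_determined_by_cosines.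

(** Comparison with the identity under the Dirac or the normal law; integrability on both sides also
    comes from the cosine transforms. *)
Lemma centered_gaussian_of_cos (R : realType) d (O : measurableType d)
    (P : probability O R) (Z : O -> R) (s2 : R) :
  measurable_fun setT Z -> 0 <= s2 ->
  (forall a t, \int[P]_w cos (a + t * Z w) = expR (- (s2 * t ^+ 2 / 2)) * cos a) ->
  centered_gaussian P Z s2.
Proof.
move=> mZ s20 cosZ; split => // B mB.
have cos0Z d0 (O0 : measurableType d0) (P0 : probability O0 R) (Y : O0 -> R) :
    (forall a t, \int[P0]_w cos (a + t * Y w) = expR (- (s2 * t ^+ 2 / 2)) * cos a) ->
    forall t, \int[P0]_w cos (t * Y w) = expR (- (s2 * t ^+ 2 / 2)).
  move=> H t; have := H 0 t; rewrite cos0 mulr1 => <-.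
  by apply: eq_Rintegral => w _; rewrite add0r.
have iZ := gaussian_integrable mZ (cos0Z _ _ _ _ cosZ).
have reference (Q : probability (measurableTypeR R) R) :
    (forall A, measurable A -> Q A = centered_normal s2 A) ->
    P (Z @^-1` B) = centered_normal s2 B.
  move=> QE; rewrite -QE//.
  have mid : measurable_fun setT (fun x : measurableTypeR R => x : R) by exact: measurable_id.
  have gQ : centered_gaussian Q (fun x : measurableTypeR R => x : R) s2 by split.
  have cosQ a t := centered_gaussian_cos a t s20 gQ.
  have iQ := gaussian_integrable mid (cos0Z _ _ _ _ cosQ).
  by apply: (law_eq_of_cos mZ mid iZ iQ) => // a t; rewrite cosZ cosQ.
have [s2E|s2N] := eqVneq s2 0.
  apply: (reference (dirac (0 : measurableTypeR R))) => A mA.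
  by rewrite /centered_normal s2E eqxx.
by apply: (reference (normal_prob 0 (Num.sqrt s2))) => A mA; rewrite /centered_normal (negbTE s2N).
Qed.

(** * Averaging functionals and Feynman-Kac flows *)

Section averaging_functionals.
Context dX (X : measurableType dX) (R : realType).
Variable mu : {finite_measure set X -> \bar R}.
Implicit Types (e : (X -> R) -> R) (phi psi : X -> R).

(** What the empirical measures, the exact flow and the predictions have in common as functionals.
    [averaging_fubini] is the exchange with [mu] on which the conservation of the flow rests. *)
Record averaging e : Prop := Averaging {
  averaging_lin : forall a phi psi, bounded_measurable phi ->
    bounded_measurable psi -> e (fun x => a * phi x + psi x) = a * e phi + e psi ;
  averaging_le : forall phi psi, bounded_measurable phi ->
    bounded_measurable psi -> (forall x, phi x <= psi x) -> e phi <= e psi ;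
  averaging_cst : forall c, e (fun=> c) = c ;
  averaging_bm : forall F : X * X -> R, bounded_measurable F ->
    bounded_measurable (fun z => e (fun x => F (x, z))) ;
  averaging_fubini : forall F : X * X -> R, bounded_measurable F ->
    \int[mu]_z e (fun x => F (x, z)) = e (fun x => \int[mu]_z F (x, z)) }.

Section theory.
Variable e : (X -> R) -> R.
Hypothesis avg_e : averaging e.

Lemma averagingD phi psi : bounded_measurable phi -> bounded_measurable psi ->
  e (fun x => phi x + psi x) = e phi + e psi.
Proof.
move=> bp bq; rewrite -[e phi]mul1r -(averaging_lin avg_e)//.
by congr e; apply/funext => x; rewrite mul1r.
Qed.

Lemma averagingZ a phi : bounded_measurable phi ->
  e (fun x => a * phi x) = a * e phi.
Proof.
move=> bp; rewrite -[RHS]addr0 -[X in _ = _ + X](averaging_cst avg_e) -(averaging_lin avg_e)//.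
  by congr e; apply/funext => x; rewrite addr0.
exact: bm_cst.
Qed.

Lemma averagingB phi psi : bounded_measurable phi -> bounded_measurable psi ->
  e (fun x => phi x - psi x) = e phi - e psi.
Proof.
move=> bp bq; rewrite averagingD//; last exact: bmN.
congr (_ + _); rewrite -mulN1r -averagingZ//.
by congr e; apply/funext => x; rewrite mulN1r.
Qed.

Lemma averaging_sum (I : Type) (r : seq I) (F : I -> X -> R) :
  (forall i, bounded_measurable (F i)) ->
  e (fun x => \sum_(i <- r) F i x) = \sum_(i <- r) e (F i).
Proof.
move=> bF; elim: r => [|i r IH].
  by rewrite big_nil -[RHS](averaging_cst avg_e); congr e; apply/funext => x; rewrite big_nil.
rewrite big_cons -IH -averagingD//; last exact: bm_sum.
by congr e; apply/funext => x; rewrite big_cons.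
Qed.

Lemma averaging_bounds phi a b : bounded_measurable phi ->
  (forall x, a <= phi x <= b) -> a <= e phi <= b.
Proof.
move=> bp ab; rewrite -(averaging_cst avg_e a) -[X in _ && (_ <= X)](averaging_cst avg_e b).
by apply/andP; split; apply: averaging_le => //; try exact: bm_cst;
  move=> x; have /andP[] := ab x.
Qed.

Lemma averaging_norm_le phi M : bounded_measurable phi ->
  (forall x, `|phi x| <= M) -> `|e phi| <= M.
Proof.
by move=> bp pM; rewrite ler_norml; apply: averaging_bounds => // x; rewrite -ler_norml.
Qed.

End theory.

Lemma averaging_empirical (N : nat) (s : 'I_N -> X) : (0 < N)%N ->
  averaging (empirical s : (X -> R) -> R).
Proof.
move=> N0; have NR : (N%:R : R) != 0 by rewrite pnatr_eq0 -lt0n.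
split; rewrite /empirical.
- move=> a phi psi _ _; rewrite big_split/= -mulr_sumr; ring.
- move=> phi psi _ _ h; apply: ler_wpM2l; first by rewrite invr_ge0.
  by apply: ler_sum => i _.
- by move=> c; rewrite sumr_const card_ord -(mulr_natl c) mulKf.
- move=> F bF; apply: bmZ; apply: bm_sum => i; apply: bm_comp bF _.
  exact: pair1_measurable.
- move=> F bF; have bi i : bounded_measurable (fun z => F (s i, z)).
    by apply: bm_comp bF _; exact: pair1_measurable.
  rewrite bm_RintegralZ; last exact: bm_sum.
  by rewrite bm_Rintegral_sum.
Qed.

Lemma averaging_density (w : X -> R) : measurable_fun setT w ->
  (forall x, 0 <= w x) -> (\int[mu]_x (w x)%:E = 1)%E ->
  averaging (fun phi => \int[mu]_x (w x * phi x)).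
Proof.
move=> mw w0 w1.
have iw : mu.-integrable setT (EFin \o w).
  apply/integrableP; split; first exact/measurable_EFinP.
  rewrite (_ : (\int[mu]_x _)%E = 1%E) ?ltry// -w1; apply: eq_integral => x _ /=.
  by rewrite ger0_norm.
have iwp phi := @integrable_weight _ _ _ mu w phi iw.
split.
- move=> a phi psi bp bq; rewrite -Rintegral_lin; [|exact: iwp..].
  by apply: eq_Rintegral => x _; ring.
- move=> phi psi bp bq h; apply: le_Rintegral => //; [exact: iwp..|].
  by move=> x _; exact: ler_wpM2l.
- move=> c; under eq_Rintegral do rewrite mulrC.
  by rewrite RintegralZl// /Rintegral w1 mulr1.
- move=> F bF.
  apply: (@bm_wkernel _ _ X X R mu (fun z => w z.2) 1 _ _ _ (fun z => F (z.2, z.1))) => //.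
  + by apply: measurableT_comp mw _; exact: measurable_snd.
  + by move=> s; rewrite w1.
  + by apply: bm_comp bF _; apply: measurable_fun_pair; [exact: measurable_snd|exact: measurable_fst].
- by move=> F bF; rewrite (weighted_fubini mu iw w0 bF).
Qed.

End averaging_functionals.

(** The model and condition (A) at a fixed [theta] and [y]. The constants stay explicit because the
    variance bound may depend on nothing else but the bound of the score. *)
Record regular_model (R : realType) (d : nat) (dX dY : measure_display)
    (X : measurableType dX) (Y : measurableType dY)
    (mu : {measure set X -> \bar R}) (m : densities R d X Y)
    (theta : 'rV[R]_d) (y : nat -> Y) (rho delta : R) : Prop := RegularModel {
  init_measurable : measurable_fun setT (init m theta) ;
  init_ge0 : forall x, 0 <= init m theta x ;
  init_integral : (\int[mu]_x (init m theta x)%:E = 1)%E ;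
  trans_measurable : measurable_fun setT (fun z : X * X => trans m theta z.1 z.2) ;
  trans_bounds : forall x x', rho^-1 <= trans m theta x x' <= rho ;
  trans_integral : forall x, (\int[mu]_x' (trans m theta x x')%:E = 1)%E ;
  obs_measurable : forall k, measurable_fun setT (fun x => obs m theta x (y k)) ;
  obs_bounds : forall k x, delta^-1 <= obs m theta x (y k) <= delta ;
  rho_gt0 : 0 < rho ;
  delta_gt0 : 0 < delta }.

Record regular_score (R : realType) (dX : measure_display) (X : measurableType dX)
    (t : nat -> X -> X -> R) (tau : R) : Prop := RegularScore {
  score_measurable : forall k, measurable_fun setT (fun z : X * X => t k z.1 z.2) ;
  score_bound : forall k x z, `|t k x z| <= tau }.

Section feynman_kac_flows.
Context (R : realType) (d : nat) (dX dY : measure_display)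
  (X : measurableType dX) (Y : measurableType dY).
Variables (mu : {finite_measure set X -> \bar R}) (m : densities R d X Y).
Variables (theta : 'rV[R]_d) (y : nat -> Y) (rho delta : R).
Hypothesis reg : regular_model mu m theta y rho delta.
Variables (t : nat -> X -> X -> R) (tau : R).
Hypothesis regt : regular_score t tau.
Implicit Types (u h phi : X -> R) (e : nat -> (X -> R) -> R).
Notation q := (qdens m theta y).
Notation g k := (fun x : X => obs m theta x (y k)).
Notation U := (Qsg mu m theta y).

Lemma tau_ge0 : 0 <= tau.
Proof. exact: le_trans (normr_ge0 _) (score_bound regt 0 point point). Qed.

Lemma qdens_bounds k x z : (delta * rho)^-1 <= q k x z <= delta * rho.
Proof.
have r0 := rho_gt0 reg; have d0 := delta_gt0 reg.
have /andP[t1 t2] := trans_bounds reg x z.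
have /andP[ob1 ob2] := obs_bounds reg k x.
rewrite invfM; apply/andP; split; apply: ler_pM => //.
- by rewrite invr_ge0 ltW.
- by rewrite invr_ge0 ltW.
- by apply: le_trans ob1; rewrite invr_ge0 ltW.
- by apply: le_trans t1; rewrite invr_ge0 ltW.
Qed.

Lemma qmax_gt0 : 0 < delta * rho.
Proof. by rewrite mulr_gt0 ?(rho_gt0 reg) ?(delta_gt0 reg). Qed.

Lemma qdens_gt0 k x z : 0 < q k x z.
Proof.
by have /andP[+ _] := qdens_bounds k x z; apply: lt_le_trans; rewrite invr_gt0 qmax_gt0.
Qed.

Lemma obs_gt0 k x : 0 < g k x.
Proof.
by have /andP[+ _] := obs_bounds reg k x; apply: lt_le_trans; rewrite invr_gt0 (delta_gt0 reg).
Qed.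

Lemma bm_obs k : bounded_measurable (g k).
Proof.
split; first exact: (obs_measurable reg); exists delta => x.
by have /andP[] := obs_bounds reg k x; rewrite gtr0_norm// obs_gt0.
Qed.

Lemma bm_trans : bounded_measurable (fun z : X * X => trans m theta z.1 z.2).
Proof.
split; first exact: (trans_measurable reg); exists rho => z.
have /andP[t1 t2] := trans_bounds reg z.1 z.2; rewrite ger0_norm//.
by apply: le_trans t1; rewrite invr_ge0 ltW// (rho_gt0 reg).
Qed.

Lemma bm_qdens k : bounded_measurable (fun z : X * X => q k z.1 z.2).
Proof.
by apply: bmM; [exact: bm_comp (bm_obs k) measurable_fst|exact: bm_trans].
Qed.

Lemma bm_score k : bounded_measurable (fun z : X * X => t k z.1 z.2).
Proof.
by split; [exact: (score_measurable regt)|exists tau => z; exact: (score_bound regt)].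
Qed.

Lemma bm_score_diag : bounded_measurable (fun z => t 0 z z).
Proof.
have mD : measurable_fun setT (fun z : X => (z, z)) by exact: measurable_fun_pair.
exact: bm_comp (bm_score 0) mD.
Qed.

Let bm_fst_section (F : X * X -> R) z : bounded_measurable F ->
  bounded_measurable (fun x => F (x, z)).
Proof. by move=> bF; apply: bm_comp bF _; exact: pair2_measurable. Qed.

Let bm_snd_section (F : X * X -> R) x : bounded_measurable F ->
  bounded_measurable (fun z => F (x, z)).
Proof. by move=> bF; apply: bm_comp bF _; exact: pair1_measurable. Qed.

Lemma bm_qdens_to k z : bounded_measurable (fun x => q k x z).
Proof. exact: (bm_fst_section z (bm_qdens k)). Qed.

Lemma bm_qdens_from k x : bounded_measurable (q k x).
Proof. exact: (bm_snd_section x (bm_qdens k)). Qed.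

Lemma bm_score_to k z : bounded_measurable (fun x => t k x z).
Proof. exact: (bm_fst_section z (bm_score k)). Qed.

Lemma bm_score_from k x : bounded_measurable (t k x).
Proof. exact: (bm_snd_section x (bm_score k)). Qed.

Lemma qdens_integral k x : \int[mu]_z q k x z = g k x.
Proof.
rewrite bm_RintegralZ; last exact: (bm_snd_section x bm_trans).
by rewrite /Rintegral (trans_integral reg) mulr1.
Qed.

Lemma qdens_integral_norm_le k x phi M : bounded_measurable phi ->
  (forall z, `|phi z| <= M) -> `|\int[mu]_z (q k x z * phi z)| <= delta * M.
Proof.
move=> bp pM; have M0 : 0 <= M := le_trans (normr_ge0 _) (pM point).
have bq := bm_qdens_from k x.
apply: le_trans (bm_norm_Rintegral _ (bmM bq bp)) _.
apply: (@le_trans _ _ (\int[mu]_z (M * q k x z))).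
  apply: bm_le_Rintegral; [by apply: bm_norm; exact: bmM|exact: bmZ|].
  move=> z; rewrite normrM (gtr0_norm (qdens_gt0 _ _ _)) mulrC.
  by apply: ler_wpM2r => //; rewrite ltW// qdens_gt0.
rewrite bm_RintegralZ// qdens_integral mulrC; apply: ler_wpM2r => //.
by have /andP[] := obs_bounds reg k x.
Qed.

Lemma bm_qdens_integral k (F : X * X -> R) : bounded_measurable F ->
  bounded_measurable (fun x => \int[mu]_z (q k x z * F (x, z))).
Proof. by move=> bF; exact: (bm_Rintegral_snd mu (bmM (bm_qdens k) bF)). Qed.

(* [fwd] maps [x |-> S_n(x) u(x_n) + h(x_n)], with [S] the additive functional
   of increments [t], to [S_k(x) U_(k,l)(u)(x_k) + Hsg_(k,l)(u,h)(x_k)]. *)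
Fixpoint Hsg (k l : nat) u h : X -> R :=
  if l is l'.+1 then fun x =>
    \int[mu]_z (q k x z * (Hsg k.+1 l' u h z + t k.+1 x z * U k.+1 l' u z))
  else h.

Lemma bm_Qsg k l u : bounded_measurable u -> bounded_measurable (U k l u).
Proof.
move=> bu; elim: l k => [//|l IH] k /=.
exact: (bm_qdens_integral k (bm_comp (IH _) measurable_snd)).
Qed.

Let bm_Hsg_step k l u h : bounded_measurable u -> bounded_measurable (Hsg k.+1 l u h) ->
  bounded_measurable (fun z : X * X =>
    Hsg k.+1 l u h z.2 + t k.+1 z.1 z.2 * U k.+1 l u z.2).
Proof.
move=> bu bH; apply: bmD; first exact: bm_comp bH measurable_snd.
by apply: bmM; [exact: bm_score|exact: bm_comp (bm_Qsg _ _ bu) measurable_snd].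
Qed.

Lemma bm_Hsg k l u h : bounded_measurable u -> bounded_measurable h ->
  bounded_measurable (Hsg k l u h).
Proof.
move=> bu bh; elim: l k => [//|l IH] k /=.
exact: (bm_qdens_integral k (bm_Hsg_step bu (IH k.+1))).
Qed.

Lemma Qsg_norm_le k l u M : bounded_measurable u -> (forall x, `|u x| <= M) ->
  forall x, `|U k l u x| <= delta ^+ l * M.
Proof.
move=> bu uM; elim: l k => [|l IH] k x /=; first by rewrite expr0 mul1r.
rewrite exprS -mulrA; apply: qdens_integral_norm_le; first exact: bm_Qsg.
exact: IH.
Qed.

Lemma Hsg_norm_le k l u h M : bounded_measurable u -> bounded_measurable h ->
  (forall x, `|u x| <= M) -> (forall x, `|h x| <= M) ->
  forall x, `|Hsg k l u h x| <= delta ^+ l * (M + l%:R * tau * M).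
Proof.
move=> bu bh uM hM; elim: l k => [|l IH] k x /=.
  by rewrite expr0 mul1r !mul0r addr0.
rewrite exprS -mulrA; apply: qdens_integral_norm_le.
  exact: (bm_snd_section x (bm_Hsg_step bu (bm_Hsg _ _ bu bh))).
move=> z; apply: le_trans (ler_normD _ _) _.
have -> : delta ^+ l * (M + l.+1%:R * tau * M) =
   delta ^+ l * (M + l%:R * tau * M) + tau * (delta ^+ l * M).
  by rewrite -natr1; ring.
apply: lerD; first exact: IH.
rewrite normrM; apply: ler_pM => //; first exact: (score_bound regt).
exact: Qsg_norm_le.
Qed.

(** Mean of the additive functional of the scores given the last state, under the backward kernels
    of the flow [e]. *)
Fixpoint Tback e (k : nat) : X -> R :=
  if k is k'.+1 then fun z =>
    backward_kernel m theta y e k' z (fun x => Tback e k' x + t k x z)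
  else fun z => t 0 z z.

(** The prediction from the measure at time [p - 1]. For the empirical measures it is the
    conditional law of one particle of generation [p]. *)
Definition predictive e (p : nat) phi : R :=
  if p is p'.+1 then
    \int[mu]_z (e p' (fun x => q p' x z) / e p' (g p') * phi z)
  else \int[mu]_z (init m theta z * phi z).

(** The likelihood of the first [p] observations according to the flow [e]; multiplying by it clears
    the denominators of the prediction steps. *)
Definition normalizer e (p : nat) : R := \prod_(k < p) e k (g k).

(* The flow [e_p(T_p U_(p,n)(u) + Hsg_(p,n)(u,h))], times its normalizer, is
   conserved by the prediction step (flow_step below): its increments are the
   sampling errors [e_p - predictive e p]. *)
Definition potential e (n : nat) u h (p : nat) (x : X) : R :=
  Tback e p x * U p (n - p) u x + Hsg p (n - p) u h x.

Section one_step.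
Variables (e : nat -> (X -> R) -> R) (p : nat).
Hypothesis avg_e : averaging mu (e p).

Lemma averaging_obs_bounds : delta^-1 <= e p (g p) <= delta.
Proof. by apply: (averaging_bounds avg_e (bm_obs p)); exact: obs_bounds reg p. Qed.

Lemma averaging_obs_gt0 : 0 < e p (g p).
Proof.
by have /andP[+ _] := averaging_obs_bounds; apply: lt_le_trans; rewrite invr_gt0 (delta_gt0 reg).
Qed.

Lemma averaging_qdens_bounds z :
  (delta * rho)^-1 <= e p (fun x => q p x z) <= delta * rho.
Proof.
by apply: (averaging_bounds avg_e (bm_qdens_to p z)) => x; exact: qdens_bounds.
Qed.

Lemma averaging_qdens_gt0 z : 0 < e p (fun x => q p x z).
Proof.
by have /andP[+ _] := averaging_qdens_bounds z; apply: lt_le_trans; rewrite invr_gt0 qmax_gt0.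
Qed.

Lemma bm_averaging_qdens : bounded_measurable (fun z => e p (fun x => q p x z)).
Proof. exact: (averaging_bm avg_e (bm_qdens p)). Qed.

Lemma backward_kernel_norm_le z phi M : bounded_measurable phi ->
  (forall x, `|phi x| <= M) -> `|backward_kernel m theta y e p z phi| <= M.
Proof.
move=> bp pM; rewrite /backward_kernel normrM normfV (gtr0_norm (averaging_qdens_gt0 z)).
rewrite ler_pdivrMr ?averaging_qdens_gt0//.
have bq := bm_qdens_to p z.
have H x : `|q p x z * phi x| <= M * q p x z.
  rewrite normrM (gtr0_norm (qdens_gt0 _ _ _)) mulrC.
  by apply: ler_wpM2r => //; rewrite ltW// qdens_gt0.
rewrite ler_norml -mulNr -!(averagingZ avg_e _ bq); apply/andP; split.
  apply: (averaging_le avg_e); [exact: bmZ|exact: bmM|move=> x].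
  by have := H x; rewrite ler_norml mulNr => /andP[].
apply: (averaging_le avg_e); [exact: bmM|exact: bmZ|move=> x].
by have := H x; rewrite ler_norml => /andP[].
Qed.

Lemma bm_backward_kernel (F : X * X -> R) : bounded_measurable F ->
  bounded_measurable (fun z => backward_kernel m theta y e p z (fun x => F (x, z))).
Proof.
move=> bF; apply: (@bm_div _ _ _ _ _ (delta * rho)^-1).
- exact: (averaging_bm avg_e (bmM (bm_qdens p) bF)).
- exact: bm_measurable bm_averaging_qdens.
- by rewrite invr_gt0 qmax_gt0.
- by move=> z; have /andP[] := averaging_qdens_bounds z.
Qed.

(** The factor [e p (fun x => q p x z)] cancels the denominator of the backward kernel, and then
    Fubini's theorem exchanges [e p] with the integral over [z]. *)
Lemma flow_step (T : X -> R) l u h : bounded_measurable T ->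
  bounded_measurable u -> bounded_measurable h ->
  \int[mu]_z (e p (fun x => q p x z) *
     (backward_kernel m theta y e p z (fun x => T x + t p.+1 x z) * U p.+1 l u z +
      Hsg p.+1 l u h z)) =
  e p (fun x => T x * U p l.+1 u x + Hsg p l.+1 u h x).
Proof.
move=> bT bu bh; have bU := bm_Qsg p.+1 l bu; have bH := bm_Hsg p.+1 l bu bh.
pose F (z : X * X) := q p z.1 z.2 * (T z.1 * U p.+1 l u z.2 +
  (Hsg p.+1 l u h z.2 + t p.+1 z.1 z.2 * U p.+1 l u z.2)).
have bF : bounded_measurable F.
  apply: bmM; first exact: bm_qdens; apply: bmD; last exact: bm_Hsg_step.
  by apply: bmM; [exact: bm_comp bT measurable_fst|exact: bm_comp bU measurable_snd].
transitivity (\int[mu]_z e p (fun x => F (x, z))).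
  apply: eq_Rintegral => z _; rewrite /backward_kernel mulrDr mulrA.
  rewrite [X in X * _ + _]mulrCA mulfV ?gt_eqF ?averaging_qdens_gt0// mulr1.
  have bq := bm_qdens_to p z.
  have bqT : bounded_measurable (fun x => q p x z * (T x + t p.+1 x z)).
    by apply: bmM => //; apply: bmD => //; exact: bm_score_to.
  rewrite mulrC [X in _ + X]mulrC -(averagingZ avg_e _ bq) -(averaging_lin avg_e) //; last exact: bmZ.
  by congr (e p); apply/funext => x; rewrite /F /=; ring.
rewrite (averaging_fubini avg_e bF); congr (e p); apply/funext => x.
rewrite /= -Rintegral_lin.
- by apply: eq_Rintegral => z _; rewrite /F /=; ring.
- by apply: bm_integrable; apply: bmM => //; exact: bm_qdens_from.
apply: bm_integrable; apply: bmM; first exact: bm_qdens_from.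
exact: (bm_snd_section x (bm_Hsg_step bu bH)).
Qed.

End one_step.

Section flow.
Variable e : nat -> (X -> R) -> R.
Hypothesis avg_e : forall p, averaging mu (e p).

Lemma normalizer_gt0 p : 0 < normalizer e p.
Proof. by apply: prodr_gt0 => k _; exact: averaging_obs_gt0. Qed.

Lemma normalizer_bounds p : (delta ^+ p)^-1 <= normalizer e p <= delta ^+ p.
Proof.
rewrite /normalizer; elim: p => [|p /andP[IH1 IH2]].
  by rewrite big_ord0 expr0 invr1 lexx.
have d0 := delta_gt0 reg; have /andP[a b] := averaging_obs_bounds (avg_e p).
rewrite big_ord_recr exprSr invfM /=.
apply/andP; split; apply: ler_pM => //.
- by rewrite invr_ge0 exprn_ge0// ltW.
- by rewrite invr_ge0 ltW.
- by apply: le_trans IH1; rewrite invr_ge0 exprn_ge0// ltW.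
- by apply: le_trans a; rewrite invr_ge0 ltW.
Qed.

Lemma bm_Tback p : bounded_measurable (Tback e p).
Proof.
elim: p => [|p IH] /=; first exact: bm_score_diag.
apply: (bm_backward_kernel (avg_e p) (F := fun z => Tback e p z.1 + t p.+1 z.1 z.2)).
by apply: bmD; [exact: bm_comp IH measurable_fst|exact: bm_score].
Qed.

Lemma Tback_norm_le p x : `|Tback e p x| <= p.+1%:R * tau.
Proof.
elim: p x => [|p IH] x /=; first by rewrite mul1r; exact: (score_bound regt).
apply: backward_kernel_norm_le => // [|z].
  by apply: bmD; [exact: bm_Tback|exact: bm_score_to].
rewrite -natr1 mulrDl mul1r; apply: le_trans (ler_normD _ _) _.
by apply: lerD => //; exact: (score_bound regt).
Qed.

Lemma bm_potential n u h p : bounded_measurable u -> bounded_measurable h ->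
  bounded_measurable (potential e n u h p).
Proof.
move=> bu bh; apply: bmD; last exact: bm_Hsg.
by apply: bmM; [exact: bm_Tback|exact: bm_Qsg].
Qed.

Lemma predictive_potential n u h p : (p < n)%N ->
  bounded_measurable u -> bounded_measurable h ->
  normalizer e p.+1 * predictive e p.+1 (potential e n u h p.+1) =
  normalizer e p * e p (potential e n u h p).
Proof.
move=> pn bu bh; rewrite /normalizer big_ord_recr -mulrA /=; congr (_ * _).
rewrite -bm_RintegralZ; last first.
  apply: bmM; last exact: bm_potential.
  by apply: bmM; [exact: bm_averaging_qdens|exact: bm_cst].
rewrite /potential (_ : (n - p)%N = (n - p.+1).+1); last by rewrite -subSn// subSS.
rewrite -(flow_step (avg_e p) _ (bm_Tback p) bu bh).
apply: eq_Rintegral => z _; rewrite [_ / _]mulrC -mulrA mulrA mulfV ?mul1r//.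
by rewrite gt_eqF// averaging_obs_gt0.
Qed.

(** Telescoping by [predictive_potential]; at [p = n] the potential is [T_n u + h]. *)
Lemma potential_martingale n u h : bounded_measurable u -> bounded_measurable h ->
  normalizer e n * e n (fun x => Tback e n x * u x + h x) -
    predictive e 0 (potential e n u h 0) =
  \sum_(p < n.+1) normalizer e p *
    (e p (potential e n u h p) - predictive e p (potential e n u h p)).
Proof.
move=> bu bh.
pose F p := normalizer e p *
  (e p (potential e n u h p) - predictive e p (potential e n u h p)).
have H k : (k <= n)%N -> \sum_(p < k.+1) F p =
    normalizer e k * e k (potential e n u h k) - predictive e 0 (potential e n u h 0).
  elim: k => [_|k IH kn]; first by rewrite big_ord1 /F [normalizer e 0]big_ord0 !mul1r.
  have -> : \sum_(p < k.+2) F p = \sum_(p < k.+1) F p + F k.+1 by exact: big_ord_recr.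
  rewrite (IH (ltnW kn)) /F -(predictive_potential kn bu bh).
  by rewrite mulrBr addrC addrA subrK.
have := H n (leqnn n); rewrite /F => ->.
by rewrite /potential subnn.
Qed.

End flow.

End feynman_kac_flows.

(** * Particle approximation *)

Lemma bm_from_g_sigma d (O : measurableType d) (R : realType) (G : set (set O))
    (f : g_sigma_algebraType G -> R) : (forall A, G A -> measurable A) ->
  bounded_measurable f -> bounded_measurable (f : O -> R).
Proof. by move=> mG bf; apply: bm_comp bf _; exact: measurable_id_g_sigma. Qed.

(** The crude constant comes from [(a + b) ^ 2 <= 2 a ^ 2 + 2 b ^ 2] at each step; the number of
    terms is fixed while [N] grows. *)
Lemma sqr_sum_le (R : realDomainType) (n : nat) (a : nat -> R) :
  (\sum_(i < n) a i) ^+ 2 <= 2 ^+ n * \sum_(i < n) a i ^+ 2.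
Proof.
elim: n => [|n IH]; first by rewrite !big_ord0 expr0n mulr0.
rewrite !big_ord_recr /= (exprS _ n); have S0 : 0 <= \sum_(i < n) a i ^+ 2.
  by apply: sumr_ge0 => i _; exact: sqr_ge0.
move: S0 IH; move: (\sum_(i < n) a i) (\sum_(i < n) a i ^+ 2) => s S S0.
have : a n ^+ 2 <= 2 ^+ n * a n ^+ 2 by rewrite ler_peMl ?sqr_ge0// exprn_ege1// ler1n.
have := sqr_ge0 (s - a n); move: (2 ^+ n) (a n) => c b.
nra.
Qed.

Section particle_approximation.
Context (R : realType) (d : nat) (dX dY : measure_display)
  (X : measurableType dX) (Y : measurableType dY).
Variables (mu : {finite_measure set X -> \bar R}) (m : densities R d X Y).
Variables (theta : 'rV[R]_d) (y : nat -> Y) (rho delta : R).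
Hypothesis reg : regular_model mu m theta y rho delta.
Variables (t : nat -> X -> X -> R) (tau : R).
Hypothesis regt : regular_score t tau.
Context (dO : measure_display) (O : measurableType dO) (P : probability O R).
Variables (N : nat) (xi : nat -> 'I_N -> {RV P >-> X}).
Hypotheses (N_gt0 : (0 < N)%N) (ps : particle_system mu m theta y xi).
Implicit Types (u h phi psi : X -> R).
Notation q := (qdens m theta y).
Notation g k := (fun x : X => obs m theta x (y k)).
Notation U := (Qsg mu m theta y).
Notation e := (etaN xi).

Lemma averaging_particles w p : averaging mu (e w p).
Proof. exact: averaging_empirical. Qed.

(** The index is shifted with respect to [past], so that the first generation, sampled from the
    initial law, is treated like the others, over a trivial past. *)
Definition past_generators (p : nat) : set (set O) :=
  if p is p'.+1 then
    [set A | exists (k : nat) (i : 'I_N) (B : set X),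
         [/\ (k <= p')%N, measurable B & A = xi k i @^-1` B]]
  else set0.

Notation S p := (g_sigma_algebraType (past_generators p)).

Lemma past_generators_measurable p A : past_generators p A -> measurable A.
Proof.
case: p => [//|p] [k [i [B [_ mB ->]]]].
by rewrite -[X in measurable X]setTI; exact: measurable_funP.
Qed.

Lemma measurable_id_past p : measurable_fun setT (fun w : S p.+1 => w : S p).
Proof.
apply: measurable_id_sub_g_sigma => A; case: p => [//|p] [k [i [B [kp mB ->]]]].
by apply: sub_sigma_algebra; exists k, i, B; split => //; exact: leqW.
Qed.

Lemma measurable_particle p i : measurable_fun setT (fun w : S p.+1 => xi p i w).
Proof.
by move=> _ B mB; rewrite setTI; apply: sub_sigma_algebra; exists p, i, B.
Qed.

Let measurable_particle_fst p i :
  measurable_fun setT (fun z : S p.+1 * X => xi p i z.1).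
Proof.
have H := @measurable_fst _ _ (S p.+1) X.
exact: measurableT_comp (@measurable_particle p i) H.
Qed.

Definition particle_density (p : nat) (w : O) (x : X) : R :=
  if p is p'.+1 then mutation_density m theta y p' (fun j => xi p' j w) x
  else init m theta x.

Lemma particle_densityS p w x :
  particle_density p.+1 w x = e w p (fun z => q p z x) / e w p (g p).
Proof.
rewrite /particle_density /mutation_density /etaN /empirical.
rewrite -mulf_div divff ?mul1r; last by rewrite invr_eq0 pnatr_eq0 -lt0n.
by congr (_ / _); apply: eq_bigr => j _; rewrite mulrC.
Qed.

Lemma particle_density_ge0 p w x : 0 <= particle_density p w x.
Proof.
case: p => [|p]; first exact: init_ge0 reg x.
rewrite particle_densityS; apply: divr_ge0; apply: ltW.
  exact: (averaging_qdens_gt0 (e := e w) reg (averaging_particles w p)).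
exact: (averaging_obs_gt0 (e := e w) reg (averaging_particles w p)).
Qed.

Lemma particle_density_le p w x : particle_density p.+1 w x <= delta ^+ 2 * rho.
Proof.
have /andP[_ h1] := averaging_qdens_bounds (e := e w) reg (averaging_particles w p) x.
have /andP[h2 _] := averaging_obs_bounds (e := e w) reg (averaging_particles w p).
have d0 := delta_gt0 reg.
rewrite particle_densityS (_ : _ * rho = (delta * rho) * delta); last by ring.
apply: ler_pM => //.
- exact/ltW/(averaging_qdens_gt0 (e := e w) reg (averaging_particles w p)).
- by rewrite invr_ge0; exact/ltW/(averaging_obs_gt0 (e := e w) reg (averaging_particles w p)).
- by rewrite -[leRHS]invrK lef_pV2// posrE ?invr_gt0//; apply: lt_le_trans h2; rewrite invr_gt0.
Qed.

Lemma measurable_particle_density p :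
  measurable_fun setT (fun z : S p * X => particle_density p z.1 z.2).
Proof.
case: p => [|p]; first exact: measurableT_comp (init_measurable reg) measurable_snd.
have H j : measurable_fun setT (fun z : S p.+1 * X => (xi p j z.1, z.2)).
  by apply: measurable_fun_pair; [exact: measurable_particle_fst|exact: measurable_snd].
apply: bm_measurable.
rewrite (_ : (fun z => _) = fun z : S p.+1 * X => e z.1 p (fun x => q p x z.2) / e z.1 p (g p)); last first.
  by apply/funext => z; rewrite particle_densityS.
apply: (@bm_div _ _ _ _ _ delta^-1).
- by apply: bmZ; apply: bm_sum => j; exact: bm_comp (bm_qdens reg p) (H j).
- apply: bm_measurable; apply: bmZ; apply: bm_sum => j.
  by apply: bm_comp (bm_obs reg p) _; exact: measurable_particle_fst.
- by rewrite invr_gt0 (delta_gt0 reg).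
- by move=> z; have /andP[] := averaging_obs_bounds (e := e z.1) reg (averaging_particles z.1 p).
Qed.

Lemma particle_density_predictive p (f : S p * X -> R) w :
  wkernel mu (fun z : S p * X => particle_density p z.1 z.2) f w =
  predictive mu m theta y (e w) p (fun x => f (w, x)).
Proof.
case: p f w => [//|p] f w; apply: eq_Rintegral => x _.
by rewrite [X in X * _]particle_densityS.
Qed.

Lemma particle_density_integral p (w : S p) :
  (\int[mu]_x (particle_density p w x)%:E = 1)%E.
Proof.
case: p w => [|p] w; first exact: init_integral reg.
have avg := averaging_particles w p.
have bd : bounded_measurable (particle_density p.+1 w).
  rewrite (_ : particle_density p.+1 w = fun x => (e w p (g p))^-1 * e w p (fun z => q p z x)).
    by apply: bmZ; exact: (bm_averaging_qdens (e := e w) reg avg).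
  by apply/funext => x; rewrite particle_densityS mulrC.
rewrite -[LHS]fineK; last first.
  exact: (integrable_fin_num measurableT (bm_integrable mu bd)).
congr EFin; change (\int[mu]_x particle_density p.+1 w x = 1).
under eq_Rintegral do rewrite particle_densityS mulrC.
rewrite bm_RintegralZ; last exact: (bm_averaging_qdens (e := e w) reg avg).
rewrite (averaging_fubini avg (bm_qdens reg p)).
rewrite (_ : (fun x => _) = g p); last by apply/funext => x; exact: qdens_integral reg p x.
by rewrite mulVf// gt_eqF// (averaging_obs_gt0 (e := e w) reg avg).
Qed.

Lemma particle_block p (A : set O) (B : 'I_N -> set X) :
  <<s past_generators p >> A -> (forall i, measurable (B i)) ->
  P (A `&` \bigcap_(i in [set: 'I_N]) (xi p i @^-1` B i)) =
  (\int[P]_(w in A) \prod_(i < N) \int[mu]_(x in B i) (particle_density p w x)%:E)%E.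
Proof.
case: ps => ps0 psS; case: p => [|p] pA mB; last exact: psS.
have [->|->] := trivial_sigma_algebra pA.
  by rewrite set0I measure0 integral_set0.
rewrite setTI ps0//.
transitivity (\int[P]_w (cst (\prod_(i < N) \int[mu]_(x in B i) (init m theta x)%:E) w))%E;
  last by [].
rewrite integral_cst//.
have -> : (P : {measure set O -> \bar R}) setT = 1%E by exact: probability_setT.
by rewrite mule1.
Qed.

Definition sampling_error (p : nat) psi (w : O) : R :=
  e w p psi - predictive mu m theta y (e w) p psi.

Let sum_innovation p (f : S p * X -> R) w :
  \sum_(i < N) innovation mu (xi p) (fun z : S p * X => particle_density p z.1 z.2) f i w =
  N%:R * sampling_error p (fun x => f (w, x)) w.
Proof.
rewrite /innovation particle_density_predictive sumrB sumr_const card_ord.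
rewrite /sampling_error /etaN /empirical mulrBr mulrA mulfV ?mul1r ?mulr_natl//.
by rewrite pnatr_eq0 -lt0n.
Qed.

Lemma bm_predictive p (f : S p * X -> R) : bounded_measurable f ->
  bounded_measurable (fun w : S p => predictive mu m theta y (e w) p (fun x => f (w, x))).
Proof.
move=> bf; rewrite (_ : (fun w => _) = wkernel mu (fun z : S p * X => particle_density p z.1 z.2) f).
  apply: (bm_wkernel (B := 1) (@measurable_particle_density p)) => // [z|s].
    exact: particle_density_ge0.
  by rewrite particle_density_integral.
by apply/funext => w; rewrite particle_density_predictive.
Qed.

Lemma bm_particle_mean p (f : S p * X -> R) : bounded_measurable f ->
  bounded_measurable (fun w : S p.+1 => e w p (fun x => f (w, x))).
Proof.
move=> bf; apply: bmZ; apply: bm_sum => i; apply: bm_comp bf _.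
by apply: measurable_fun_pair; [exact: measurable_id_past|exact: measurable_particle].
Qed.

Lemma bm_sampling_error p (f : S p * X -> R) : bounded_measurable f ->
  bounded_measurable (fun w : S p.+1 => sampling_error p (fun x => f (w, x)) w).
Proof.
move=> bf; apply: bmB; first exact: bm_particle_mean.
exact: bm_comp (bm_predictive bf) (@measurable_id_past p).
Qed.

Lemma bm_past p (f : S p -> R) : bounded_measurable f -> bounded_measurable (f : O -> R).
Proof. by apply: bm_from_g_sigma; exact: past_generators_measurable. Qed.

Let NR0 : 0 < N%:R :> R. Proof. by rewrite ltr0n. Qed.

(** The test function may depend on the past, as the random potentials do. [N] times the sampling
    error is the sum of the innovations of the generation. *)
Lemma sampling_second_moment p (f : S p * X -> R) : bounded_measurable f ->
  \int[P]_w (sampling_error p (fun x => f (w, x)) w) ^+ 2 <=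
  N%:R^-1 * \int[P]_w predictive mu m theta y (e w) p (fun x => f (w, x) ^+ 2).
Proof.
move=> bf.
have := block_second_moment (P := P) (mu := mu) (@past_generators_measurable p)
  (fun i => measurable_funP (xi p i)) (@measurable_particle_density p)
  (fun z => particle_density_ge0 p z.1 z.2) (@particle_density_integral p)
  (@particle_block p) bf.
under eq_Rintegral do rewrite sum_innovation exprMn.
rewrite bm_RintegralZ; last first.
  by apply: bmX; exact: (bm_past (bm_sampling_error bf)).
under [X in _ <= _ * X]eq_Rintegral do rewrite particle_density_predictive.
by rewrite expr2 -mulrA ler_pM2l// -ler_pdivlMl.
Qed.

Lemma sampling_clt p psi M s2 (al : S p -> R) : bounded_measurable psi ->
  (forall x, `|psi x| <= M) -> 0 <= s2 -> s2 <= 4 * M ^+ 2 ->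
  measurable_fun setT al ->
  `|\int[P]_w cos (al w + Num.sqrt N%:R * sampling_error p psi w) -
    expR (- (s2 / 2)) * \int[P]_w cos (al w)| <=
  (8 * M ^+ 3 + 4 * M ^+ 4) / Num.sqrt N%:R +
  (\int[P]_w `|predictive mu m theta y (e w) p (fun x => psi x ^+ 2) -
     predictive mu m theta y (e w) p psi ^+ 2 - s2|) / 2.
Proof.
move=> bpsi psiM s20 s2M mal.
have := block_clt (P := P) (mu := mu) (@past_generators_measurable p)
  (fun i => measurable_funP (xi p i)) (@measurable_particle_density p)
  (fun z => particle_density_ge0 p z.1 z.2) (@particle_density_integral p)
  (@particle_block p) bpsi psiM N_gt0 s20 s2M mal.
under eq_Rintegral do rewrite sum_innovation /=.
under [X in _ <= _ + X / 2]eq_Rintegral do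
  rewrite /block_variance !particle_density_predictive.
have E w : N%:R * sampling_error p psi w / Num.sqrt N%:R = Num.sqrt N%:R * sampling_error p psi w.
  rewrite -{1}(sqr_sqrtr (ltW NR0)); field.
  by rewrite gt_eqF// sqrtr_gt0.
by under eq_Rintegral do rewrite E.
Qed.

End particle_approximation.

Section exact_flow.
Context (R : realType) (d : nat) (dX dY : measure_display)
  (X : measurableType dX) (Y : measurableType dY).
Variables (mu : {finite_measure set X -> \bar R}) (m : densities R d X Y).
Variables (theta : 'rV[R]_d) (y : nat -> Y) (rho delta : R).
Hypothesis reg : regular_model mu m theta y rho delta.
Variables (t : nat -> X -> X -> R) (tau : R).
Hypothesis regt : regular_score t tau.
Implicit Types (u h phi psi : X -> R) (e : nat -> (X -> R) -> R).
Notation q := (qdens m theta y).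
Notation g k := (fun x : X => obs m theta x (y k)).
Notation U := (Qsg mu m theta y).

Lemma averaging_predictive e p : averaging mu (e p.-1) ->
  averaging mu (predictive mu m theta y e p).
Proof.
case: p => [|p] /= avg; apply: averaging_density.
- exact: init_measurable reg.
- exact: init_ge0 reg.
- exact: init_integral reg.
- apply: bm_measurable; apply: bmM; last exact: bm_cst.
  exact: (bm_averaging_qdens (e := e) reg avg).
- move=> x; apply: divr_ge0; apply: ltW.
    exact: (averaging_qdens_gt0 (e := e) reg avg).
  exact: (averaging_obs_gt0 (e := e) reg avg).
have bd : bounded_measurable (fun z => e p (fun x => q p x z) / e p (g p)).
  by apply: bmM; [exact: (bm_averaging_qdens (e := e) reg avg)|exact: bm_cst].
rewrite -[LHS]fineK; last first.
  exact: (integrable_fin_num measurableT (bm_integrable mu bd)).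
congr EFin; change (\int[mu]_x (e p (fun z => q p z x) / e p (g p)) = 1).
under eq_Rintegral do rewrite mulrC.
rewrite bm_RintegralZ; last exact: (bm_averaging_qdens (e := e) reg avg).
rewrite (averaging_fubini avg (bm_qdens reg p)).
rewrite (_ : (fun x => _) = g p); last by apply/funext => x; exact: qdens_integral reg p x.
by rewrite mulVf// gt_eqF// (averaging_obs_gt0 (e := e) reg avg).
Qed.

Lemma predictiveS_mean e p phi : averaging mu (e p) -> bounded_measurable phi ->
  predictive mu m theta y e p.+1 phi = e p (U p 1 phi) / e p (g p).
Proof.
move=> avg bp; have bF : bounded_measurable (fun z : X * X => q p z.1 z.2 * phi z.2).
  by apply: bmM; [exact: bm_qdens reg p|exact: bm_comp bp measurable_snd].
rewrite /= -(averaging_fubini avg bF) mulrC -bm_RintegralZ; last first.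
  exact: (averaging_bm avg bF).
apply: eq_Rintegral => z _ /=.
have -> : e p (fun x => q p x z * phi z) = phi z * e p (fun x => q p x z).
  rewrite -(averagingZ avg) //; last exact: (bm_qdens_to reg p z).
  by congr (e p); apply/funext => x; rewrite mulrC.
by move: (e p _) (e p _)^-1 => A B; ring.
Qed.

(** [eta_flow] is defined through path integrals; in this recursive form the prediction step holds
    by definition. The two are identified in [eta_flowE]. *)
Fixpoint exact_density (p : nat) : X -> R :=
  if p is p'.+1 then fun z =>
    (\int[mu]_x (exact_density p' x * q p' x z)) /
    (\int[mu]_x (exact_density p' x * obs m theta x (y p')))
  else init m theta.

Definition exact_flow (p : nat) phi : R := \int[mu]_x (exact_density p x * phi x).

Lemma exact_flow_predictive p :
  exact_flow p = predictive mu m theta y exact_flow p.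
Proof. by case: p. Qed.

Lemma averaging_exact p : averaging mu (exact_flow p).
Proof.
elim: p => [|p IH]; rewrite exact_flow_predictive; last exact: averaging_predictive.
apply: averaging_density; [exact: init_measurable reg|exact: init_ge0 reg|exact: init_integral reg].
Qed.

Definition initial_mean n u h : R :=
  \int[mu]_z (init m theta z * (t 0 z z * U 0 n u z + Hsg mu m theta y t 0 n u h z)).

Lemma initial_meanE e n u h :
  predictive mu m theta y e 0 (potential mu m theta y t e n u h 0) = initial_mean n u h.
Proof. by rewrite /potential subn0. Qed.

(** The exact flow is its own prediction, so every term of the telescoping sum is zero. *)
Lemma exact_flow_mean n u h : bounded_measurable u -> bounded_measurable h ->
  normalizer m theta y exact_flow n *
    exact_flow n (fun x => Tback m theta y t exact_flow n x * u x + h x) =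
  initial_mean n u h.
Proof.
move=> bu bh; apply/eqP; rewrite -subr_eq0; apply/eqP.
rewrite -(initial_meanE exact_flow) (potential_martingale reg regt averaging_exact)//.
by rewrite big1// => p _; rewrite -exact_flow_predictive subrr mulr0.
Qed.

Definition potential_bound n (M : R) p : R :=
  (p.+1%:R * tau) * (delta ^+ (n - p) * M) +
  delta ^+ (n - p) * (M + (n - p)%:R * tau * M).

Lemma potential_norm_le e n u h M p x : (forall p, averaging mu (e p)) ->
  bounded_measurable u -> bounded_measurable h ->
  (forall x, `|u x| <= M) -> (forall x, `|h x| <= M) ->
  `|potential mu m theta y t e n u h p x| <= potential_bound n M p.
Proof.
move=> avg bu bh uM hM; apply: le_trans (ler_normD _ _) _; apply: lerD.
  rewrite normrM; apply: ler_pM => //; first exact: (Tback_norm_le (e := e) reg regt avg).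
  exact: (Qsg_norm_le reg _ _ bu uM).
exact: (Hsg_norm_le reg regt _ _ bu bh uM hM).
Qed.

Lemma predictive_norm_le e p phi M : (forall p, averaging mu (e p)) ->
  bounded_measurable phi -> (forall x, `|phi x| <= M) ->
  `|predictive mu m theta y e p phi| <= M.
Proof.
by move=> avg bp pM; apply: averaging_norm_le bp pM; exact: averaging_predictive.
Qed.

End exact_flow.

Section moment_inequalities.
Context d (O : measurableType d) (R : realType) (P : probability O R).
Implicit Types A B : O -> R.

(** With [r = a / b], one has [A / B - r = ((A - a) - r (B - b)) / B]; then
    [(x - z) ^ 2 <= 2 x ^ 2 + 2 z ^ 2]. *)
Lemma ratio_second_moment A B (a b b0 K c : R) :
  bounded_measurable A -> bounded_measurable B -> 0 < b0 -> 0 < b ->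
  (forall w, b0 <= B w) -> `|a / b| <= K ->
  \int[P]_w (A w - a) ^+ 2 <= c -> \int[P]_w (B w - b) ^+ 2 <= c ->
  \int[P]_w (A w / B w - a / b) ^+ 2 <= 2 / b0 ^+ 2 * (1 + K ^+ 2) * c.
Proof.
move=> bA bB b00 b_0 Bb rK Ac Bc; set r := a / b.
have aE : a = r * b by rewrite /r divfK// gt_eqF.
have bAa : bounded_measurable (fun w => (A w - a) ^+ 2).
  by apply: bmX; apply: bmB => //; exact: bm_cst.
have bBb : bounded_measurable (fun w => K ^+ 2 * (B w - b) ^+ 2).
  by apply: bmZ; apply: bmX; apply: bmB => //; exact: bm_cst.
apply: (@le_trans _ _ (\int[P]_w (2 / b0 ^+ 2 * ((A w - a) ^+ 2 + K ^+ 2 * (B w - b) ^+ 2)))).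
  apply: bm_le_Rintegral.
  - apply: bmX; apply: bmB; last exact: bm_cst.
    by apply: (bm_div bA _ b00) => //; exact: bm_measurable.
  - by apply: bmZ; exact: bmD.
  move=> w; have Bw0 : 0 < B w := lt_le_trans b00 (Bb w).
  have -> : A w / B w - r = ((A w - a) - r * (B w - b)) / B w.
    by rewrite aE; field; rewrite gt_eqF.
  rewrite expr_div_n (_ : 2 / b0 ^+ 2 * _ =
    (2 * ((A w - a) ^+ 2 + K ^+ 2 * (B w - b) ^+ 2)) * (b0 ^+ 2)^-1); last by ring.
  apply: ler_pM; rewrite ?sqr_ge0 ?invr_ge0 ?sqr_ge0//; last first.
    rewrite lef_pV2 ?posrE ?exprn_gt0//.
    by apply: lerXn2r; rewrite ?nnegrE; [exact: ltW|exact: ltW|exact: Bb].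
  have r2 : r ^+ 2 <= K ^+ 2.
    by rewrite -(real_normK (num_real r)); apply: lerXn2r => //; rewrite nnegrE// (le_trans _ rK).
  have : r ^+ 2 * (B w - b) ^+ 2 <= K ^+ 2 * (B w - b) ^+ 2.
    by apply: ler_wpM2r => //; exact: sqr_ge0.
  have := sqr_ge0 ((A w - a) + r * (B w - b)).
  by move: (A w - a) (B w - b) => {Bw0 bAa bBb} a' b'; nra.
rewrite bm_RintegralZ; last exact: bmD.
rewrite bm_RintegralD// bm_RintegralZ; last by apply: bmX; apply: bmB => //; exact: bm_cst.
rewrite -mulrA; apply: ler_wpM2l; first by rewrite divr_ge0// exprn_ge0// ltW.
by rewrite mulrDl mul1r; apply: lerD => //; apply: ler_wpM2l => //; exact: sqr_ge0.
Qed.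

(* [2 |x| <= s x^2 + 1 / s] *)
Lemma abs_of_second_moment A (s c : R) : bounded_measurable A -> 0 < s ->
  \int[P]_w A w ^+ 2 <= c / s ^+ 2 -> \int[P]_w `|A w| <= (c + 1) / s.
Proof.
move=> bA s0 Ac.
apply: (@le_trans _ _ (\int[P]_w (s * A w ^+ 2 + s^-1))).
  apply: bm_le_Rintegral; first exact: bm_norm.
    by apply: bmD; [apply: bmZ; exact: bmX|exact: bm_cst].
  move=> w; rewrite -(real_normK (num_real (A w))).
  have := sqr_ge0 (s * `|A w| - 1); have := normr_ge0 (A w).
  move: `|A w| => x x0 H; rewrite -(ler_pM2l s0) mulrDr mulfV ?gt_eqF//.
  have : 0 <= s * x by rewrite mulr_ge0// ltW.
  nra.
rewrite bm_RintegralD; [|by apply: bmZ; exact: bmX|exact: bm_cst].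
rewrite Rintegral_prob_cst bm_RintegralZ; last exact: bmX.
rewrite mulrDl mul1r lerD2r.
have -> : c / s = s * (c / s ^+ 2) by field; rewrite gt_eqF.
by apply: ler_wpM2l => //; exact: ltW.
Qed.

Lemma abs_mul_of_second_moments A B (s a b : R) :
  bounded_measurable A -> bounded_measurable B -> 0 < s ->
  \int[P]_w A w ^+ 2 <= a / s -> \int[P]_w B w ^+ 2 <= b / s ->
  \int[P]_w `|A w * B w| <= (a + b) / s.
Proof.
move=> bA bB s0 Aa Bb.
apply: (@le_trans _ _ (\int[P]_w (A w ^+ 2 + B w ^+ 2))).
  apply: bm_le_Rintegral; first by apply: bm_norm; exact: bmM.
    by apply: bmD; exact: bmX.
  move=> w; rewrite normrM -(real_normK (num_real (A w))) -(real_normK (num_real (B w))).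
  have := sqr_ge0 (`|A w| - `|B w|); have := normr_ge0 (A w); have := normr_ge0 (B w).
  have := mulr_ge0 (normr_ge0 (A w)) (normr_ge0 (B w)).
  by move: `|A w| `|B w| => x z; nra.
by rewrite bm_RintegralD ?mulrDl; [exact: lerD|exact: bmX|exact: bmX].
Qed.

End moment_inequalities.

(** * Mean-square convergence of the particle measures and backward statistics *)

Section particle_convergence.
Context (R : realType) (d : nat) (dX dY : measure_display)
  (X : measurableType dX) (Y : measurableType dY).
Variables (mu : {finite_measure set X -> \bar R}) (m : densities R d X Y).
Variables (theta : 'rV[R]_d) (y : nat -> Y) (rho delta : R).
Hypothesis reg : regular_model mu m theta y rho delta.
Variables (t : nat -> X -> X -> R) (tau : R).
Hypothesis regt : regular_score t tau.

(** From [sqr_sum_le] over the [n + 1] generations, the normalizers being at most [delta ^ p] and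
    the potentials at most [potential_bound]. *)
Definition fluctuation_bound n (M : R) : R :=
  2 ^+ n.+1 * \sum_(p < n.+1) (delta ^+ p * potential_bound delta tau n M p) ^+ 2.

(** The constant of [ratio_second_moment]: lower bound of the denominator, bound of the ratio,
    fluctuation of the two flows. At time 0 the backward statistic is deterministic. *)
Definition Tback_error p : R :=
  if p is p'.+1 then 2 / ((delta ^+ p')^-1 * (delta * rho)^-1) ^+ 2 *
    (1 + (p.+1%:R * tau) ^+ 2) * fluctuation_bound p' (delta * rho * (1 + tau))
  else 0.

Definition predictive_error p (M : R) : R :=
  if p is p'.+1 then 2 / ((delta ^+ p')^-1 * delta^-1) ^+ 2 *
    (1 + M ^+ 2) * fluctuation_bound p' (delta * (1 + M))
  else 0.

Context (dO : measure_display) (O : measurableType dO) (P : probability O R).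
Variables (N : nat) (xi : nat -> 'I_N -> {RV P >-> X}).
Hypotheses (N_gt0 : (0 < N)%N) (ps : particle_system mu m theta y xi).
Implicit Types (u h phi psi : X -> R).
Notation q := (qdens m theta y).
Notation g k := (fun x : X => obs m theta x (y k)).
Notation U := (Qsg mu m theta y).
Notation e := (etaN xi).
Notation eta := (exact_flow mu m theta y).
Notation S p := (g_sigma_algebraType (past_generators xi p)).
Notation T w p := (Tback m theta y t (e w) p).
Notation Phi w := (potential mu m theta y t (e w)).

Let avg w p : averaging mu (e w p) := averaging_particles mu xi N_gt0 w p.

Let bm_to_O p (f : S p -> R) : bounded_measurable f -> bounded_measurable (f : O -> R) :=
  @bm_past _ _ _ _ _ _ _ xi p f.

Let measurable_fst_id p :
  measurable_fun setT (fun z : S p.+1 * X => z.1 : S p).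
Proof.
exact: measurableT_comp (@measurable_id_past _ _ X _ O P N xi p) (@measurable_fst _ _ (S p.+1) X).
Qed.

Let measurable_fst_particle p i :
  measurable_fun setT (fun z : S p.+1 * X => xi p i z.1).
Proof.
exact: measurableT_comp (@measurable_particle _ _ X _ O P N xi p i) (@measurable_fst _ _ (S p.+1) X).
Qed.

Lemma bm_particle_Tback p : bounded_measurable (fun z : S p * X => T z.1 p z.2).
Proof.
elim: p => [|p IH]; first exact: bm_comp (bm_score_diag regt) measurable_snd.
have mx i : measurable_fun setT (fun z : S p.+1 * X => (xi p i z.1, z.2)).
  by apply: measurable_fun_pair; [exact: measurable_fst_particle|exact: measurable_snd].
have mT i : measurable_fun setT (fun z : S p.+1 * X => (z.1 : S p, xi p i z.1)).
  by apply: measurable_fun_pair; [exact: measurable_fst_id|exact: measurable_fst_particle].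
apply: (@bm_div _ _ _ _ _ (delta * rho)^-1).
- apply: bmZ; apply: bm_sum => i; apply: bmM; first exact: bm_comp (bm_qdens reg p) (mx i).
  by apply: bmD; [exact: bm_comp IH (mT i)|exact: bm_comp (bm_score regt p.+1) (mx i)].
- apply: bm_measurable; apply: bmZ; apply: bm_sum => i.
  exact: bm_comp (bm_qdens reg p) (mx i).
- by rewrite invr_gt0 (qmax_gt0 reg).
- by move=> z; have /andP[] := averaging_qdens_bounds (e := e z.1) reg (avg z.1 p) z.2.
Qed.

Lemma bm_particle_potential n u h p : bounded_measurable u -> bounded_measurable h ->
  bounded_measurable (fun z : S p * X => Phi z.1 n u h p z.2).
Proof.
move=> bu bh; apply: bmD; last exact: bm_comp (bm_Hsg reg regt _ _ bu bh) measurable_snd.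
by apply: bmM; [exact: bm_particle_Tback|exact: bm_comp (bm_Qsg reg _ _ bu) measurable_snd].
Qed.

Lemma bm_particle_normalizer p :
  bounded_measurable (fun w : S p => normalizer m theta y (e w) p).
Proof.
elim: p => [|p IH].
  rewrite (_ : (fun w => _) = fun=> 1); first exact: bm_cst.
  by apply/funext => w; rewrite /normalizer big_ord0.
rewrite (_ : (fun w => _) = fun w => normalizer m theta y (e w) p * e w p (g p)).
  apply: bmM; first exact: bm_comp IH (@measurable_id_past _ _ X _ O P N xi p).
  exact: (@bm_particle_mean _ _ _ _ _ _ _ xi p (fun z => g p z.2)
    (bm_comp (bm_obs reg p) measurable_snd)).
by apply/funext => w; rewrite /normalizer big_ord_recr.
Qed.

Let NV0 : 0 <= N%:R^-1 :> R. Proof. by rewrite invr_ge0. Qed.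

Lemma sampling_second_moment_le p (f : S p * X -> R) C : bounded_measurable f ->
  (forall z, `|f z| <= C) ->
  \int[P]_w (sampling_error mu m theta y xi p (fun x => f (w, x)) w) ^+ 2 <=
  N%:R^-1 * C ^+ 2.
Proof.
move=> bf fC; apply: le_trans (sampling_second_moment reg N_gt0 ps bf) _.
apply: ler_wpM2l => //; apply: le_trans (ler_norm _) _.
apply: expectation_norm_le.
  exact: bm_to_O (bm_predictive reg N_gt0 (bmX 2 bf)).
move=> w; apply: (predictive_norm_le (e := e w) reg _ (avg w)).
  by apply: bmX; apply: bm_comp bf _; exact: (@pair1_measurable _ _ (S p) X).
move=> x; rewrite normrX; apply: lerXn2r; rewrite ?nnegrE//.
exact: le_trans (fC (w, x)).
Qed.

Definition particle_flow n u h (w : O) : R :=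
  normalizer m theta y (e w) n * e w n (fun x => T w n x * u x + h x).

Lemma particle_flow_telescope n u h w : bounded_measurable u -> bounded_measurable h ->
  particle_flow n u h w - initial_mean mu m theta y t n u h =
  \sum_(p < n.+1) normalizer m theta y (e w) p *
    sampling_error mu m theta y xi p (Phi w n u h p) w.
Proof.
by move=> bu bh; rewrite -(potential_martingale reg regt (avg w) n bu bh) initial_meanE.
Qed.

Lemma bm_particle_flow n u h : bounded_measurable u -> bounded_measurable h ->
  bounded_measurable (particle_flow n u h).
Proof.
move=> bu bh; apply: bmM; first exact: bm_to_O (bm_particle_normalizer n).
have bT : bounded_measurable (fun z : S n * X => T z.1 n z.2 * u z.2 + h z.2).
  apply: bmD; last exact: bm_comp bh measurable_snd.
  by apply: bmM; [exact: bm_particle_Tback|exact: bm_comp bu measurable_snd].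
exact: (bm_to_O (bm_particle_mean bT)).
Qed.

(** The telescoping sum is bounded generation by generation; the second moment of each sampling
    error is of order [1 / N]. *)
Lemma particle_fluctuation n u h M : bounded_measurable u -> bounded_measurable h ->
  (forall x, `|u x| <= M) -> (forall x, `|h x| <= M) ->
  \int[P]_w (particle_flow n u h w - initial_mean mu m theta y t n u h) ^+ 2 <=
  N%:R^-1 * fluctuation_bound n M.
Proof.
move=> bu bh uM hM.
pose D p w := normalizer m theta y (e w) p * sampling_error mu m theta y xi p (Phi w n u h p) w.
have bE p : bounded_measurable (fun w : O => sampling_error mu m theta y xi p (Phi w n u h p) w).
  exact: bm_to_O (bm_sampling_error reg N_gt0 (bm_particle_potential n p bu bh)).
have bD p : bounded_measurable (D p).
  by apply: bmM; [exact: bm_to_O (bm_particle_normalizer p)|exact: bE].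
apply: (@le_trans _ _ (\int[P]_w (2 ^+ n.+1 * \sum_(p < n.+1) D p w ^+ 2))).
  apply: bm_le_Rintegral.
  - apply: bmX; apply: bmB; [exact: bm_particle_flow|exact: bm_cst].
  - by apply: bmZ; apply: bm_sum => p; exact: bmX.
  - by move=> w; rewrite particle_flow_telescope//; exact: (sqr_sum_le n.+1 (fun p => D p w)).
rewrite bm_RintegralZ; last by apply: bm_sum => p; exact: bmX.
rewrite bm_Rintegral_sum; last by move=> p; exact: bmX.
rewrite /fluctuation_bound mulrCA; apply: ler_wpM2l; first exact: exprn_ge0.
rewrite mulr_sumr; apply: ler_sum => p _; rewrite exprMn mulrCA.
have d0 := delta_gt0 reg.
apply: (@le_trans _ _ (\int[P]_w ((delta ^+ p) ^+ 2 *
    sampling_error mu m theta y xi p (Phi w n u h p) w ^+ 2))).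
  apply: bm_le_Rintegral; [exact: bmX|by apply: bmZ; exact: bmX|].
  move=> w; rewrite exprMn; apply: ler_wpM2r; first exact: sqr_ge0.
  have /andP[_ a] := normalizer_bounds reg (avg w) p.
  by apply: lerXn2r => //; rewrite nnegrE ?exprn_ge0// ltW// (normalizer_gt0 reg (avg w)).
rewrite bm_RintegralZ; last exact: bmX.
apply: ler_wpM2l; first exact: sqr_ge0.
apply: (sampling_second_moment_le (f := fun z => Phi z.1 n u h p z.2)); first exact: bm_particle_potential.
by move=> z; apply: (@potential_norm_le _ _ _ _ _ _ _ _ _ _ _ _ reg _ _ regt (e z.1) n u h M p z.2 (avg z.1)).
Qed.

Let bm0 : bounded_measurable (fun _ : X => 0 : R). Proof. exact: bm_cst. Qed.

Lemma particle_flow_mass n h w :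
  particle_flow n (fun=> 0) h w = normalizer m theta y (e w) n * e w n h.
Proof.
by congr (_ * e w n _); apply/funext => x; rewrite mulr0 add0r.
Qed.

Lemma exact_flow_mass n h : bounded_measurable h ->
  initial_mean mu m theta y t n (fun=> 0) h = normalizer m theta y eta n * eta n h.
Proof.
move=> bh; rewrite -(exact_flow_mean reg regt n bm0 bh).
by congr (_ * eta n _); apply/funext => x; rewrite mulr0 add0r.
Qed.

Lemma mass_second_moment n h M : bounded_measurable h -> (forall x, `|h x| <= M) ->
  \int[P]_w (normalizer m theta y (e w) n * e w n h -
     normalizer m theta y eta n * eta n h) ^+ 2 <= N%:R^-1 * fluctuation_bound n M.
Proof.
move=> bh hM; rewrite -exact_flow_mass//.
under eq_Rintegral do rewrite -particle_flow_mass.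
apply: particle_fluctuation => //.
by move=> x; rewrite normr0 (le_trans _ (hM x)).
Qed.

Lemma bm_mass n h : bounded_measurable h ->
  bounded_measurable (fun w : O => normalizer m theta y (e w) n * e w n h).
Proof.
move=> bh; have := bm_particle_flow n bm0 bh.
by rewrite (_ : particle_flow _ _ _ = fun w => normalizer m theta y (e w) n * e w n h)//;
  apply/funext => w; rewrite particle_flow_mass.
Qed.

Lemma normalizer_second_moment n :
  \int[P]_w (normalizer m theta y (e w) n - normalizer m theta y eta n) ^+ 2 <=
  N%:R^-1 * fluctuation_bound n 1.
Proof.
have := @mass_second_moment n (fun=> 1) 1 (bm_cst X (1 : R)).
rewrite (averaging_cst (averaging_exact reg n)) mulr1 => H.
apply: le_trans (H _); last by move=> x; rewrite normr1.
rewrite le_eqVlt; apply/orP; left; apply/eqP; apply: eq_Rintegral => w _.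
by rewrite (averaging_cst (avg w n)) mulr1.
Qed.

(** Once the normalizer is inserted above and below, [T_(p+1)(x)] is a ratio of two flows at time
    [p], both with explicit test functions built from [q p . x]. The fluctuation bound applied to
    them rests on the sup bound of [T] alone, so there is no circularity. *)
Lemma Tback_second_moment p x :
  \int[P]_w (T w p x - Tback m theta y t eta p x) ^+ 2 <= N%:R^-1 * Tback_error p.
Proof.
have [d0 r0] := (delta_gt0 reg, rho_gt0 reg).
case: p => [|p].
  by rewrite mulr0; under eq_Rintegral do rewrite subrr expr0n; rewrite Rintegral_prob_cst.
pose u z := q p z x; pose h z := q p z x * t p.+1 z x.
have bu : bounded_measurable u by exact: (bm_qdens_to reg p x).
have bh : bounded_measurable h by apply: bmM => //; exact: (bm_score_to regt p.+1 x).
pose M := delta * rho * (1 + tau).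
have t0 := tau_ge0 regt; have c0 := qmax_gt0 reg.
have u0 z : `|u z| <= delta * rho.
  by rewrite gtr0_norm ?(qdens_gt0 reg)//; have /andP[] := qdens_bounds reg p z x.
have uM z : `|u z| <= M.
  by apply: le_trans (u0 z) _; rewrite /M ler_peMr ?lerDl// ltW.
have hM z : `|h z| <= M.
  rewrite normrM /M mulrDr mulr1; apply: le_trans (_ : delta * rho * tau <= _); last by rewrite lerDr ltW.
  by apply: ler_pM => //; [exact: u0|exact: (score_bound regt)].
have split_u (f : nat -> (X -> R) -> R) : averaging mu (f p) ->
    Tback m theta y t f p.+1 x =
    f p (fun z => Tback m theta y t f p z * u z + h z) / f p u.
  move=> _; rewrite /= /backward_kernel; congr (f p _ / _).
  by apply/funext => z; rewrite /u /h; ring.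
have ratio (c a b : R) : c != 0 -> a / b = (c * a) / (c * b).
  by move=> c_0; rewrite invfM mulrACA mulfV ?mul1r.
have n0 := normalizer_gt0 reg (averaging_exact reg) p.
have nw w := normalizer_gt0 reg (avg w) p.
have eT : Tback m theta y t eta p.+1 x = initial_mean mu m theta y t p u h /
    initial_mean mu m theta y t p (fun=> 0) u.
  rewrite split_u; last exact: (averaging_exact reg p).
  rewrite (ratio (normalizer m theta y eta p)) ?gt_eqF//.
  by rewrite exact_flow_mass// (exact_flow_mean reg regt).
have eN w : T w p.+1 x = particle_flow p u h w / particle_flow p (fun=> 0) u w.
  by rewrite split_u// (ratio (normalizer m theta y (e w) p)) ?gt_eqF// particle_flow_mass.
under eq_Rintegral do rewrite eN eT.
rewrite /Tback_error mulrCA -/M.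
apply: ratio_second_moment.
- exact: bm_particle_flow.
- exact: bm_particle_flow.
- by rewrite mulr_gt0// invr_gt0// exprn_gt0.
- rewrite exact_flow_mass// mulr_gt0//.
  exact: (averaging_qdens_gt0 (e := eta) reg (averaging_exact reg p)).
- move=> w; rewrite particle_flow_mass.
  have /andP[a _] := normalizer_bounds reg (avg w) p.
  have /andP[b _] := averaging_qdens_bounds (e := e w) reg (avg w p) x.
  by apply: ler_pM => //; rewrite invr_ge0 ?exprn_ge0// ltW.
- by rewrite -eT; exact: (Tback_norm_le (e := eta) reg regt (averaging_exact reg) _ _).
- exact: particle_fluctuation.
- by apply: particle_fluctuation => // z; rewrite normr0 (le_trans _ (uM z)).
Qed.

(** A ratio of the masses of [U_(p,p+1)(phi)] and of the observation density, treated as in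
    [Tback_second_moment]. *)
Lemma predictive_second_moment p phi M : bounded_measurable phi ->
  (forall x, `|phi x| <= M) ->
  \int[P]_w (predictive mu m theta y (e w) p phi - eta p phi) ^+ 2 <=
  N%:R^-1 * predictive_error p M.
Proof.
have d0 := delta_gt0 reg; move=> bp pM.
have M0 : 0 <= M := le_trans (normr_ge0 _) (pM point).
case: p => [|p].
  by rewrite mulr0; under eq_Rintegral do rewrite subrr expr0n; rewrite Rintegral_prob_cst.
have bU := bm_Qsg reg p 1 bp.
have bg := bm_obs reg p.
have UM x : `|U p 1 phi x| <= delta * (1 + M).
  apply: le_trans (Qsg_norm_le reg p 1 bp pM x) _; rewrite expr1.
  by apply: ler_wpM2l; [exact: ltW|rewrite lerDr].
have gM x : `|g p x| <= delta * (1 + M).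
  rewrite gtr0_norm ?(obs_gt0 reg)//; have /andP[_ a] := obs_bounds reg p x.
  by apply: le_trans a _; rewrite ler_peMr ?lerDl// ltW.
have ratio (c a b : R) : c != 0 -> a / b = (c * a) / (c * b).
  by move=> c_0; rewrite invfM mulrACA mulfV ?mul1r.
have n0 := normalizer_gt0 reg (averaging_exact reg) p.
have nw w := normalizer_gt0 reg (avg w) p.
have eE : eta p.+1 phi = (normalizer m theta y eta p * eta p (U p 1 phi)) /
    (normalizer m theta y eta p * eta p (g p)).
  rewrite exact_flow_predictive (predictiveS_mean reg (averaging_exact reg p))//.
  by rewrite -ratio// gt_eqF.
have eN w : predictive mu m theta y (e w) p.+1 phi =
   (normalizer m theta y (e w) p * e w p (U p 1 phi)) /
    (normalizer m theta y (e w) p * e w p (g p)).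
  by rewrite (predictiveS_mean (e := e w) reg (avg w p))// -ratio// gt_eqF.
under eq_Rintegral do rewrite eN eE.
rewrite /predictive_error mulrCA.
apply: ratio_second_moment.
- exact: bm_mass.
- exact: bm_mass.
- by rewrite mulr_gt0// invr_gt0// exprn_gt0.
- by rewrite mulr_gt0//; exact: (averaging_obs_gt0 (e := eta) reg (averaging_exact reg p)).
- move=> w; have /andP[a _] := normalizer_bounds reg (avg w) p.
  have /andP[b _] := averaging_obs_bounds (e := e w) reg (avg w p).
  by apply: ler_pM => //; rewrite invr_ge0 ?exprn_ge0// ltW.
- by rewrite -eE; exact: (averaging_norm_le (averaging_exact reg p.+1)).
- exact: mass_second_moment.
- exact: mass_second_moment.
Qed.

End particle_convergence.

(** * First order expansion and central limit theorem for the particle error *)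

Section particle_expansion.
Context (R : realType) (d : nat) (dX dY : measure_display)
  (X : measurableType dX) (Y : measurableType dY).
Variables (mu : {finite_measure set X -> \bar R}) (m : densities R d X Y).
Variables (theta : 'rV[R]_d) (y : nat -> Y) (rho delta : R).
Hypothesis reg : regular_model mu m theta y rho delta.
Variables (t : nat -> X -> X -> R) (tau : R).
Hypothesis regt : regular_score t tau.

(** Error of [block_clt] for one generation; the last term bounds the discrepancy between the
    conditional and the limit variance. *)
Definition clt_bound p (M : R) : R :=
  8 * M ^+ 3 + 4 * M ^+ 4 +
  ((predictive_error delta tau p (M ^+ 2) + 1) + 2 * M * (predictive_error delta tau p M + 1)) / 2.

(** The first summand is the price of freezing [T_p], the second that of freezing the normalizer. *)
Definition freezing_bound n (M : R) p : R :=
  ((delta ^+ p) ^+ 2 * (delta ^+ 2 * rho * (delta ^+ (n - p) * M) ^+ 2 *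
     (fine (mu setT) * Tback_error rho delta tau p)) + 1) +
  (fluctuation_bound delta tau p 1 + potential_bound delta tau n M p ^+ 2).

(** One line for each source of error in [zeta_expansion]: the random normalizer, the product of the
    two centring errors, the freezing of the sampling errors. *)
Definition expansion_bound n (M : R) : R :=
  (delta ^+ n) ^+ 2 * (fluctuation_bound delta tau n M + fluctuation_bound delta tau n 1) +
  (delta ^+ n) ^+ 2 * (fluctuation_bound delta tau n M + fluctuation_bound delta tau n M) +
  delta ^+ n * \sum_(p < n.+1) freezing_bound n M p.

Definition score_mean n : R :=
  exact_flow mu m theta y n (Tback m theta y t (exact_flow mu m theta y) n).

Definition centered_test n (phi : X -> R) x : R := phi x - exact_flow mu m theta y n phi.

Definition score_covariance n (phi : X -> R) : R :=
  exact_flow mu m theta y n (fun x =>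
    (Tback m theta y t (exact_flow mu m theta y) n x - score_mean n) *
    centered_test n phi x).

(** With [u] the centered test function and [h] this offset, [S_n u + h] is [(phi - eta_n(phi)) (S_n
    - mean) - covariance], that is, [F_n - Q_n(F_n)]. *)
Definition centered_offset n (phi : X -> R) x : R :=
  - score_mean n * centered_test n phi x - score_covariance n phi.

Definition limit_potential n (phi : X -> R) p x : R :=
  normalizer m theta y (exact_flow mu m theta y) p /
  normalizer m theta y (exact_flow mu m theta y) n *
  potential mu m theta y t (exact_flow mu m theta y) n
    (centered_test n phi) (centered_offset n phi) p x.

Context (dO : measure_display) (O : measurableType dO) (P : probability O R).
Variables (N : nat) (xi : nat -> 'I_N -> {RV P >-> X}).
Hypotheses (N_gt0 : (0 < N)%N) (ps : particle_system mu m theta y xi).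
Implicit Types (u h phi psi : X -> R).
Notation q := (qdens m theta y).
Notation g k := (fun x : X => obs m theta x (y k)).
Notation U := (Qsg mu m theta y).
Notation e := (etaN xi).
Notation eta := (exact_flow mu m theta y).
Notation S p := (g_sigma_algebraType (past_generators xi p)).
Notation T w p := (Tback m theta y t (e w) p).
Notation Phi w := (potential mu m theta y t (e w)).
Notation err := (sampling_error mu m theta y xi).
Notation norm f p := (normalizer m theta y f p).
Notation sN := (Num.sqrt N%:R : R).

Let avg w p : averaging mu (e w p) := averaging_particles mu xi N_gt0 w p.

Let bm_to_O p (f : S p -> R) : bounded_measurable f -> bounded_measurable (f : O -> R) :=
  @bm_past _ _ _ _ _ _ _ xi p f.

Let NR0 : 0 < N%:R :> R. Proof. by rewrite ltr0n. Qed.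

Let sN0 : 0 < sN. Proof. by rewrite sqrtr_gt0. Qed.

Let sN2 : sN ^+ 2 = N%:R. Proof. by rewrite sqr_sqrtr// ltW. Qed.

Let d0 := delta_gt0 reg.

Lemma sampling_errorB p w phi psi : bounded_measurable phi -> bounded_measurable psi ->
  err p (fun x => phi x - psi x) w = err p phi w - err p psi w.
Proof.
move=> bp bq; rewrite /sampling_error (averagingB (avg w p))//.
have ap := averaging_predictive (e := e w) reg (avg w p.-1).
by rewrite (averagingB ap)//; ring.
Qed.

Lemma sampling_errorZ p w c phi : bounded_measurable phi ->
  err p (fun x => c * phi x) w = c * err p phi w.
Proof.
move=> bp; rewrite /sampling_error (averagingZ (avg w p))//.
have ap := averaging_predictive (e := e w) reg (avg w p.-1).
by rewrite (averagingZ ap)//; ring.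
Qed.

Let bm_err p psi : bounded_measurable psi ->
  bounded_measurable (fun w : S p.+1 => err p psi w).
Proof.
move=> bp; apply: (@bm_sampling_error _ _ _ _ _ _ mu m theta y rho delta reg _ _ _ _ xi N_gt0 p (fun z => psi z.2)).
exact: bm_comp bp measurable_snd.
Qed.

Let bm_errO p psi : bounded_measurable psi ->
  bounded_measurable (fun w : O => err p psi w).
Proof. by move=> bp; exact: bm_to_O (bm_err p bp). Qed.

Let err_second_moment p psi M : bounded_measurable psi -> (forall x, `|psi x| <= M) ->
  \int[P]_w err p psi w ^+ 2 <= N%:R^-1 * M ^+ 2.
Proof.
move=> bp pM; apply: (sampling_second_moment_le reg N_gt0 ps (f := fun z => psi z.2)) => //.
exact: bm_comp bp measurable_snd.
Qed.

Lemma sampling_error_abs p psi M : bounded_measurable psi -> (forall x, `|psi x| <= M) ->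
  \int[P]_w `|sN * err p psi w| <= M ^+ 2 + 1.
Proof.
move=> bp pM; rewrite -[leRHS]divr1; apply: abs_of_second_moment => //.
  by apply: bmZ; exact: bm_errO.
under eq_Rintegral do rewrite exprMn sN2.
rewrite bm_RintegralZ; last by apply: bmX; exact: bm_errO.
by rewrite expr1n divr1 -ler_pdivlMl//; exact: err_second_moment.
Qed.

Section iterated_clt.
Variables (chi : nat -> X -> R) (M : R).
Hypotheses (bchi : forall p, bounded_measurable (chi p))
  (chiM : forall p x, `|chi p x| <= M).

Definition asymptotic_variance p : R :=
  eta p (fun x => chi p x ^+ 2) - (eta p (chi p)) ^+ 2.

Let M0 : 0 <= M. Proof. exact: le_trans (normr_ge0 _) (chiM 0 point). Qed.

Let chi2M p x : `|chi p x ^+ 2| <= M ^+ 2.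
Proof. by rewrite normrX; apply: lerXn2r; rewrite ?nnegrE. Qed.

Lemma asymptotic_variance_bounds p : 0 <= asymptotic_variance p <= 4 * M ^+ 2.
Proof.
have avge := averaging_exact reg p; set c := eta p (chi p).
apply/andP; split; last first.
  have := averaging_norm_le avge (bmX 2 (bchi p)) (chi2M p).
  rewrite ler_norml => /andP[_]; rewrite /asymptotic_variance -/c.
  by have := sqr_ge0 c; have := sqr_ge0 M; lra.
have -> : asymptotic_variance p = eta p (fun x => (chi p x - c) ^+ 2).
  rewrite /asymptotic_variance -/c.
  have -> : (fun x => (chi p x - c) ^+ 2) = (fun x => (- (2 * c)) * chi p x + (chi p x ^+ 2 + c ^+ 2)).
    by apply/funext => x; ring.
  rewrite (averaging_lin avge)//; last by apply: bmD; [exact: bmX|exact: bm_cst].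
  rewrite (averagingD avge) ?(averaging_cst avge) -/c; [ring|exact: bmX|exact: bm_cst].
rewrite -(averaging_cst avge 0); apply: (averaging_le avge); first exact: bm_cst.
  by apply: bmX; apply: bmB => //; exact: bm_cst.
by move=> x; exact: sqr_ge0.
Qed.

(** The squared means differ by a product of their sum, at most [2 * M], and their difference, which
    [predictive_second_moment] controls. *)
Let variance_error p :
  \int[P]_w `|predictive mu m theta y (e w) p (fun x => chi p x ^+ 2) -
     predictive mu m theta y (e w) p (chi p) ^+ 2 - asymptotic_variance p| <=
  ((predictive_error delta tau p (M ^+ 2) + 1) +
    2 * M * (predictive_error delta tau p M + 1)) / sN.
Proof.
have bK psi : bounded_measurable psi -> bounded_measurable
    (fun w : O => predictive mu m theta y (e w) p psi).
  move=> bp; apply: bm_to_O.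
  apply: (bm_predictive reg N_gt0 (f := fun z : S p * X => psi z.2)).
  exact: bm_comp bp measurable_snd.
pose A w := predictive mu m theta y (e w) p (fun x => chi p x ^+ 2) -
  eta p (fun x => chi p x ^+ 2).
pose B w := predictive mu m theta y (e w) p (chi p) - eta p (chi p).
have bA : bounded_measurable A.
  by apply: bmB; [apply: bK; exact: bmX|exact: bm_cst].
have bB : bounded_measurable B by apply: bmB; [exact: bK|exact: bm_cst].
apply: (@le_trans _ _ (\int[P]_w (`|A w| + 2 * M * `|B w|))).
  apply: bm_le_Rintegral.
  - apply: bm_norm; apply: bmB; last exact: bm_cst.
    by apply: bmB; [apply: bK; exact: bmX|apply: bmX; exact: bK].
  - by apply: bmD; [exact: bm_norm|apply: bmZ; exact: bm_norm].
  move=> w; set a := predictive _ _ _ _ _ _ _; set b := predictive _ _ _ _ _ _ _.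
  have -> : a - b ^+ 2 - asymptotic_variance p = A w - (b + eta p (chi p)) * B w.
    by rewrite /asymptotic_variance /A /B -/a -/b; ring.
  apply: le_trans (ler_normB _ _) _; rewrite lerD2l normrM; apply: ler_wpM2r => //.
  apply: le_trans (ler_normD _ _) _; rewrite mulr2n mulrDl mul1r; apply: lerD.
    exact: (predictive_norm_le (e := e w) reg _ (avg w)).
  exact: (averaging_norm_le (averaging_exact reg p)).
rewrite bm_RintegralD; [|exact: bm_norm|by apply: bmZ; exact: bm_norm].
rewrite bm_RintegralZ; last exact: bm_norm.
rewrite [leRHS]mulrDl; apply: lerD.
  apply: abs_of_second_moment => //; rewrite sN2 mulrC.
  by apply: (predictive_second_moment reg regt N_gt0 ps) => //; exact: bmX.
rewrite -[leRHS]mulrA; apply: ler_wpM2l; first by rewrite mulr_ge0.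
apply: abs_of_second_moment => //; rewrite sN2 mulrC.
exact: (predictive_second_moment reg regt N_gt0 ps).
Qed.

Let phase b k (w : O) : R := b + \sum_(p < k) sN * err p (chi p) w.

Let measurable_phase b k : measurable_fun setT (phase b k : S k -> R).
Proof.
elim: k => [|k IH].
  rewrite (_ : phase b 0 = fun=> b); first exact: measurable_cst.
  by apply/funext => w; rewrite /phase big_ord0 addr0.
rewrite (_ : phase b k.+1 = fun w => phase b k w + sN * err k (chi k) w).
  apply: measurable_funD; last by apply: bm_measurable; apply: bmZ; exact: bm_err.
  exact: measurableT_comp IH (@measurable_id_past _ _ X _ O P N xi k).
by apply/funext => w; rewrite /phase big_ord_recr/= addrA.
Qed.

(** The test functions are deterministic here. The phase accumulated over the first [k] generations
    is known before generation [k] is sampled, so [sampling_clt] multiplies its cosine transform by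
    a factor at most 1, and earlier errors are not amplified. *)
Lemma iterated_clt b k :
  `|\int[P]_w cos (b + \sum_(p < k) sN * err p (chi p) w) -
    expR (- ((\sum_(p < k) asymptotic_variance p) / 2)) * cos b| <=
  (\sum_(p < k) clt_bound p M) / sN.
Proof.
elim: k => [|k IH].
  rewrite !big_ord0 mul0r oppr0 expR0 mul1r mul0r.
  under eq_Rintegral do rewrite big_ord0 addr0.
  by rewrite Rintegral_prob_cst subrr normr0.
have /andP[v0 v1] := asymptotic_variance_bounds k.
have := sampling_clt reg N_gt0 ps (bchi k) (chiM k) v0 v1 (@measurable_phase b k).
set E0 := \int[P]_w cos (phase b k w) in IH *.
set E1 := \int[P]_w cos (phase b k w + _).
have -> : \int[P]_w cos (b + \sum_(p < k.+1) sN * err p (chi p) w) = E1.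
  by apply: eq_Rintegral => w _; rewrite big_ord_recr/= addrA.
move=> H; rewrite !big_ord_recr/=.
set s := \sum_(p < k) _ in IH *; set v := asymptotic_variance k in H v0 v1 *.
have -> : - ((s + v) / 2) = - (v / 2) + - (s / 2) by ring.
rewrite expRD [leRHS]mulrDl.
have -> : E1 - expR (- (v / 2)) * expR (- (s / 2)) * cos b =
  (E1 - expR (- (v / 2)) * E0) + expR (- (v / 2)) * (E0 - expR (- (s / 2)) * cos b).
  by ring.
apply: le_trans (ler_normD _ _) _; rewrite addrC; apply: lerD.
  apply: le_trans _ IH; rewrite normrM ger0_norm ?expR_ge0//; apply: ler_piMl => //.
  by rewrite -(expR0 R) ler_expR oppr_le0 divr_ge0.
apply: le_trans H _; rewrite /clt_bound [leRHS]mulrDl lerD2l.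
rewrite mulrAC; apply: ler_wpM2r; first by rewrite invr_ge0.
exact: variance_error.
Qed.

End iterated_clt.

Section expansion.
Variables (n : nat) (M : R).
Hypothesis M1 : 1 <= M.

Let M0 : 0 <= M := le_trans ler01 M1.

(** The difference splits into the effect of the random [T_p], a sampling error of [F], and that of
    the random normalizer, a product of two errors of order [N ^ (-1/2)]. Since [F] is known from
    the past and is itself small, the second moment of its sampling error is of order [N ^ (-2)]. *)
Let freezing u h p : bounded_measurable u -> bounded_measurable h ->
  (forall x, `|u x| <= M) -> (forall x, `|h x| <= M) ->
  \int[P]_w `|sN * (norm (e w) p * err p (Phi w n u h p) w) -
     sN * err p (fun x => norm eta p * potential mu m theta y t eta n u h p x) w| <=
  freezing_bound n M p / sN.
Proof.
move=> bu bh uM hM; pose psi := potential mu m theta y t eta n u h p.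
have bpsi : bounded_measurable psi by exact: (bm_potential reg regt (averaging_exact reg)).
pose F (z : S p * X) := (T z.1 p z.2 - Tback m theta y t eta p z.2) * U p (n - p) u z.2.
have bD : bounded_measurable (fun z : S p * X => T z.1 p z.2 - Tback m theta y t eta p z.2).
  apply: bmB; first exact: (bm_particle_Tback reg regt xi N_gt0 p).
  exact: bm_comp (bm_Tback reg regt (averaging_exact reg) p) measurable_snd.
have bF : bounded_measurable F.
  by apply: bmM => //; exact: bm_comp (bm_Qsg reg _ _ bu) measurable_snd.
have bFw w : bounded_measurable (fun x => F (w, x)).
  by apply: bm_comp bF _; exact: (@pair1_measurable _ _ (S p) X).
have bn : bounded_measurable (fun w : O => norm (e w) p).
  exact: bm_to_O (bm_particle_normalizer reg xi p).
have bEF : bounded_measurable (fun w : O => err p (fun x => F (w, x)) w).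
  exact: bm_to_O (bm_sampling_error reg N_gt0 bF).
pose A w := sN * (norm (e w) p * err p (fun x => F (w, x)) w).
pose B1 w := norm (e w) p - norm eta p.
pose B2 w := err p psi w.
have bA : bounded_measurable A by apply: bmZ; exact: bmM.
have bB1 : bounded_measurable B1 by apply: bmB => //; exact: bm_cst.
have bB2 : bounded_measurable B2 by exact: bm_errO.
apply: (@le_trans _ _ (\int[P]_w (`|A w| + sN * `|B1 w * B2 w|))).
  have bP w : bounded_measurable (Phi w n u h p).
    exact: (bm_potential (e := e w) reg regt (avg w)).
  apply: bm_le_Rintegral.
  - apply: bm_norm; apply: bmB.
      apply: bmZ; apply: bmM => //.
      exact: bm_to_O (bm_sampling_error reg N_gt0 (bm_particle_potential reg regt xi N_gt0 n p bu bh)).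
    by apply: bmZ; apply: bm_errO; exact: bmZ.
  - by apply: bmD; [exact: bm_norm|apply: bmZ; apply: bm_norm; exact: bmM].
  move=> w; rewrite (sampling_errorZ p w (norm eta p) bpsi).
  have -> : Phi w n u h p = fun x => psi x - -1 * F (w, x).
    by apply/funext => x; rewrite /psi /F /potential /=; ring.
  rewrite sampling_errorB//; last exact: bmZ.
  rewrite sampling_errorZ//.
  set a := err p psi w; set b := err p _ w.
  have -> : sN * (norm (e w) p * (a - -1 * b)) - sN * (norm eta p * a) =
      A w + sN * (B1 w * B2 w).
    by rewrite /A /B1 /B2 -/a -/b; ring.
  by apply: le_trans (ler_normD _ _) _; rewrite lerD2l normrM (gtr0_norm sN0).
rewrite bm_RintegralD; [|exact: bm_norm|by apply: bmZ; apply: bm_norm; exact: bmM].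
rewrite bm_RintegralZ; last by apply: bm_norm; exact: bmM.
rewrite /freezing_bound [leRHS]mulrDl; apply: lerD; last first.
  have -> : forall c, c / sN = sN * (c / N%:R).
    by move=> c; rewrite -[X in _ = _ * (_ / X)]sN2; field; rewrite gt_eqF.
  apply: ler_wpM2l; first exact: ltW.
  apply: abs_mul_of_second_moments => //; rewrite mulrC.
    exact: (normalizer_second_moment reg regt N_gt0 ps).
  apply: err_second_moment => // x.
  exact: (@potential_norm_le _ _ _ _ _ _ _ _ _ _ _ _ reg _ _ regt eta n u h M p x (averaging_exact reg)).
apply: abs_of_second_moment => //; rewrite sN2.
apply: (@le_trans _ _ (\int[P]_w (N%:R * (delta ^+ p) ^+ 2 * err p (fun x => F (w, x)) w ^+ 2))).
  apply: bm_le_Rintegral; [exact: bmX|by apply: bmZ; exact: bmX|].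
  move=> w; rewrite /A !exprMn sN2 mulrA; apply: ler_wpM2r; first exact: sqr_ge0.
  apply: ler_wpM2l; first exact: ltW.
  have /andP[_ a] := normalizer_bounds reg (avg w) p.
  by apply: lerXn2r => //; rewrite nnegrE ?exprn_ge0// ltW// (normalizer_gt0 reg (avg w)).
rewrite bm_RintegralZ; last exact: bmX.
have assoc (c D K I : R) : 0 <= D -> c * I <= K / c -> c * D * I <= D * K / c.
  move=> D0 H; have -> : c * D * I = D * (c * I) by ring.
  by rewrite -mulrA; exact: ler_wpM2l.
apply: assoc; first exact: sqr_ge0.
rewrite -ler_pdivlMl//; apply: le_trans (sampling_second_moment reg N_gt0 ps bF) _.
rewrite ler_pM2l ?invr_gt0//.
(* For [p = 0] the backward statistic is exact and [F] vanishes. For [p > 0] the predictive density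
   is bounded, so the prediction of [F ^ 2] is controlled by an integral against [mu]. *)
clear A B1 B2 bA bB1 bB2 psi bpsi bEF bn; case: p @F bF bD bFw => [|p] F bF bD bFw.
  rewrite (_ : \int[P]_w _ = 0); last first.
    rewrite -[RHS](Rintegral_prob_cst P); apply: eq_Rintegral => w _.
    rewrite -[RHS](averaging_cst (averaging_predictive (e := e w) (p := 0) reg (avg w 0)) 0).
    congr (predictive _ _ _ _ _ _ _); apply/funext => x.
    by rewrite /F /= subrr mul0r expr0n.
  by rewrite !mulr0.
pose c := delta ^+ 2 * rho * (delta ^+ (n - p.+1) * M) ^+ 2.
have c0 : 0 <= c.
  by apply: mulr_ge0; [apply: mulr_ge0; [exact: sqr_ge0|exact: ltW (rho_gt0 reg)]|exact: sqr_ge0].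
pose D (z : S p.+1 * X) := (T z.1 p.+1 z.2 - Tback m theta y t eta p.+1 z.2) ^+ 2.
have bD2 : bounded_measurable D by exact: bmX.
have bDO : bounded_measurable (fun z : O * X => D z).
  have mid : measurable_fun setT (fun z : O * X => (z.1 : S p.+1, z.2)).
    apply: measurable_fun_pair; last exact: measurable_snd.
    have mi := measurable_id_g_sigma (@past_generators_measurable _ _ X _ O P N xi p.+1).
    exact: measurableT_comp mi (@measurable_fst _ _ O X).
  rewrite (_ : (fun z : O * X => D z) = fun z : O * X => D (z.1, z.2)).
    exact: bm_comp bD2 mid.
  by apply/funext => -[].
have bDw w : bounded_measurable (fun x => D (w, x)).
  by apply: bm_comp bD2 _; exact: (@pair1_measurable _ _ (S p.+1) X).
apply: (@le_trans _ _ (\int[P]_w (c * \int[mu]_x D (w, x)))).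
  apply: bm_le_Rintegral.
  - exact: bm_to_O (bm_predictive reg N_gt0 (bmX 2 bF)).
  - by apply: bmZ; exact: (bm_Rintegral_snd mu bDO).
  move=> w; rewrite -bm_RintegralZ//.
  apply: bm_le_Rintegral; [|exact: bmZ|move=> x].
    apply: bmM; last exact: bmX.
    by apply: bmM; [exact: (bm_averaging_qdens (e := e w) reg (avg w p))|exact: bm_cst].
  rewrite /F exprMn mulrCA (mulrC c) -/(D (w, x)); apply: ler_wpM2l; first exact: sqr_ge0.
  apply: ler_pM; rewrite ?sqr_ge0//.
  - rewrite -particle_densityS//; exact: (particle_density_ge0 reg xi N_gt0 p.+1).
  - by rewrite -particle_densityS//; exact: (particle_density_le reg xi N_gt0 p).
  - rewrite -(real_normK (num_real (Qsg _ _ _ _ _ _ _ _))); apply: lerXn2r.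
    + by rewrite nnegrE.
    + by rewrite nnegrE mulr_ge0// exprn_ge0// ltW.
    + exact: (Qsg_norm_le reg).
rewrite bm_RintegralZ; last exact: (bm_Rintegral_snd mu bDO).
rewrite -mulrA; apply: ler_wpM2l => //.
have i1 : P.-integrable setT (EFin \o (fun=> 1 : R)) by apply: bm_integrable; exact: bm_cst.
(* The error of [T] is bounded in mean square at each fixed [x], so the expectation has to be taken
   inside the integral over [x]. *)
have := weighted_fubini mu i1 (fun=> ler01) bDO.
under eq_Rintegral do rewrite mul1r.
under [X in _ = X -> _]eq_Rintegral do under eq_Rintegral do rewrite mul1r.
move=> ->.
apply: (@le_trans _ _ (\int[mu]_x (N%:R^-1 * Tback_error rho delta tau p.+1))).
  apply: bm_le_Rintegral.
  - have bDs : bounded_measurable (fun z : X * O => D (z.2, z.1)).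
      apply: (@bm_comp _ _ (X * O)%type (O * X)%type R (fun z => D z) (fun z => (z.2, z.1)) bDO).
      by apply: measurable_fun_pair; [exact: measurable_snd|exact: measurable_fst].
    exact: (bm_Rintegral_snd P bDs).
  - exact: bm_cst.
  by move=> x; exact: (Tback_second_moment reg regt N_gt0 ps).
rewrite Rintegral_cst// le_eqVlt; apply/orP; left; apply/eqP; ring.
Qed.

Let bm_potential_eta u h p : bounded_measurable u -> bounded_measurable h ->
  bounded_measurable (potential mu m theta y t eta n u h p).
Proof. by move=> bu bh; exact: (bm_potential reg regt (averaging_exact reg)). Qed.

Let bm_errPhi u h p : bounded_measurable u -> bounded_measurable h ->
  bounded_measurable (fun w : O => norm (e w) p * err p (Phi w n u h p) w).
Proof.
move=> bu bh; apply: bmM; first exact: bm_to_O (bm_particle_normalizer reg xi p).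
exact: bm_to_O (bm_sampling_error reg N_gt0 (bm_particle_potential reg regt xi N_gt0 n p bu bh)).
Qed.

Lemma particle_flow_expansion u h : bounded_measurable u -> bounded_measurable h ->
  (forall x, `|u x| <= M) -> (forall x, `|h x| <= M) ->
  initial_mean mu m theta y t n u h = 0 ->
  \int[P]_w `|sN * particle_flow m theta y t xi n u h w -
    \sum_(p < n.+1) sN * err p (fun x => norm eta p * potential mu m theta y t eta n u h p x) w| <=
  (\sum_(p < n.+1) freezing_bound n M p) / sN.
Proof.
move=> bu bh uM hM G0.
pose D p w := sN * (norm (e w) p * err p (Phi w n u h p) w) -
     sN * err p (fun x => norm eta p * potential mu m theta y t eta n u h p x) w.
have bD p : bounded_measurable (D p).
  apply: bmB; first by apply: bmZ; exact: bm_errPhi.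
  by apply: bmZ; apply: bm_errO; apply: bmZ; exact: bm_potential_eta.
have E w : sN * particle_flow m theta y t xi n u h w -
    \sum_(p < n.+1) sN * err p (fun x => norm eta p * potential mu m theta y t eta n u h p x) w =
    \sum_(p < n.+1) D p w.
  rewrite sumrB; congr (_ - _); rewrite -mulr_sumr; congr (_ * _).
  by rewrite -(particle_flow_telescope reg regt xi N_gt0 n w bu bh)// G0 subr0.
under eq_Rintegral do rewrite E.
apply: (@le_trans _ _ (\int[P]_w (\sum_(p < n.+1) `|D p w|))).
  apply: bm_le_Rintegral; first by apply: bm_norm; exact: bm_sum.
    by apply: bm_sum => p; exact: bm_norm.
  by move=> w; exact: ler_norm_sum.
rewrite bm_Rintegral_sum; last by move=> p; exact: bm_norm.
by rewrite mulr_suml; apply: ler_sum => p _; exact: freezing.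
Qed.

Section test_function.
Variable phi : X -> R.
Hypothesis bphi : bounded_measurable phi.
Hypotheses (uM : forall x, `|centered_test n phi x| <= M)
  (hM : forall x, `|centered_offset n phi x| <= M) (sM : `|score_mean n| <= M).

Let avge p : averaging mu (eta p) := averaging_exact reg p.

Let bT : bounded_measurable (Tback m theta y t eta n).
Proof. exact: (bm_Tback reg regt (averaging_exact reg)). Qed.

Let bu : bounded_measurable (centered_test n phi).
Proof. by apply: bmB => //; exact: bm_cst. Qed.

Let bh : bounded_measurable (centered_offset n phi).
Proof. by apply: bmB; [exact: bmZ|exact: bm_cst]. Qed.

Let bc (c : R) : bounded_measurable (fun _ : X => c).
Proof. exact: bm_cst. Qed.

Let eta_u : eta n (centered_test n phi) = 0.
Proof. by rewrite (averagingB (avge n))// (averaging_cst (avge n)) subrr. Qed.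

Lemma initial_mean_centered : initial_mean mu m theta y t n (centered_test n phi) (centered_offset n phi) = 0.
Proof.
rewrite -(exact_flow_mean reg regt)//.
rewrite (_ : (fun x => _) = (fun x => (Tback m theta y t eta n x - score_mean n) *
    centered_test n phi x - score_covariance n phi)); last first.
  by apply/funext => x; rewrite /centered_offset; ring.
rewrite (averagingB (avge n))//; last by apply: bmM => //; exact: bmB.
by rewrite (averaging_cst (avge n)) subrr mulr0.
Qed.

Let mean_score0 : initial_mean mu m theta y t n (fun=> 1) (fun=> - score_mean n) = 0.
Proof.
rewrite -(exact_flow_mean reg regt)//.
rewrite (_ : (fun x => _) = (fun x => Tback m theta y t eta n x - score_mean n)); last first.
  by apply/funext => x; rewrite mulr1.
by rewrite (averagingB (avge n))// (averaging_cst (avge n)) subrr mulr0.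
Qed.

Let mean_test0 : initial_mean mu m theta y t n (fun=> 0) (centered_test n phi) = 0.
Proof. by rewrite (exact_flow_mass reg regt)// eta_u mulr0. Qed.

(** The flows of the centered product, of the centered additive functional and of the centered test
    function. All three have exact mean zero, hence are of order [N ^ (-1/2)] in L2. *)
Let W := particle_flow m theta y t xi n (centered_test n phi) (centered_offset n phi).
Let Wa := particle_flow m theta y t xi n (fun=> 1) (fun=> - score_mean n).
Let Wb := particle_flow m theta y t xi n (fun=> 0) (centered_test n phi).

Let bW : bounded_measurable W. Proof. exact: (bm_particle_flow reg regt xi N_gt0 n). Qed.
Let bWa : bounded_measurable Wa. Proof. exact: (bm_particle_flow reg regt xi N_gt0 n). Qed.
Let bWb : bounded_measurable Wb. Proof. exact: (bm_particle_flow reg regt xi N_gt0 n). Qed.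

Let W2 : \int[P]_w W w ^+ 2 <= fluctuation_bound delta tau n M / N%:R.
Proof.
have := particle_fluctuation reg regt N_gt0 ps n bu bh uM hM.
by under eq_Rintegral do rewrite initial_mean_centered subr0; rewrite mulrC.
Qed.

Let Wa2 : \int[P]_w Wa w ^+ 2 <= fluctuation_bound delta tau n M / N%:R.
Proof.
have h1 (x : X) : `|1 : R| <= M by rewrite normr1.
have h2 (x : X) : `|- score_mean n| <= M by rewrite normrN.
have := particle_fluctuation reg regt N_gt0 ps n (bc 1) (bc (- score_mean n)) h1 h2.
by under eq_Rintegral do rewrite mean_score0 subr0; rewrite mulrC.
Qed.

Let Wb2 : \int[P]_w Wb w ^+ 2 <= fluctuation_bound delta tau n M / N%:R.
Proof.
have h1 (x : X) : `|0 : R| <= M by rewrite normr0.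
have := particle_fluctuation reg regt N_gt0 ps n (bc 0) bu h1 uM.
by under eq_Rintegral do rewrite mean_test0 subr0; rewrite mulrC.
Qed.

Let zN w := e w n (fun x => T w n x * phi x) - e w n phi * e w n (T w n) -
  score_covariance n phi.

(** An exact identity: centring at the empirical means instead of the exact ones subtracts the
    product of the errors of the two means. *)
Let zNE w : zN w = W w / norm (e w) n - (Wa w / norm (e w) n) * (Wb w / norm (e w) n).
Proof.
have n0 : norm (e w) n != 0 by rewrite gt_eqF// (normalizer_gt0 reg (avg w)).
have K (f : X -> R) : norm (e w) n * e w n f / norm (e w) n = e w n f.
  by rewrite mulrAC mulfV// mul1r.
rewrite /W /Wa /Wb /particle_flow !K {K}.
have bTw : bounded_measurable (T w n) by exact: (bm_Tback (e := e w) reg regt (avg w)).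
set s := score_mean n; set b := eta n phi; set c := score_covariance n phi.
rewrite (_ : (fun x => T w n x * centered_test n phi x + centered_offset n phi x) =
  (fun x => (- b) * T w n x + ((- s) * phi x + (T w n x * phi x + (s * b - c))))); last first.
  by apply/funext => x; rewrite /centered_offset /centered_test -/b -/s -/c; ring.
rewrite (_ : (fun x => T w n x * 1 + - s) = (fun x => T w n x - s)); last first.
  by apply/funext => x; rewrite mulr1.
rewrite (_ : (fun x => T w n x * 0 + centered_test n phi x) = (fun x => phi x - b)); last first.
  by apply/funext => x; rewrite mulr0 add0r.
have b1 : bounded_measurable (fun x => T w n x * phi x) by exact: bmM.
have b2 : bounded_measurable (fun x => T w n x * phi x + (s * b - c)) by exact: bmD.
have b3 : bounded_measurable (fun x => (- s) * phi x + (T w n x * phi x + (s * b - c))).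
  by apply: bmD => //; exact: bmZ.
rewrite (averaging_lin (avg w n) _ bTw b3) (averaging_lin (avg w n) _ bphi b2).
rewrite (averagingD (avg w n) b1 (bc _)) (averagingB (avg w n) bTw (bc _)).
rewrite (averagingB (avg w n) bphi (bc _)) !(averaging_cst (avg w n)) /zN -/c.
move: (e w n _) (e w n _) (e w n _) => x1 x2 x3; ring.
Qed.

Let nV w : 0 < (norm (e w) n)^-1 <= delta ^+ n.
Proof.
have n0 := normalizer_gt0 reg (avg w) n.
rewrite invr_gt0 n0 /= -[leRHS]invrK lef_pV2 ?posrE ?invr_gt0 ?exprn_gt0//.
by have /andP[] := normalizer_bounds reg (avg w) n.
Qed.

Let nVe : 0 < (norm eta n)^-1 <= delta ^+ n.
Proof.
have n0 := normalizer_gt0 reg avge n.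
rewrite invr_gt0 n0 /= -[leRHS]invrK lef_pV2 ?posrE ?invr_gt0 ?exprn_gt0//.
by have /andP[] := normalizer_bounds reg avge n.
Qed.

Lemma zeta_expansion :
  \int[P]_w `|sN * (e w n (fun x => T w n x * phi x) - e w n phi * e w n (T w n) -
      score_covariance n phi) -
    \sum_(p < n.+1) sN * err p (limit_potential n phi p) w| <=
  expansion_bound n M / sN.
Proof.
pose B w := norm (e w) n - norm eta n.
pose L w := sN * W w - \sum_(p < n.+1) sN * err p (fun x => norm eta p *
   potential mu m theta y t eta n (centered_test n phi) (centered_offset n phi) p x) w.
have bn : bounded_measurable (fun w : O => norm (e w) n).
  exact: bm_to_O (bm_particle_normalizer reg xi n).
have bB : bounded_measurable B by apply: bmB => //; exact: bm_cst.
have bP p := bm_potential_eta p bu bh.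
have bL : bounded_measurable L.
  apply: bmB; first exact: bmZ.
  by apply: bm_sum => p; apply: bmZ; apply: bm_errO; exact: bmZ.
have bl p : bounded_measurable (limit_potential n phi p) by apply: bmZ; exact: bP.
have dn0 : 0 <= delta ^+ n by rewrite exprn_ge0// ltW.
have bzN : bounded_measurable zN.
  rewrite (_ : zN = fun w => W w / norm (e w) n - (Wa w / norm (e w) n) * (Wb w / norm (e w) n)); last first.
    by apply/funext => w; exact: zNE.
  have bd A : bounded_measurable A -> bounded_measurable (fun w => A w / norm (e w) n).
    move=> bA; apply: (bm_div (b := (delta ^+ n)^-1) bA (bm_measurable bn)).
      by rewrite invr_gt0 exprn_gt0.
    by move=> w; have /andP[] := normalizer_bounds reg (avg w) n.
  by apply: bmB; [exact: bd|apply: bmM; exact: bd].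
pose R1 w := (delta ^+ n) ^+ 2 * (sN * `|W w * B w|).
pose R2 w := (delta ^+ n) ^+ 2 * (sN * `|Wa w * Wb w|).
pose R3 w := delta ^+ n * `|L w|.
have bR1 : bounded_measurable R1 by apply: (@bmZ _ O R ((delta ^+ n) ^+ 2)); apply: (@bmZ _ O R sN); apply: bm_norm; exact: bmM.
have bR2 : bounded_measurable R2 by apply: (@bmZ _ O R ((delta ^+ n) ^+ 2)); apply: (@bmZ _ O R sN); apply: bm_norm; exact: bmM.
have bR3 : bounded_measurable R3 by apply: (@bmZ _ O R (delta ^+ n)); exact: bm_norm.
apply: (@le_trans _ _ (\int[P]_w (R1 w + R2 w + R3 w))).
  apply: bm_le_Rintegral.
  - apply: bm_norm; apply: bmB; first exact: (@bmZ _ O R sN _ bzN).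
    by apply: bm_sum => p; apply: bmZ; exact: bm_errO.
  - by apply: bmD => //; exact: bmD.
  move=> w; have /andP[v0 vd] := nV w; have /andP[ve0 ved] := nVe.
  set v := (norm (e w) n)^-1 in v0 vd; set ve := (norm eta n)^-1 in ve0 ved.
  have vn : v * norm (e w) n = 1 by rewrite /v mulVf// gt_eqF// (normalizer_gt0 reg (avg w)).
  have ven : ve * norm eta n = 1 by rewrite /ve mulVf// gt_eqF// (normalizer_gt0 reg avge).
  (* Passing to the exact normalizer, [v W = ve W - v ve W B], leaves the linear term and a product
     of two small quantities. *)
  have -> : sN * zN w - \sum_(p < n.+1) sN * err p (limit_potential n phi p) w =
     - (v * ve) * (sN * (W w * B w)) - v ^+ 2 * (sN * (Wa w * Wb w)) + ve * L w.
    have -> : \sum_(p < n.+1) sN * err p (limit_potential n phi p) w = ve * (sN * W w - L w).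
      rewrite /L subKr mulr_sumr; apply: eq_bigr => p _.
      rewrite (_ : limit_potential n phi p = fun x => ve * (norm eta p * potential mu m theta y t eta n
        (centered_test n phi) (centered_offset n phi) p x)); last first.
        by apply/funext => x; rewrite /limit_potential /ve; ring.
      have bq : bounded_measurable (fun x => norm eta p * potential mu m theta y t eta n
          (centered_test n phi) (centered_offset n phi) p x) by apply: bmZ; exact: bP.
      by rewrite (sampling_errorZ p w ve bq) mulrCA.
    rewrite zNE -/v.
    have -> : - (v * ve) * (sN * (W w * B w)) =
       - (ve * (v * norm (e w) n) - v * (ve * norm eta n)) * (sN * W w) by rewrite /B; ring.
    rewrite vn ven; ring.
  have H (a c z : R) : `|a| <= c -> `|a * z| <= c * `|z|.
    by move=> ac; rewrite normrM; apply: ler_wpM2r.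
  have zs (z : R) : `|sN * z| = sN * `|z| by rewrite normrM (gtr0_norm sN0).
  apply: le_trans (ler_normD _ _) _; apply: lerD; last first.
    by apply: H; rewrite gtr0_norm.
  apply: le_trans (ler_normB _ _) _; apply: lerD; rewrite /R1 /R2 -zs; apply: H.
    rewrite normrN normrM (gtr0_norm v0) (gtr0_norm ve0) expr2.
    by apply: ler_pM => //; exact: ltW.
  by rewrite normrX (gtr0_norm v0); apply: lerXn2r => //; rewrite nnegrE ltW.
have s_N (c : R) : c / sN = sN * (c / N%:R).
  by rewrite -[X in _ = _ * (_ / X)]sN2; field; rewrite gt_eqF.
rewrite bm_RintegralD//; last exact: bmD.
rewrite bm_RintegralD// /expansion_bound !mulrDl; apply: lerD; first apply: lerD.
- rewrite bm_RintegralZ; last by apply: bmZ; apply: bm_norm; exact: bmM.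
  rewrite -[leRHS]mulrA; apply: ler_wpM2l; first exact: sqr_ge0.
  rewrite bm_RintegralZ; last by apply: bm_norm; exact: bmM.
  rewrite s_N; apply: ler_wpM2l; first exact: ltW.
  apply: abs_mul_of_second_moments => //.
  by rewrite mulrC; exact: (normalizer_second_moment reg regt N_gt0 ps).
- rewrite bm_RintegralZ; last by apply: bmZ; apply: bm_norm; exact: bmM.
  rewrite -[leRHS]mulrA; apply: ler_wpM2l; first exact: sqr_ge0.
  rewrite bm_RintegralZ; last by apply: bm_norm; exact: bmM.
  rewrite s_N; apply: ler_wpM2l; first exact: ltW.
  exact: abs_mul_of_second_moments.
rewrite bm_RintegralZ; last exact: bm_norm.
rewrite -[leRHS]mulrA; apply: ler_wpM2l => //.
exact: (particle_flow_expansion bu bh uM hM initial_mean_centered).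
Qed.

End test_function.

End expansion.

End particle_expansion.

(** * Path measures and backward kernels *)

Section path_functionals.
Context (R : realType) (d : nat) (dX dY : measure_display)
  (X : measurableType dX) (Y : measurableType dY).
Variables (mu : {finite_measure set X -> \bar R}) (m : densities R d X Y).
Variables (theta : 'rV[R]_d) (y : nat -> Y) (rho delta : R).
Hypothesis reg : regular_model mu m theta y rho delta.
Variables (t : nat -> X -> X -> R) (tau : R).
Hypothesis regt : regular_score t tau.
Implicit Types (u h phi psi : X -> R) (e : nat -> (X -> R) -> R).
Notation q := (qdens m theta y).
Notation U := (Qsg mu m theta y).
Notation H := (Hsg mu m theta y t).
Notation eta := (exact_flow mu m theta y).
Notation norm f p := (normalizer m theta y f p).

Definition additive_functional k x : R := \sum_(i < k.+1) t i (x i.-1) (x i).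
Notation A := additive_functional.

Lemma additive_functionalS k x : A k.+1 x = A k x + t k.+1 (x k) (x k.+1).
Proof. by rewrite /A big_ord_recr. Qed.

Lemma additive_functional_upd k j x z : (k < j)%N -> A k (upd_coord x j z) = A k x.
Proof.
move=> kj; apply: eq_bigr => i _; rewrite /upd_coord.
have ij : (i < j)%N by apply: leq_trans (ltn_ord i) kj.
by rewrite !ltn_eqF//; exact: leq_ltn_trans (leq_pred i) ij.
Qed.

(** The coordinates up to [k] are not integrated, so the part [A k] of the additive functional
    factors out; the later increments are collected by [Hsg]. *)
Lemma fwd_additive l k u h x : bounded_measurable u -> bounded_measurable h ->
  fwd mu m theta y k l (fun x => A (k + l) x * u (x (k + l)%N) + h (x (k + l)%N)) x =
  A k x * U k l u (x k) + H k l u h (x k).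
Proof.
move=> bu bh; elim: l k x => [|l IH] k x /=; first by rewrite addn0.
have bU := bm_Qsg reg k.+1 l bu; have bH := bm_Hsg reg regt k.+1 l bu bh.
have bq := bm_qdens_from reg k (x k).
rewrite -bm_RintegralZ; last exact: bmM.
rewrite -bm_RintegralD; first last.
- apply: bmM => //; apply: bmD => //; apply: bmM => //; exact: (bm_score_from regt).
- by apply: bmZ; exact: bmM.
apply: eq_Rintegral => z _; rewrite -addSnnS IH additive_functionalS.
rewrite additive_functional_upd// /upd_coord eqxx ltn_eqF//; ring.
Qed.

Lemma unnormalized_path_additive n u h : bounded_measurable u -> bounded_measurable h ->
  unnormalized_path mu m theta y n (fun x => A n x * u (x n) + h (x n)) =
  initial_mean mu m theta y t n u h.
Proof.
move=> bu bh; apply: eq_Rintegral => z _.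
rewrite (_ : (fun x => _) = fun x => A (0 + n) x * u (x (0 + n)%N) + h (x (0 + n)%N)) //.
by rewrite fwd_additive// /A big_ord1.
Qed.

Let b1 : bounded_measurable (fun _ : X => 1 : R). Proof. exact: bm_cst. Qed.
Let b0 : bounded_measurable (fun _ : X => 0 : R). Proof. exact: bm_cst. Qed.

Lemma unnormalized_path_cst n : unnormalized_path mu m theta y n (fun=> 1) = norm eta n.
Proof.
rewrite (_ : (fun=> 1) = fun x => A n x * (fun=> 0) (x n) + (fun=> 1) (x n)); last first.
  by apply/funext => x; rewrite mulr0 add0r.
rewrite (unnormalized_path_additive n b0 b1) (exact_flow_mass reg regt)//.
by rewrite (averaging_cst (averaging_exact reg n)) mulr1.
Qed.

Lemma Qpath_additive n u h : bounded_measurable u -> bounded_measurable h ->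
  Qpath mu m theta y n (fun x => A n x * u (x n) + h (x n)) =
  eta n (fun z => Tback m theta y t eta n z * u z + h z).
Proof.
move=> bu bh; rewrite /Qpath unnormalized_path_additive// unnormalized_path_cst.
rewrite -(exact_flow_mean reg regt)// mulrAC mulfV ?mul1r//.
by rewrite gt_eqF// (normalizer_gt0 reg (averaging_exact reg)).
Qed.

Lemma eta_flowE n phi : bounded_measurable phi -> eta_flow mu m theta y n phi = eta n phi.
Proof.
move=> bp; rewrite /eta_flow.
rewrite (_ : (fun x => _) = fun x => A n x * (fun=> 0) (x n) + phi (x n)); last first.
  by apply/funext => x; rewrite mulr0 add0r.
rewrite (Qpath_additive n b0 bp); congr (eta n _).
by apply/funext => x; rewrite mulr0 add0r.
Qed.

(** [eta_flow] is identified with [exact_flow] on bounded measurable functions only, so each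
    property is transported separately. *)
Lemma averaging_eta_flow n : averaging mu (eta_flow mu m theta y n).
Proof.
have avg := averaging_exact reg n; have E phi := @eta_flowE n phi.
split.
- move=> a phi psi bp bq; rewrite !E//; first exact: (averaging_lin avg).
  by apply: bmD => //; exact: bmZ.
- by move=> phi psi bp bq le; rewrite !E//; exact: (averaging_le avg).
- by move=> c; rewrite E ?(averaging_cst avg)//; exact: bm_cst.
- move=> F bF; rewrite (_ : (fun z => eta_flow mu m theta y n (fun v => F (v, z))) =
    fun z => eta n (fun v => F (v, z))).
    exact: (averaging_bm avg).
  by apply/funext => z; rewrite E//; apply: bm_comp bF _; exact: pair2_measurable.
- move=> F bF; rewrite E; last exact: bm_Rintegral_snd.
  rewrite -(averaging_fubini avg bF); apply: eq_Rintegral => z _.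
  by rewrite E//; apply: bm_comp bF _; exact: pair2_measurable.
Qed.

Lemma Tback_eta_flow p : Tback m theta y t (eta_flow mu m theta y) p = Tback m theta y t eta p.
Proof.
elim: p => [//|p IH]; apply/funext => z; rewrite /= /backward_kernel IH.
have bq := bm_qdens_to reg p z.
rewrite !eta_flowE//; apply: bmM => //; apply: bmD; last exact: (bm_score_to regt).
exact: (bm_Tback reg regt (averaging_exact reg)).
Qed.

Section backward.
Variable e : nat -> (X -> R) -> R.
Hypothesis avg : forall p, averaging mu (e p).

Lemma backward_kernel_affine k z phi (a b : R) : bounded_measurable phi ->
  backward_kernel m theta y e k z (fun x => phi x * a + b) =
  backward_kernel m theta y e k z phi * a + b.
Proof.
move=> bp; have bq := bm_qdens_to reg k z.
rewrite /backward_kernel.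
rewrite (_ : (fun x => _) = (fun x => a * (q k x z * phi x) + b * q k x z)); last first.
  by apply/funext => x; ring.
rewrite (averaging_lin (avg k) _ (bmM bq bp) (bmZ b bq)) (averagingZ (avg k) _ bq).
have q0 : e k (fun x => q k x z) != 0.
  by rewrite gt_eqF// (averaging_qdens_gt0 reg (avg k)).
by move: q0; move: (e k _) (e k _) => A B B0; field.
Qed.

(** Such functions do not read the coordinates that [bwd] integrates out, and act as constants
    there. *)
Definition invariant_before k (a : (nat -> X) -> R) :=
  forall x j z, (j < k)%N -> a (upd_coord x j z) = a x.

Lemma bwd_additive k (a b : (nat -> X) -> R) x :
  invariant_before k a -> invariant_before k b ->
  bwd m theta y e k (fun x => A k x * a x + b x) x =
  Tback m theta y t e k (x k) * a x + b x.
Proof.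
elim: k a b x => [|k IH] a b x ia ib /=.
  by rewrite /A big_ord1.
rewrite -backward_kernel_affine; last first.
  apply: bmD; last exact: (bm_score_to regt).
  exact: (bm_Tback reg regt avg).
congr (backward_kernel _ _ _ _ _ _ _); apply/funext => z.
rewrite (_ : (fun x => _) = fun x => A k x * a x + (t k.+1 (x k) (x k.+1) * a x + b x)); last first.
  by apply/funext => x'; rewrite additive_functionalS; ring.
rewrite IH; first last.
- move=> x' j z' jk; rewrite ia ?ib ?(ltnW jk)// ?ltnS ?(ltnW jk)//.
  by rewrite /upd_coord !gtn_eqF//; exact: ltnW.
- by move=> x' j z' jk; rewrite ia// ltnW.
rewrite ia// ib// /upd_coord eqxx gtn_eqF//; ring.
Qed.

Lemma Qpath_backward_additive n u h :
  Qpath_backward m theta y e n (fun x => A n x * u (x n) + h (x n)) =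
  e n (fun z => Tback m theta y t e n z * u z + h z).
Proof.
rewrite /Qpath_backward; congr (e n _); apply/funext => z.
rewrite (bwd_additive (a := fun x => u (x n)) (b := fun x => h (x n)))//.
  by move=> x j z' jn; rewrite /upd_coord gtn_eqF.
by move=> x j z' jn; rewrite /upd_coord gtn_eqF.
Qed.

End backward.

Lemma Dop_additive k n u h z : (k <= n)%N -> bounded_measurable u -> bounded_measurable h ->
  Dop mu m theta y k n (fun x => A n x * u (x n) + h (x n)) z =
  potential mu m theta y t eta n u h k z.
Proof.
move=> kn bu bh; rewrite /Dop.
rewrite (_ : fwd _ _ _ _ _ _ _ = fun x => A k x * U k (n - k) u (x k) + H k (n - k) u h (x k)); last first.
  apply/funext => x; rewrite -fwd_additive// subnKC//.
rewrite (bwd_additive averaging_eta_flow (a := fun x => U k (n - k) u (x k))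
  (b := fun x => H k (n - k) u h (x k))).
- by rewrite Tback_eta_flow.
- by move=> x j z' jn; rewrite /upd_coord gtn_eqF.
- by move=> x j z' jn; rewrite /upd_coord gtn_eqF.
Qed.

Lemma Qsg0 k l x : U k l (fun=> 0) x = 0.
Proof.
elim: l k x => [//|l IH] k x /=.
by under eq_Rintegral do rewrite IH mulr0; rewrite Rintegral_cst// mul0r.
Qed.

Lemma Hsg_mass k l h : H k l (fun=> 0) h = U k l h.
Proof.
elim: l k => [//|l IH] k; apply/funext => x /=; apply: eq_Rintegral => z _.
by rewrite Qsg0 mulr0 addr0 IH.
Qed.

Lemma Qsg_lower k l u c : bounded_measurable u -> 0 <= c -> (forall x, c <= u x) ->
  forall x, (delta ^+ l)^-1 * c <= U k l u x.
Proof.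
move=> bu c0 cu; have d0 := delta_gt0 reg.
elim: l k => [|l IH] k x /=; first by rewrite expr0 invr1 mul1r.
have bq := bm_qdens_from reg k x.
apply: (@le_trans _ _ (\int[mu]_z ((delta ^+ l)^-1 * c * q k x z))).
  rewrite bm_RintegralZ// (qdens_integral reg) exprS invfM -mulrA mulrC.
  apply: ler_wpM2l; first by rewrite mulr_ge0// invr_ge0 exprn_ge0// ltW.
  by have /andP[] := obs_bounds reg k x.
apply: bm_le_Rintegral; [exact: bmZ|by apply: bmM => //; exact: (bm_Qsg reg)|].
move=> z; rewrite mulrC; apply: ler_wpM2l; first by rewrite ltW// (qdens_gt0 reg).
exact: IH.
Qed.

(** The exact flow is its own prediction, so [predictive_potential] makes the left-hand side
    independent of [p]. *)
Lemma exact_flow_potential n u h p : (p <= n)%N ->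
  bounded_measurable u -> bounded_measurable h ->
  norm eta p * eta p (potential mu m theta y t eta n u h p) =
  initial_mean mu m theta y t n u h.
Proof.
move=> + bu bh; elim: p => [_|p IH pn].
  by rewrite /normalizer big_ord0 mul1r -(initial_meanE mu m theta y t eta) -exact_flow_predictive.
rewrite [eta p.+1]exact_flow_predictive (predictive_potential reg regt (averaging_exact reg))//.
by rewrite IH// ltnW.
Qed.

Lemma eta_Qsg_one n p : (p <= n)%N ->
  eta p (U p (n - p) (fun=> 1)) = norm eta n / norm eta p.
Proof.
move=> pn; have n0 := normalizer_gt0 reg (averaging_exact reg) p.
have := exact_flow_potential pn b0 b1.
rewrite (exact_flow_mass reg regt n b1) (averaging_cst (averaging_exact reg n)) mulr1 => <-.
rewrite mulrAC mulfV ?gt_eqF// mul1r; congr (eta p _); apply/funext => x.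
rewrite /potential Hsg_mass -[LHS]add0r; congr (_ + _).
by rewrite Qsg0 mulr0.
Qed.

Section test_function.
Variables (n : nat) (phi : X -> R).
Hypothesis bphi : bounded_measurable phi.

Let avge p : averaging mu (eta p) := averaging_exact reg p.
Let bT : bounded_measurable (Tback m theta y t eta n).
Proof. exact: (bm_Tback reg regt (averaging_exact reg)). Qed.

Let bu : bounded_measurable (centered_test mu m theta y n phi).
Proof. by apply: bmB => //; exact: bm_cst. Qed.

Lemma Qpath_additive_functional :
  Qpath mu m theta y n (A n) = score_mean mu m theta y t n.
Proof.
rewrite (_ : A n = fun x => A n x * (fun=> 1) (x n) + (fun=> 0) (x n)); last first.
  by apply/funext => x; rewrite mulr1 addr0.
rewrite (Qpath_additive n b1 b0); congr (eta n _); apply/funext => z.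
by rewrite mulr1 addr0.
Qed.

Lemma Qpath_test_additive : Qpath mu m theta y n
    (fun x => (phi (x n) - eta_flow mu m theta y n phi) * A n x) =
  score_covariance mu m theta y t n phi.
Proof.
rewrite (_ : (fun x => _) = fun x => A n x * centered_test mu m theta y n phi (x n) + (fun=> 0) (x n)); last first.
  by apply/funext => x; rewrite eta_flowE// /centered_test; ring.
rewrite (Qpath_additive n bu b0) /score_covariance.
rewrite (_ : (fun x => (_ - _) * _) = (fun x => (- score_mean mu m theta y t n) *
   centered_test mu m theta y n phi x + (Tback m theta y t eta n x * centered_test mu m theta y n phi x + 0))); last first.
  by apply/funext => x; ring.
rewrite (averaging_lin (avge n))//; last by apply: bmD => //; exact: bmM.
rewrite /centered_test (averagingB (avge n))//; last exact: bm_cst.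
by rewrite (averaging_cst (avge n)) subrr mulr0 add0r.
Qed.

Lemma Qpath_centered : Qpath mu m theta y n
    (fun x => (phi (x n) - Qpath mu m theta y n (fun x' => phi (x' n))) *
      (A n x - Qpath mu m theta y n (A n))) =
  score_covariance mu m theta y t n phi.
Proof.
rewrite -[Qpath _ _ _ _ _ (fun x' => phi (x' n))]/(eta_flow mu m theta y n phi) eta_flowE//.
rewrite Qpath_additive_functional.
rewrite (_ : (fun x => _) = fun x => A n x * centered_test mu m theta y n phi (x n) +
   (fun z => - score_mean mu m theta y t n * centered_test mu m theta y n phi z) (x n)); last first.
  by apply/funext => x; rewrite /centered_test; ring.
rewrite (Qpath_additive n bu (bmZ (- score_mean mu m theta y t n) bu)).
by congr (eta n _); apply/funext => x; ring.
Qed.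

(** [D_(p,n)(1)] is [Q_(p,n)(1)], the numerator of [G_(p,n)], and cancels; what remains is the
    inverse of [eta_p(Q_(p,n)(1))], a ratio of normalizers. *)
Lemma limit_potentialE p z : (p <= n)%N ->
  Gpot mu m theta y p n z / Dop mu m theta y p n (fun=> 1) z *
  Dop mu m theta y p n (fun x =>
    (phi (x n) - Qpath mu m theta y n (fun x' => phi (x' n))) *
      (A n x - Qpath mu m theta y n (A n)) - score_covariance mu m theta y t n phi) z =
  limit_potential mu m theta y t n phi p z.
Proof.
move=> pn.
rewrite -[Qpath _ _ _ _ _ (fun x' => phi (x' n))]/(eta_flow mu m theta y n phi) eta_flowE//.
rewrite Qpath_additive_functional.
rewrite (_ : (fun x => _ - _) = fun x => A n x * centered_test mu m theta y n phi (x n) +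
   centered_offset mu m theta y t n phi (x n)); last first.
  by apply/funext => x; rewrite /centered_offset /centered_test; ring.
rewrite Dop_additive//; last by apply: bmB; [exact: bmZ|exact: bm_cst].
congr (_ * _).
rewrite (_ : (fun=> 1) = fun x => A n x * (fun=> 0) (x n) + (fun=> 1) (x n)); last first.
  by apply/funext => x; rewrite mulr0 add0r.
rewrite (Dop_additive z pn b0 b1) /Gpot eta_flowE; last exact: (bm_Qsg reg).
rewrite eta_Qsg_one// invf_div /potential Hsg_mass.
rewrite Qsg0 mulr0 add0r mulrAC mulfV ?mul1r// gt_eqF//.
have := Qsg_lower p (n - p) b1 ler01 (fun=> lexx 1) z; apply: lt_le_trans.
by rewrite mulr1 invr_gt0 exprn_gt0// (delta_gt0 reg).
Qed.

End test_function.

Lemma Qpath_backward_test e n phi : (forall p, averaging mu (e p)) ->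
  bounded_measurable phi ->
  Qpath_backward m theta y e n (fun x => (phi (x n) - e n phi) * A n x) =
  e n (fun z => Tback m theta y t e n z * phi z) - e n phi * e n (Tback m theta y t e n).
Proof.
move=> avg bp; have bT := bm_Tback reg regt avg n.
rewrite (_ : (fun x => _) = fun x => A n x * (fun z => phi z - e n phi) (x n) + (fun=> 0) (x n)); last first.
  by apply/funext => x; ring.
rewrite (Qpath_backward_additive avg n (fun z => phi z - e n phi) (fun=> 0)).
rewrite (_ : (fun z => _) = fun z => - e n phi * Tback m theta y t e n z + Tback m theta y t e n z * phi z); last first.
  by apply/funext => z; ring.
rewrite (averaging_lin (avg n))//; last exact: bmM.
by rewrite addrC mulNr.
Qed.

End path_functionals.

(** * Stability *)

Section oscillations.
Context dX (X : measurableType dX) (R : realType).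
Implicit Types (v w a : X -> R) (e : (X -> R) -> R).

Definition osc_le v (o : R) : Prop := forall x x', `|v x - v x'| <= o.

Lemma osc_interval v o : osc_le v o -> exists c, forall x, c <= v x <= c + o.
Proof.
move=> vo; exists (inf (range v)) => x.
have lb x' : lbound (range v) (v x' - o).
  by move=> _ [z _ <-]; have := vo z x'; rewrite ler_norml => /andP[]; lra.
apply/andP; split; last first.
  rewrite -lerBlDr; apply: lb_le_inf; last exact: lb.
  by exists (v point), point.
by apply: ge_inf; [exists (v point - o)|exists x].
Qed.

(** Weaker than [averaging]: it also covers the integral against [mu], whose mass need not be 1. *)
Record positive_linear e : Prop := PositiveLinear {
  positive_lin : forall c v w, bounded_measurable v -> bounded_measurable w ->
    e (fun x => c * v x + w x) = c * e v + e w ;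
  positive_le : forall v w, bounded_measurable v -> bounded_measurable w ->
    (forall x, v x <= w x) -> e v <= e w }.

Lemma positive_linear_averaging (mu : {finite_measure set X -> \bar R}) e :
  averaging mu e -> positive_linear e.
Proof. by move=> avg; split; [exact: averaging_lin avg|exact: averaging_le avg]. Qed.

Lemma positive_linear_integral (mu : {finite_measure set X -> \bar R}) :
  positive_linear (fun v => \int[mu]_x v x).
Proof.
split; last exact: bm_le_Rintegral.
by move=> c v w bv bw; rewrite Rintegral_lin//; exact: bm_integrable.
Qed.

Section weighted_means.
Variable e : (X -> R) -> R.
Hypothesis pe : positive_linear e.

Lemma positiveZ c v : bounded_measurable v -> e (fun x => c * v x) = c * e v.
Proof.
move=> bv; have b0 : bounded_measurable (fun _ : X => 0 : R) by exact: bm_cst.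
have e0 : e (fun=> 0) = 0.
  have := positive_lin pe 1 b0 b0.
  rewrite (_ : (fun x => _) = fun=> 0); last by apply/funext => x; rewrite mulr0 addr0.
  lra.
rewrite -[RHS]addr0 -[X in _ = _ + X]e0 -(positive_lin pe)//.
by congr e; apply/funext => x; rewrite addr0.
Qed.

Definition weighted_mean a v := e (fun z => a z * v z) / e a.

Lemma weighted_mean_lin a c v w : bounded_measurable a -> bounded_measurable v ->
  bounded_measurable w ->
  weighted_mean a (fun z => c * v z + w z) = c * weighted_mean a v + weighted_mean a w.
Proof.
move=> ba bv bw; rewrite /weighted_mean mulrA -mulrDl -(positive_lin pe); [|exact: bmM..].
by congr (e _ / _); apply/funext => z; ring.
Qed.

Lemma weighted_mean_cst a c : bounded_measurable a -> 0 < e a ->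
  weighted_mean a (fun=> c) = c.
Proof.
move=> ba a0; rewrite /weighted_mean (_ : (fun z => _) = fun z => c * a z).
  by rewrite positiveZ// mulfK// gt_eqF.
by apply/funext => z; rewrite mulrC.
Qed.

Lemma weighted_mean_le a v w : bounded_measurable a -> bounded_measurable v ->
  bounded_measurable w -> (forall z, 0 <= a z) -> 0 < e a ->
  (forall z, v z <= w z) -> weighted_mean a v <= weighted_mean a w.
Proof.
move=> ba bv bw a0 ea vw; rewrite /weighted_mean ler_pM2r ?invr_gt0//.
by apply: (positive_le pe); [exact: bmM|exact: bmM|move=> z; exact: ler_wpM2l].
Qed.

Lemma weighted_mean_norm_le a v M : bounded_measurable a -> bounded_measurable v ->
  (forall z, 0 <= a z) -> 0 < e a -> (forall z, `|v z| <= M) ->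
  `|weighted_mean a v| <= M.
Proof.
move=> ba bv a0 ea vM; rewrite ler_norml -(weighted_mean_cst (- M) ba ea).
rewrite -[X in _ && (_ <= X)](weighted_mean_cst M ba ea); apply/andP; split;
  apply: weighted_mean_le => //; try exact: bm_cst; move=> z;
  by have := vM z; rewrite ler_norml => /andP[].
Qed.

(** Shift [v] so that it takes values in [0, o]. Passing from the weight [a2] to [a1] costs a factor
    [r] in the numerator and another in the denominator, so [m1 >= m2 / r ^ 2], while [m2 <= o]. *)
Let contraction_half a1 a2 v r o c : bounded_measurable a1 -> bounded_measurable a2 ->
  bounded_measurable v -> (forall z, 0 <= a1 z) -> (forall z, 0 <= a2 z) ->
  0 < e a1 -> 0 < e a2 -> 0 < r ->
  (forall z, a1 z <= r * a2 z) -> (forall z, a2 z <= r * a1 z) ->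
  (forall z, c <= v z <= c + o) -> (r ^+ 2)^-1 <= 1 ->
  weighted_mean a2 v - weighted_mean a1 v <= (1 - (r ^+ 2)^-1) * o.
Proof.
move=> ba1 ba2 bv a10 a20 ea1 ea2 r0 a12 a21 vc r1.
pose v' z := v z - c.
have bc : bounded_measurable (fun _ : X => c) by exact: bm_cst.
have bv' : bounded_measurable v' by exact: bmB.
have v'0 z : 0 <= v' z by have /andP[+ _] := vc z; rewrite /v'; lra.
have E a : bounded_measurable a -> 0 < e a -> weighted_mean a v = weighted_mean a v' + c.
  move=> ba ea; rewrite -[X in _ + X](weighted_mean_cst c ba ea) -[weighted_mean a v']mul1r.
  rewrite -weighted_mean_lin//; congr (weighted_mean a _); apply/funext => z.
  by rewrite /v'; ring.
rewrite !E// (_ : _ - _ = weighted_mean a2 v' - weighted_mean a1 v'); last by ring.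
set m2 := weighted_mean a2 v'; set m1 := weighted_mean a1 v'.
have m2o : m2 <= o.
  rewrite -(weighted_mean_cst o ba2 ea2); apply: weighted_mean_le => //; first exact: bm_cst.
  by move=> z; have /andP[_] := vc z; rewrite /v'; lra.
have m12 : (r ^+ 2)^-1 * m2 <= m1.
  have B12 : e (fun z => a2 z * v' z) <= r * e (fun z => a1 z * v' z).
    rewrite -positiveZ; last exact: bmM.
    apply: (positive_le pe); [exact: bmM|by apply: bmZ; exact: bmM|move=> z].
    by rewrite mulrA; exact: ler_wpM2r.
  have A12 : e a1 <= r * e a2.
    by rewrite -positiveZ//; apply: (positive_le pe) => //; exact: bmZ.
  have B10 : 0 <= e (fun z => a1 z * v' z).
    rewrite -(mul0r (e a1)) -positiveZ//; apply: (positive_le pe); [exact: bmZ|exact: bmM|].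
    by move=> z; rewrite mul0r mulr_ge0.
  rewrite /m1 /m2 /weighted_mean; move: B12 A12 B10 ea1 ea2.
  move: (e a1) (e a2) (e _) (e _) => A1 A2 B1 B2 B12 A12 B10 A10 A20.
  rewrite (_ : (r ^+ 2)^-1 * (B2 / A2) = (r^-1 * B2) * (r * A2)^-1); last first.
    by field; rewrite !gt_eqF.
  have [B20|/ltW B20] := leP 0 B2; last first.
    apply: le_trans (_ : 0 <= _); last by rewrite divr_ge0// ltW.
    by rewrite mulr_le0_ge0 ?mulr_ge0_le0 ?invr_ge0 ?mulr_ge0// ltW.
  apply: ler_pM; [by rewrite mulr_ge0// invr_ge0 ltW|by rewrite invr_ge0 mulr_ge0// ltW| |].
    by rewrite ler_pdivrMl.
  by rewrite lef_pV2 ?posrE ?mulr_gt0.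
apply: le_trans (_ : (1 - (r ^+ 2)^-1) * m2 <= _); first by rewrite mulrBl mul1r lerD2l lerN2.
by apply: ler_wpM2l => //; rewrite subr_ge0.
Qed.

Lemma weighted_mean_contraction a1 a2 v r o : bounded_measurable a1 ->
  bounded_measurable a2 -> bounded_measurable v ->
  (forall z, 0 <= a1 z) -> (forall z, 0 <= a2 z) -> 0 < e a1 -> 0 < e a2 -> 1 <= r ->
  (forall z, a1 z <= r * a2 z) -> (forall z, a2 z <= r * a1 z) -> osc_le v o ->
  `|weighted_mean a1 v - weighted_mean a2 v| <= (1 - (r ^+ 2)^-1) * o.
Proof.
move=> ba1 ba2 bv a10 a20 ea1 ea2 r1 a12 a21 /osc_interval[c vc].
have r0 : 0 < r := lt_le_trans ltr01 r1.
have r2 : (r ^+ 2)^-1 <= 1 by rewrite invf_le1 ?exprn_gt0// exprn_ege1.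
rewrite ler_norml; apply/andP; split; last first.
  exact: (@contraction_half a2 a1 v r o c).
by rewrite lerNl opprB; exact: (@contraction_half a1 a2 v r o c).
Qed.

(** Since the weighted mean of [v] is zero, [v x] is the weighted mean of [z |-> v x - v z]. *)
Lemma centered_osc_bound a v o x : bounded_measurable a -> bounded_measurable v ->
  (forall z, 0 <= a z) -> 0 < e a -> e (fun z => a z * v z) = 0 -> osc_le v o ->
  `|v x| <= o.
Proof.
move=> ba bv a0 ea m0 vo.
have m0' : weighted_mean a v = 0 by rewrite /weighted_mean m0 mul0r.
have := @weighted_mean_norm_le a (fun z => -1 * v z + v x) o ba _ a0 ea _.
rewrite weighted_mean_lin// ?m0' ?mulr0 ?add0r ?weighted_mean_cst//; last exact: bm_cst.
apply; first by apply: bmD; [exact: bmZ|exact: bm_cst].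
by move=> z; rewrite mulN1r addrC.
Qed.

End weighted_means.

Lemma osc_norm v M : (forall x, `|v x| <= M) -> osc_le v (M + M).
Proof. by move=> vM x x'; apply: le_trans (ler_normB _ _) _; exact: lerD. Qed.

End oscillations.

Section stability.
Context (R : realType) (d : nat) (dX dY : measure_display)
  (X : measurableType dX) (Y : measurableType dY).
Variables (mu : {finite_measure set X -> \bar R}) (m : densities R d X Y).
Variables (theta : 'rV[R]_d) (y : nat -> Y) (rho delta : R).
Hypothesis reg : regular_model mu m theta y rho delta.
Variables (t : nat -> X -> X -> R) (tau : R).
Hypothesis regt : regular_score t tau.
Notation q := (qdens m theta y).
Notation U := (Qsg mu m theta y).
Notation H := (Hsg mu m theta y t).
Notation eta := (exact_flow mu m theta y).
Notation T p := (Tback m theta y t eta p).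

(** [q] takes values between the inverse of [delta * rho] and [delta * rho], so two of its values
    have at most this ratio. *)
Definition mixing_ratio : R := (delta * rho) ^+ 2.
Notation r := mixing_ratio.
Definition contraction_rate : R := 1 - (r ^+ 2)^-1.
Notation lam := contraction_rate.
(** Halfway between [lam] and 1. The offsets contract at rate [lam] under a forcing that itself
    decays like [lam ^ l], which alone would produce a factor [l]; a strictly slower rate absorbs
    it. *)
Definition slow_rate : R := (1 + lam) / 2.
Notation lam' := slow_rate.
(** The fixed point of [b |-> lam * b + 2 * tau]. *)
Definition score_osc_bound : R := 2 * tau * r ^+ 2.
Notation B := score_osc_bound.
(** [B] bounds the oscillation at time [n]; the second term is the forcing [2 (2 tau + B)] divided
    by [lam' - lam = (r ^ 2)^-1 / 2]. *)
Definition offset_osc_bound : R := B + 2 * (2 * (2 * tau + B)) * r ^+ 2.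
Notation K0 := offset_osc_bound.

Let t0 : 0 <= tau := tau_ge0 regt.
Let b1 : bounded_measurable (fun _ : X => 1 : R). Proof. exact: bm_cst. Qed.

Lemma qdens_ratio k x z x' z' : q k x z <= r * q k x' z'.
Proof.
have c0 := qmax_gt0 reg; have /andP[_ h1] := qdens_bounds reg k x z.
have /andP[h2 _] := qdens_bounds reg k x' z'; apply: le_trans h1 _.
rewrite /r; move: (delta * rho) c0 h2 => c c0 h2.
have h : 1 <= c * q k x' z' by rewrite -ler_pdivrMl// mulr1.
by rewrite expr2 -mulrA ler_peMr// ltW.
Qed.

Lemma mixing_ratio_ge1 : 1 <= r.
Proof.
have := qdens_ratio 0 point point point point.
by rewrite -[X in X <= _]mul1r ler_pM2r// (qdens_gt0 reg).
Qed.
Let r0 : 0 < r := lt_le_trans ltr01 mixing_ratio_ge1.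
Let r20 : 0 < r ^+ 2. Proof. by rewrite exprn_gt0. Qed.
Let rV : 0 < (r ^+ 2)^-1 <= 1.
Proof. by rewrite invr_gt0 r20 invf_le1// exprn_ege1// mixing_ratio_ge1. Qed.

Lemma contraction_rate_bounds : 0 <= lam < 1.
Proof. by have /andP[a b] := rV; rewrite /lam; apply/andP; split; lra. Qed.

Lemma slow_rate_bounds : [/\ 0 < lam', lam' < 1 & lam <= lam'].
Proof. by have /andP[a b] := contraction_rate_bounds; rewrite /lam'; split; lra. Qed.

Let B0 : 0 <= B. Proof. by apply: mulr_ge0; [exact: mulr_ge0|exact: ltW]. Qed.

Let Brec : lam * B + (tau + tau) = B.
Proof. by rewrite /lam /B; field; rewrite gt_eqF. Qed.

Let bT p : bounded_measurable (T p).
Proof. exact: (bm_Tback reg regt (averaging_exact reg)). Qed.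

Let pe p : positive_linear (eta p) := positive_linear_averaging (averaging_exact reg p).

Let q0 k x z : 0 <= q k x z. Proof. by rewrite ltW// (qdens_gt0 reg). Qed.

Let eq0 p z : 0 < eta p (fun x => q p x z).
Proof. exact: (averaging_qdens_gt0 reg (averaging_exact reg p)). Qed.

Let Tstep p z : T p.+1 z = weighted_mean (eta p) (fun x => q p x z) (T p) +
  weighted_mean (eta p) (fun x => q p x z) (fun x => t p.+1 x z).
Proof.
have bq := bm_qdens_to reg p z; rewrite -[X in X + _]mul1r -(weighted_mean_lin (pe p))//; last exact: (bm_score_to regt).
by rewrite /= /backward_kernel; congr (eta p _ / _); apply/funext => x; rewrite mul1r.
Qed.

Let tmean p z : `|weighted_mean (eta p) (fun x => q p x z) (fun x => t p.+1 x z)| <= tau.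
Proof.
have bq := bm_qdens_to reg p z.
apply: (weighted_mean_norm_le (pe p)) => //; first exact: (bm_score_to regt).
by move=> x; exact: (score_bound regt).
Qed.

(** The weights [q(., z)] for different [z] are comparable up to [r], so the backward mean contracts
    the oscillation of [T_p], and the new increment adds at most [2 * tau]. *)
Lemma Tback_osc p : osc_le (T p) B.
Proof.
elim: p => [|p IH] z z'.
  apply: le_trans (osc_norm (fun x => score_bound regt 0 x x) z z') _.
  by rewrite -Brec lerDr mulr_ge0//; have /andP[] := contraction_rate_bounds.
rewrite !Tstep opprD addrACA; apply: le_trans (ler_normD _ _) _.
rewrite -Brec; apply: lerD; last first.
  by apply: le_trans (ler_normB _ _) _; apply: lerD; exact: tmean.
apply: (weighted_mean_contraction (pe p)) => //; try exact: (bm_qdens_to reg).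
- exact: mixing_ratio_ge1.
- by move=> x; exact: qdens_ratio.
- by move=> x; exact: qdens_ratio.
Qed.

Lemma Tback_increment p x : `|T p.+1 x - T p x| <= B + tau.
Proof.
rewrite Tstep addrAC; apply: le_trans (ler_normD _ _) _; apply: lerD; last exact: tmean.
have bq := bm_qdens_to reg p x.
have bc : bounded_measurable (fun _ : X => - T p x) by exact: bm_cst.
have := weighted_mean_lin (pe p) 1 bq (bT p) bc.
rewrite mul1r (weighted_mean_cst (pe p) _ bq (eq0 p x)) => <-.
apply: (weighted_mean_norm_le (pe p)) => //; first by apply: bmD => //; exact: bmZ.
by move=> z; rewrite mul1r; exact: Tback_osc.
Qed.

Notation w k l := (U k l (fun=> 1)).

Let bw k l : bounded_measurable (w k l). Proof. exact: (bm_Qsg reg). Qed.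

Let w0 k l x : 0 < w k l x.
Proof.
have := Qsg_lower reg k l b1 ler01 (fun=> lexx 1) x; apply: lt_le_trans.
by rewrite mulr1 invr_gt0 exprn_gt0// (delta_gt0 reg).
Qed.

Let bm_over_mass k l v : bounded_measurable v -> bounded_measurable (fun x => v x / w k l x).
Proof.
move=> bv; apply: (bm_div (b := (delta ^+ l)^-1) bv (bm_measurable (bw k l))).
  by rewrite invr_gt0 exprn_gt0// (delta_gt0 reg).
by move=> x; have := Qsg_lower reg k l b1 ler01 (fun=> lexx 1) x; rewrite mulr1.
Qed.

(** Only the first transition depends on the starting point. *)
Lemma Qsg_one_ratio k l x z : w k l x <= r * w k l z.
Proof.
case: l => [|l] /=; first by rewrite mulr1 mixing_ratio_ge1.
have bq v := bm_qdens_from reg k v.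
rewrite -bm_RintegralZ; last exact: bmM.
apply: bm_le_Rintegral; [exact: bmM|by apply: bmZ; exact: bmM|move=> v].
by rewrite mulrA; apply: ler_wpM2r; [rewrite ltW|exact: qdens_ratio].
Qed.

Notation I := (fun v : X -> R => \int[mu]_x v x).
Let pI : positive_linear I := positive_linear_integral mu.
Notation doob k l x := (weighted_mean I (fun z => q k x z * w k.+1 l z)).

Let ba k l x : bounded_measurable (fun z => q k x z * w k.+1 l z).
Proof. by apply: bmM => //; exact: (bm_qdens_from reg). Qed.
Let a0 k l x z : 0 <= q k x z * w k.+1 l z. Proof. by rewrite mulr_ge0// ltW. Qed.
Let Ia0 k l x : 0 < I (fun z => q k x z * w k.+1 l z). Proof. exact: (w0 k l.+1 x). Qed.

(** The weights of two starting points differ only through the factor [q k], hence by a ratio of at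
    most [r]. *)
Let doob_contraction k l v o x x' : bounded_measurable v -> osc_le v o ->
  `|doob k l x v - doob k l x' v| <= lam * o.
Proof.
move=> bv vo; apply: (weighted_mean_contraction pI) => //.
- exact: mixing_ratio_ge1.
- by move=> z; rewrite mulrA; apply: ler_wpM2r; [rewrite ltW|exact: qdens_ratio].
- by move=> z; rewrite mulrA; apply: ler_wpM2r; [rewrite ltW|exact: qdens_ratio].
Qed.

Section limit.
Variables (n : nat) (u h : X -> R) (kap : R).
Hypotheses (bu : bounded_measurable u) (bh : bounded_measurable h).
Hypotheses (u_osc : osc_le u 1) (u_mean : eta n u = 0).
Hypothesis hE : forall x, h x = - score_mean mu m theta y t n * u x - kap.
Hypothesis mean0 : initial_mean mu m theta y t n u h = 0.

(** Division by the mass turns the semigroup into the Markov transitions of its Doob transform. *)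
Let uh k l x := U k l u x / w k l x.

Let bm_uh k l : bounded_measurable (uh k l).
Proof. by apply: bm_over_mass; exact: (bm_Qsg reg). Qed.

Let uhS k l x : uh k l.+1 x = doob k l x (uh k.+1 l).
Proof.
rewrite /uh /weighted_mean /=; congr (_ / _); apply: eq_Rintegral => z _.
by have := w0 k.+1 l z; move: (w k.+1 l z) => W W0; field; rewrite gt_eqF.
Qed.

Let uh_osc k l : osc_le (uh k l) (lam ^+ l).
Proof.
elim: l k => [|l IH] k x x'; first by rewrite /uh /= !divr1 expr0.
by rewrite !uhS exprS; exact: doob_contraction.
Qed.

Let wpos p : 0 < eta p (w p (n - p)).
Proof.
have := averaging_bounds (averaging_exact reg p) (bw p (n - p)) (a := (delta ^+ (n - p))^-1)
  (b := r * w p (n - p) point).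
move=> /(_ _)/andP[|+ _].
  move=> x; rewrite Qsg_one_ratio andbT.
  by have := Qsg_lower reg p (n - p) b1 ler01 (fun=> lexx 1) x; rewrite mulr1.
by apply: lt_le_trans; rewrite invr_gt0 exprn_gt0// (delta_gt0 reg).
Qed.

Let b0 : bounded_measurable (fun _ : X => 0 : R). Proof. exact: bm_cst. Qed.

(** [eta n u = 0] gives [uh] a zero mean under [eta p] weighted by the mass, so its sup norm is at
    most its oscillation. *)
Let uh_bound p x : (p <= n)%N -> `|uh p (n - p) x| <= lam ^+ (n - p).
Proof.
move=> pn; apply: (centered_osc_bound (pe p) x (bw p (n - p)) (bm_uh p (n - p))) => //.
- by move=> z; exact: ltW.
- have := exact_flow_potential reg regt pn b0 bu.
  rewrite (exact_flow_mass reg regt)// u_mean mulr0 => /eqP.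
  rewrite mulf_eq0 gt_eqF ?(normalizer_gt0 reg (averaging_exact reg))//= => /eqP <-.
  congr (eta p _); apply/funext => z.
  by rewrite /potential Hsg_mass Qsg0 mulr0 add0r /uh mulrCA mulfV ?mulr1// gt_eqF.
Qed.

Let hh k l x := H k l u h x / w k l x.

Let bm_hh k l : bounded_measurable (hh k l).
Proof. by apply: bm_over_mass; exact: (bm_Hsg reg regt). Qed.

(* recentring the backward statistic at a reference point makes the offsets
   contract *)
Let h' k l x := T k point * uh k l x + hh k l x.

Let bm_h' k l : bounded_measurable (h' k l).
Proof. by apply: bmD => //; exact: bmZ. Qed.

(** Moving the reference value from time [k + 1] to time [k] creates the forcing term, in which only
    an increment of [T] appears; its factor is bounded by [2 * tau + B]. *)
Let h'S k l x : h' k l.+1 x = doob k l x (h' k.+1 l) +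
  doob k l x (fun z => (t k.+1 x z + (T k point - T k.+1 point)) * uh k.+1 l z).
Proof.
have bts : bounded_measurable (fun z => (t k.+1 x z + (T k point - T k.+1 point)) * uh k.+1 l z).
  by apply: bmM => //; apply: bmD; [exact: (bm_score_from regt)|exact: bm_cst].
rewrite -[X in X + _]mul1r -(weighted_mean_lin pI)//.
have -> : (fun z => 1 * h' k.+1 l z + (t k.+1 x z + (T k point - T k.+1 point)) * uh k.+1 l z) =
   fun z => T k point * uh k.+1 l z + (hh k.+1 l z + t k.+1 x z * uh k.+1 l z).
  by apply/funext => z; rewrite /h'; ring.
have bt : bounded_measurable (fun z => hh k.+1 l z + t k.+1 x z * uh k.+1 l z).
  by apply: bmD => //; apply: bmM => //; exact: (bm_score_from regt).
rewrite (weighted_mean_lin pI)// /h' -uhS; congr (_ + _).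
rewrite /hh /weighted_mean /=; congr (_ / _); apply: eq_Rintegral => z _.
by rewrite /uh; have := w0 k.+1 l z; move: (w k.+1 l z) => W W0; field; rewrite gt_eqF.
Qed.

Let h'_osc l k : (k + l)%N = n -> osc_le (h' k l) (K0 * lam' ^+ l).
Proof.
have [l0 l1 ll] := slow_rate_bounds.
have D0 : 0 <= 2 * (2 * (2 * tau + B)) * r ^+ 2.
  apply: mulr_ge0; last exact: ltW.
  by have := B0; have := t0; lra.
have K00 : 0 <= K0 by exact: addr_ge0.
elim: l k => [|l IH] k kn x x'.
  (* At time [n] the constant [kap] drops out of the oscillation, which leaves [T_n(point) - mean],
     at most [B], times an increment of [u]. *)
  rewrite addn0 in kn; rewrite expr0 mulr1 /h' /uh /hh kn /= !divr1 !hE.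
  have -> : T n point * u x + (- score_mean mu m theta y t n * u x - kap) -
      (T n point * u x' + (- score_mean mu m theta y t n * u x' - kap)) =
      (T n point - score_mean mu m theta y t n) * (u x - u x') by ring.
  rewrite normrM; apply: le_trans (_ : B * 1 <= _); last first.
    by rewrite mulr1 /K0 lerDl.
  apply: ler_pM => //.
  have avg := averaging_exact reg n.
  rewrite /score_mean -[T n point](averaging_cst avg) -(averagingB avg)//; last exact: bm_cst.
  apply: (averaging_norm_le avg); first by apply: bmB => //; exact: bm_cst.
  by move=> z; exact: Tback_osc.
rewrite !h'S opprD addrACA; apply: le_trans (ler_normD _ _) _.
have kn' : (k.+1 + l)%N = n by rewrite addSnnS.
have h1 := doob_contraction k l x x' (bm_h' k.+1 l) (IH k.+1 kn').
have h2 v : `|doob k l v (fun z => (t k.+1 v z + (T k point - T k.+1 point)) * uh k.+1 l z)| <=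
    (2 * tau + B) * lam' ^+ l.
  apply: (weighted_mean_norm_le pI) => //.
    by apply: bmM => //; apply: bmD; [exact: (bm_score_from regt)|exact: bm_cst].
  move=> z; rewrite normrM; apply: ler_pM => //.
    apply: le_trans (ler_normD _ _) _; rewrite distrC.
    have := Tback_increment k point; have := score_bound regt k.+1 v z; lra.
  have -> : l = (n - k.+1)%N by rewrite -kn' addKn.
  apply: le_trans (uh_bound z _) _; first by rewrite -kn' leq_addr.
  by apply: lerXn2r => //; rewrite nnegrE; [have /andP[] := contraction_rate_bounds|exact: ltW].
apply: le_trans (lerD h1 (le_trans (ler_normB _ _) (lerD (h2 x) (h2 x')))) _.
(* The gap [lam' - lam] pays for the forcing, by the choice of [K0]. *)
have E : K0 * lam' ^+ l.+1 = lam * (K0 * lam' ^+ l) + (lam' - lam) * K0 * lam' ^+ l.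
  by rewrite exprS; ring.
rewrite E lerD2l -mulrDl; apply: ler_wpM2r; first by rewrite exprn_ge0// ltW.
have -> : (lam' - lam) * K0 = (r ^+ 2)^-1 / 2 * B + 2 * (2 * tau + B).
  by rewrite /lam' /lam /K0; field; rewrite gt_eqF.
have : 0 <= (r ^+ 2)^-1 / 2 * B by rewrite mulr_ge0// divr_ge0// ltW//; have /andP[] := rV.
lra.
Qed.

(** Divided by the mass, the potential has weighted mean zero under [eta p], so its oscillation
    suffices. Thanks to the reference point, only differences of values of [T_p] multiply [uh] or
    its increments, and the rest is an increment of [h']. The factor [r] bounds the mass divided by
    its mean. *)
Lemma potential_decay p x : (p <= n)%N ->
  `|normalizer m theta y eta p / normalizer m theta y eta n *
    potential mu m theta y t eta n u h p x| <= r * (2 * B + K0) * lam' ^+ (n - p).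
Proof.
move=> pn; have [l0 l1 ll] := slow_rate_bounds.
have lle : lam ^+ (n - p) <= lam' ^+ (n - p).
  by apply: lerXn2r => //; rewrite nnegrE; [have /andP[] := contraction_rate_bounds|exact: ltW].
pose chi z := T p z * uh p (n - p) z + hh p (n - p) z.
have bchi : bounded_measurable chi by apply: bmD => //; exact: bmM.
have PE z : potential mu m theta y t eta n u h p z = w p (n - p) z * chi z.
  rewrite /potential /chi /uh /hh; have := w0 p (n - p) z.
    by move: (w p (n - p) z) => W W0; field; rewrite gt_eqF.
have chi_osc : osc_le chi ((2 * B + K0) * lam' ^+ (n - p)).
  move=> z z'; have -> : chi z - chi z' =
      ((T p z - T p z') * uh p (n - p) z + (T p z' - T p point) * (uh p (n - p) z - uh p (n - p) z')) +
      (h' p (n - p) z - h' p (n - p) z') by rewrite /chi /h'; ring.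
  apply: le_trans (ler_normD _ _) _; rewrite [leRHS]mulrDl; apply: lerD; last first.
    by apply: h'_osc; rewrite subnKC.
  apply: le_trans (ler_normD _ _) _; rewrite (normrM (T p z - _)) (normrM (T p z' - _)).
  rewrite (_ : 2 * B * _ = B * lam' ^+ (n - p) + B * lam' ^+ (n - p)); last by ring.
  apply: lerD; apply: ler_pM => //.
  - exact: Tback_osc.
  - by apply: le_trans _ lle; exact: uh_bound.
  - exact: Tback_osc.
  - by apply: le_trans _ lle; exact: uh_osc.
have chi_bound : `|chi x| <= (2 * B + K0) * lam' ^+ (n - p).
  apply: (centered_osc_bound (pe p) x (bw p (n - p)) bchi) => //.
  - by move=> z; exact: ltW.
  have := exact_flow_potential reg regt pn bu bh; rewrite mean0 => /eqP.
  rewrite mulf_eq0 gt_eqF ?(normalizer_gt0 reg (averaging_exact reg))//= => /eqP <-.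
  by congr (eta p _); apply/funext => z; rewrite PE.
rewrite PE mulrA normrM -[leRHS]mulrA; apply: ler_pM => //.
rewrite -invf_div -(eta_Qsg_one reg regt pn).
rewrite normrM normfV !gtr0_norm// mulrC ler_pdivrMr//.
rewrite -(averagingZ (averaging_exact reg p))// -[leLHS](averaging_cst (averaging_exact reg p)).
apply: (averaging_le (averaging_exact reg p)); [exact: bm_cst|exact: bmZ|].
by move=> z; exact: Qsg_one_ratio.
Qed.

End limit.

End stability.

(** * Regularity of the score *)

Section directional_derivatives.
Context (R : realType) (d : nat).
Implicit Types (f g : 'rV[R]_d -> R) (th v : 'rV[R]_d).

(** Only directional derivatives are assumed to exist, so the chain rule is applied to the
    restriction of [f] to a line. *)
Let line f th v : R -> R := fun s => f (s *: v + th).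

Let line_quotient f th v :
  (fun s : R => s^-1 *: ((line f th v \o shift 0) (s *: 1) - line f th v 0)) =
  (fun s => s^-1 *: ((f \o shift th) (s *: v) - f th)).
Proof.
apply/funext => s /=; rewrite /line /= addr0 scale0r add0r.
by rewrite [s *: 1]mulr1.
Qed.

Let derive_line f th v : 'D_1 (line f th v) 0 = 'D_v f th.
Proof. by rewrite /derive line_quotient. Qed.

Let derivable_line f th v : derivable (line f th v) 0 1 <-> derivable f th v.
Proof. by rewrite /derivable line_quotient. Qed.

Lemma is_derive_ln_comp f th v : derivable f th v -> 0 < f th ->
  is_derive th v (fun th' => ln (f th')) ('D_v f th / f th).
Proof.
move=> df f0; have lf0 : 0 < line f th v 0 by rewrite /line scale0r add0r.
have dl : is_derive (0 : R) 1 (line f th v) ('D_v f th).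
  by rewrite -derive_line; apply: derivableP; apply/derivable_line.
have := is_derive1_comp (is_derive1_ln lf0) dl.
rewrite {2}/line scale0r add0r mulrC => -[dL vL].
split; first exact/derivable_line.
by rewrite -vL -derive_line.
Qed.

Lemma derive_ln_mul f g th v : derivable f th v -> derivable g th v ->
  0 < f th -> 0 < g th ->
  'D_v (fun th' => ln (f th' * g th')) th =
  'D_v (fun th' => ln (f th')) th + 'D_v (fun th' => ln (g th')) th.
Proof.
move=> df dg f0 g0.
have [_ ->] := is_derive_ln_comp df f0; have [_ ->] := is_derive_ln_comp dg g0.
have dfg : derivable (f * g) th v by exact: derivableM.
have fg0 : 0 < (f * g) th by exact: mulr_gt0.
have [_ ->] := is_derive_ln_comp dfg fg0.
rewrite deriveM// /GRing.scale /= (_ : (f * g) th = f th * g th)//.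
by field; rewrite !gt_eqF.
Qed.

Lemma derivable_ln_comp f th v : derivable f th v -> 0 < f th ->
  derivable (fun th' => ln (f th')) th v.
Proof. by move=> df f0; have [] := is_derive_ln_comp df f0. Qed.

(** A pointwise limit of difference quotients along a sequence of parameters that tends to [th]. *)
Lemma measurable_derive d' (T : measurableType d') (Theta : set 'rV[R]_d)
    (F : 'rV[R]_d -> T -> R) th v : open Theta -> Theta th ->
  (forall th', Theta th' -> measurable_fun setT (F th')) ->
  (forall x, derivable (fun th' => F th' x) th v) ->
  measurable_fun setT (fun x => 'D_v (fun th' => F th' x) th).
Proof.
move=> oT Tth mF dF.
have hv : (fun s : R => s *: v + th) @ (0 : R) --> th.
  rewrite -[X in _ --> X]add0r -(scale0r v); apply: cvgD; last exact: cvg_cst.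
  by apply: cvgZr_tmp; exact: cvg_id.
have [e /= e0 He] := hv Theta (open_nbhs_nbhs (conj oT Tth)).
(* The shift of the index keeps every parameter [s n *: v + th] in [Theta], where [F] is
   measurable. *)
pose s (n : nat) : R := (n + Num.bound e^-1).+1%:R^-1.
have s0 n : 0 < s n by rewrite invr_gt0.
have sT n : Theta (s n *: v + th).
  apply: He; rewrite /= sub0r normrN gtr0_norm// -[e]invrK ltf_pV2 ?posrE ?invr_gt0//.
  apply: lt_le_trans (archi_boundP _) _; first by rewrite invr_ge0 ltW.
  by rewrite ler_nat; apply: leqW; exact: leq_addl.
have sc : s @ \oo --> (0 : R).
  have := @cvg_harmonic R; rewrite -(cvg_shiftn (Num.bound e^-1)) //.
apply: (@measurable_fun_cvg _ _ _ setT (fun n x => (s n)^-1 * (F (s n *: v + th) x - F th x))).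
  move=> n; apply: measurable_funM => //; apply: measurable_funB; exact: mF.
move=> x _; have /cvg_ex[l] := dF x.
move=> /[dup] /cvg_lim <-// /cvgr_dnbhsP/(_ s); apply.
by split => // n; rewrite gt_eqF.
Qed.

End directional_derivatives.

Lemma enorm_coord_le (R : realType) (d : nat) (v : 'rV[R]_d) j : `|v 0 j| <= enorm v.
Proof.
rewrite /enorm -sqrtr_sqr; apply: ler_wsqrtr.
by rewrite (bigD1 j)//= lerDl; apply: sumr_ge0 => i _; exact: sqr_ge0.
Qed.

Section regularity.
Context (R : realType) (d : nat) (dX dY : measure_display)
  (X : measurableType dX) (Y : measurableType dY).
Variables (mu : {measure set X -> \bar R}) (nu : {measure set Y -> \bar R}).
Variables (Theta : set 'rV[R]_d) (m : densities R d X Y) (rho delta c : R).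
Hypotheses (open_Theta : open Theta) (model : is_model mu nu Theta m).
Hypotheses (rho0 : 0 < rho) (delta0 : 0 < delta).
Hypothesis cond : forall (x x' : X) (y : Y) (theta : 'rV[R]_d), Theta theta ->
  [/\ [/\ partials_exist (fun th => init m th x) theta,
          partials_exist (fun th => trans m th x x') theta &
          partials_exist (fun th => obs m th x y) theta],
      0 < init m theta x,
      rho^-1 <= trans m theta x x' <= rho,
      delta^-1 <= obs m theta x y <= delta &
      [/\ enorm (grad (fun th => ln (init m th x)) theta) <= c,
          enorm (grad (fun th => ln (trans m th x x')) theta) <= c &
          enorm (grad (fun th => ln (obs m th x y)) theta) <= c]].
Variables (theta : 'rV[R]_d) (y : nat -> Y).
Hypothesis Ttheta : Theta theta.

Let measurable_obs th k : Theta th -> measurable_fun setT (fun x => obs m th x (y k)).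
Proof.
move=> Tth; have [_ _ [mo _] _] := model Tth.
exact: (measurableT_comp mo (@pair2_measurable _ _ _ _ (y k))).
Qed.

Lemma regular_model_condition : regular_model mu m theta y rho delta.
Proof.
have [[mi i0] [mt t0] [mo ob0] [i1 t1 _]] := model Ttheta.
split => //.
- by move=> x x'; have [] := cond x x' (y 0) Ttheta.
- by move=> k; exact: measurable_obs.
- by move=> k x; have [] := cond x x (y k) Ttheta.
Qed.

Let ln_comp (f : X * X -> R) : measurable_fun setT f ->
  measurable_fun setT (fun z => ln (f z)).
Proof. by move=> mf; apply: measurableT_comp mf; exact: measurable_ln. Qed.

Let trans_gt0 x x' th : Theta th -> 0 < trans m th x x'.
Proof.
move=> Tth; have [_ _ /andP[+ _] _ _] := cond x x' (y 0) Tth.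
by apply: lt_le_trans; rewrite invr_gt0.
Qed.

Let obs_gt0' x k th : Theta th -> 0 < obs m th x (y k).
Proof.
move=> Tth; have [_ _ _ /andP[+ _] _] := cond x x (y k) Tth.
by apply: lt_le_trans; rewrite invr_gt0.
Qed.

Let grad_coord (f : 'rV[R]_d -> R) j : `|'D_(delta_mx 0 j) f theta| <= enorm (grad f theta).
Proof. by have := enorm_coord_le (grad f theta) j; rewrite mxE. Qed.

Let score_coord k x z j : (score m theta y k.+1 x z) 0 j =
  'D_(delta_mx 0 j) (fun th => ln (obs m th x (y k))) theta +
  'D_(delta_mx 0 j) (fun th => ln (trans m th x z)) theta.
Proof.
have [[_ dt do_] _ _ _ _] := cond x z (y k) Ttheta.
rewrite /score mxE; apply: derive_ln_mul; [exact: do_|exact: dt|exact: obs_gt0'|exact: trans_gt0].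
Qed.

(** From time 1 on, the score is the sum of the gradients of the logarithms of the observation and
    transition densities, whence [c + c]. *)
Lemma regular_score_condition j :
  regular_score (fun k x z => score m theta y k x z 0 j) (c + c).
Proof.
split=> [k|k x z]; last first.
  case: k => [|k].
    rewrite /score mxE; apply: le_trans (grad_coord _ _) _.
    have [_ _ _ _ [h _ _]] := cond z z (y 0) Ttheta.
    have c0 : 0 <= c by apply: le_trans h; exact: sqrtr_ge0.
    by apply: le_trans h _; rewrite lerDl.
  rewrite score_coord; apply: le_trans (ler_normD _ _) _.
  have [_ _ _ _ [_ ht ho]] := cond x z (y k) Ttheta.
  by apply: lerD; apply: le_trans (grad_coord _ _) _.
case: k => [|k].
  have -> : (fun z : X * X => score m theta y 0 z.1 z.2 0 j) =
    (fun z => 'D_(delta_mx 0 j) (fun th => ln (init m th z.2)) theta).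
    by apply/funext => z; rewrite /score mxE.
  apply: (measurable_derive (F := fun th (z : X * X) => ln (init m th z.2)) open_Theta Ttheta).
    move=> th Tth; have [[mi _] _ _ _] := model Tth.
    by apply: ln_comp; exact: measurableT_comp mi measurable_snd.
  move=> z; have [[di _ _] i0 _ _ _] := cond z.2 z.2 (y 0) Ttheta.
  exact: derivable_ln_comp (di j) i0.
have -> : (fun z : X * X => score m theta y k.+1 z.1 z.2 0 j) =
  (fun z => 'D_(delta_mx 0 j) (fun th => ln (obs m th z.1 (y k))) theta +
    'D_(delta_mx 0 j) (fun th => ln (trans m th z.1 z.2)) theta).
  by apply/funext => z; rewrite score_coord.
apply: measurable_funD.
  apply: (measurable_derive (F := fun th (z : X * X) => ln (obs m th z.1 (y k))) open_Theta Ttheta).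
    move=> th Tth.
    by apply: ln_comp; exact: measurableT_comp (measurable_obs k Tth) measurable_fst.
  move=> z; have [[_ _ do_] _ _ _ _] := cond z.1 z.2 (y k) Ttheta.
  by apply: derivable_ln_comp (do_ j) _; exact: obs_gt0'.
apply: (measurable_derive (F := fun th (z : X * X) => ln (trans m th z.1 z.2)) open_Theta Ttheta).
  move=> th Tth; have [_ [mt _] _ _] := model Tth.
  exact: ln_comp.
move=> z; have [[_ dt _] _ _ _ _] := cond z.1 z.2 (y 0) Ttheta.
by apply: derivable_ln_comp (dt j) _; exact: trans_gt0.
Qed.

End regularity.

(** An equality of measures, so that [mu] can be replaced by its finite version everywhere at
    once. *)
Lemma finite_measure_of_lty d (T : measurableType d) (R : realType)
    (mu : {measure set T -> \bar R}) : (mu setT < +oo)%E ->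
  exists muF : {finite_measure set T -> \bar R}, mu = muF :> {measure set T -> \bar R}.
Proof.
case: mu => f fc fT.
pose mu0 : {measure set T -> \bar R} := Measure.Pack fc.
have fin : fin_num_fun mu0 by exact: lty_fin_num_fun.
pose muF : {finite_measure set T -> \bar R} :=
  HB.pack (f : set T -> \bar R) (mu0 : {measure set T -> \bar R}) (Measure_isFinite.Build _ T R mu0 fin).
by exists muF.
Qed.

(** * Limit law *)

Section multivariate_particle_limit.
Context (R : realType) (d : nat) (dX dY : measure_display)
  (X : measurableType dX) (Y : measurableType dY).
Variables (mu : {finite_measure set X -> \bar R}) (m : densities R d X Y).
Variables (theta : 'rV[R]_d) (y : nat -> Y) (rho delta tau : R).
Hypothesis reg : regular_model mu m theta y rho delta.
Variables (D : nat) (t : 'I_D -> nat -> X -> X -> R).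
Hypotheses (tau0 : 0 <= tau) (regt : forall j, regular_score (t j) tau).
Variables (n : nat) (phi : X -> R).
Hypothesis oscphi : Osc1 phi.
Notation eta := (exact_flow mu m theta y).

Let bphi : bounded_measurable phi. Proof. by case: oscphi. Qed.

Let reg0 : regular_score (fun (_ : nat) (_ _ : X) => 0 : R) tau.
Proof. by split=> [k|k x z]; [exact: measurable_cst|rewrite normr0]. Qed.

(* [minn p n] only serves to have a sequence bounded uniformly in [p] *)
Definition limit_function (j : 'I_D) (p : nat) : X -> R :=
  limit_potential mu m theta y (t j) n phi (minn p n).
Notation psi := limit_function.

Let bu : bounded_measurable (centered_test mu m theta y n phi).
Proof. by apply: bmB => //; exact: bm_cst. Qed.

Let bh j : bounded_measurable (centered_offset mu m theta y (t j) n phi).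
Proof. by apply: bmB; [exact: bmZ|exact: bm_cst]. Qed.

Lemma bm_limit_function j p : bounded_measurable (psi j p).
Proof. by apply: bmZ; exact: (bm_potential reg (regt j) (averaging_exact reg)). Qed.

Definition limit_bound : R :=
  mixing_ratio rho delta * (2 * score_osc_bound rho delta tau + offset_osc_bound rho delta tau).

Lemma limit_function_decay j p x :
  `|psi j p x| <= limit_bound * slow_rate rho delta ^+ (n - minn p n).
Proof.
have avg := averaging_exact reg n.
apply: (potential_decay reg (regt j) (kap := score_covariance mu m theta y (t j) n phi)) => //.
- by move=> z z'; rewrite /centered_test opprB addrC -addrA addrA addrC addrA subrK; case: oscphi.
- by rewrite (averagingB avg)// ?(averaging_cst avg) ?subrr//; exact: bm_cst.
- exact: (initial_mean_centered reg (regt j)).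
- exact: geq_minr.
Qed.

Let limit_bound_ge0 : 0 <= limit_bound.
Proof.
have r0 : 0 <= mixing_ratio rho delta := le_trans ler01 (mixing_ratio_ge1 reg).
have B0 : 0 <= score_osc_bound rho delta tau.
  by apply: mulr_ge0; [exact: mulr_ge0|exact: sqr_ge0].
apply: mulr_ge0 => //; apply: addr_ge0; first exact: mulr_ge0.
apply: addr_ge0 => //; apply: mulr_ge0; last exact: sqr_ge0.
by have := tau0; lra.
Qed.

Lemma limit_function_bound j p x : `|psi j p x| <= limit_bound.
Proof.
apply: le_trans (limit_function_decay j p x) _.
have [l0 l1 _] := slow_rate_bounds reg.
by apply: ler_piMr => //; apply: exprn_ile1; exact: ltW.
Qed.

(** [(1 - l)^-1] is the fixed point of the recursion [s |-> l * s + 1] satisfied by these sums. *)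
Lemma geometric_sum_le (l : R) k : 0 < l -> l < 1 ->
  \sum_(p < k.+1) l ^+ (k - p) <= (1 - l)^-1.
Proof.
move=> l0 l1; have l1' : 0 < 1 - l by rewrite subr_gt0.
elim: k => [|k IH].
  by rewrite big_ord1 subnn expr0 invf_ge1// ?lerBlDr ?lerDl ltW.
rewrite big_ord_recr /= subnn expr0.
rewrite (eq_bigr (fun p : 'I_k.+1 => l * l ^+ (k - p))); last first.
  by move=> p _; rewrite -exprS subSn// -ltnS.
rewrite -mulr_sumr; apply: le_trans (lerD (ler_wpM2l (ltW l0) IH) (lexx _)) _.
by rewrite le_eqVlt; apply/orP; left; apply/eqP; field; rewrite gt_eqF.
Qed.

(** A variance is at most the second moment, and one of the two factors [slow_rate ^ (n - p)] is
    enough to sum a geometric series. *)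
Lemma limit_variance_le j :
  \sum_(p < n.+1) asymptotic_variance mu m theta y (psi j) p <=
  limit_bound ^+ 2 / (1 - slow_rate rho delta).
Proof.
have [l0 l1 _] := slow_rate_bounds reg.
apply: le_trans (_ : limit_bound ^+ 2 * \sum_(p < n.+1) slow_rate rho delta ^+ (n - p) <= _); last first.
  by apply: ler_wpM2l; [exact: sqr_ge0|exact: geometric_sum_le].
rewrite mulr_sumr; apply: ler_sum => p _.
have avg := averaging_exact reg p.
apply: (@le_trans _ _ (eta p (fun x => psi j p x ^+ 2))).
  by rewrite /asymptotic_variance gerBl sqr_ge0.
have /minn_idPl pn : (p <= n)%N by rewrite -ltnS.
have := averaging_norm_le avg (bmX 2 (bm_limit_function j p))
  (M := limit_bound ^+ 2 * slow_rate rho delta ^+ (n - p)).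
move=> /(_ _)/(le_trans (ler_norm _)); apply=> x.
rewrite normrX; apply: le_trans (_ : (limit_bound * slow_rate rho delta ^+ (n - p)) ^+ 2 <= _).
  have h := limit_function_decay j p x; rewrite pn in h.
  by apply: lerXn2r => //; rewrite nnegrE// (le_trans _ h).
rewrite exprMn; apply: ler_wpM2l; first exact: sqr_ge0.
rewrite -[leRHS]mulr1 expr2; apply: ler_wpM2l; first by rewrite exprn_ge0// ltW.
by apply: exprn_ile1; exact: ltW.
Qed.

(** Cramer-Wold device: a linear combination of the coordinates of the error has these test
    functions in its linear part. *)
Definition combination (a : 'rV[R]_D) (p : nat) (x : X) : R := \sum_j a 0 j * psi j p x.

Lemma bm_combination a p : bounded_measurable (combination a p).
Proof. by apply: bm_sum => j; apply: bmZ; exact: bm_limit_function. Qed.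

Lemma combination_bound a p x : `|combination a p x| <= \sum_j `|a 0 j| * limit_bound.
Proof.
apply: le_trans (ler_norm_sum _ _ _) _; apply: ler_sum => j _.
by rewrite normrM; apply: ler_wpM2l => //; exact: limit_function_bound.
Qed.

Variable M : R.
Hypotheses (M1 : 1 <= M) (uM : forall x, `|centered_test mu m theta y n phi x| <= M)
  (hM : forall j x, `|centered_offset mu m theta y (t j) n phi x| <= M)
  (sM : forall j, `|score_mean mu m theta y (t j) n| <= M).

Context (dO : measure_display) (O : measurableType dO) (P : probability O R).
Variables (N : nat) (xi : nat -> 'I_N -> {RV P >-> X}).
Hypotheses (N_gt0 : (0 < N)%N) (ps : particle_system mu m theta y xi).
Notation e := (etaN xi).
Notation err := (sampling_error mu m theta y xi).
Notation sN := (Num.sqrt N%:R : R).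

Let avg w p : averaging mu (e w p) := averaging_particles mu xi N_gt0 w p.
Let sN0 : 0 < sN. Proof. by rewrite sqrtr_gt0 ltr0n. Qed.
Let sN1 : 1 <= sN. Proof. by rewrite -[leLHS]sqrtr1; apply: ler_wsqrtr; rewrite ler1n. Qed.

Definition scaled_error (j : 'I_D) (w : O) : R :=
  sN * (e w n (fun x => Tback m theta y (t j) (e w) n x * phi x) -
        e w n phi * e w n (Tback m theta y (t j) (e w) n) -
        score_covariance mu m theta y (t j) n phi).

Let bm_to_O p (f : g_sigma_algebraType (past_generators xi p) -> R) :
  bounded_measurable f -> bounded_measurable (f : O -> R) :=
  @bm_past _ _ _ _ _ _ _ xi p f.

Lemma bm_scaled_error j : bounded_measurable (scaled_error j).
Proof.
have bT := bm_particle_Tback reg (regt j) xi N_gt0 n.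
have b3 : bounded_measurable (fun z : g_sigma_algebraType (past_generators xi n) * X => phi z.2).
  exact: bm_comp bphi measurable_snd.
apply: (@bmZ _ O R sN); apply: bmB; last exact: bm_cst.
apply: bmB; first exact: (bm_to_O (bm_particle_mean (bmM bT b3))).
by apply: bmM; [exact: (bm_to_O (bm_particle_mean b3))|exact: (bm_to_O (bm_particle_mean bT))].
Qed.

Let bm_err p chi : bounded_measurable chi -> bounded_measurable (fun w : O => err p chi w).
Proof.
move=> bc; apply: (bm_to_O (p := p.+1)).
apply: (@bm_sampling_error _ _ _ _ _ _ mu m theta y rho delta reg _ _ _ _ xi N_gt0 p (fun z => chi z.2)).
exact: bm_comp bc measurable_snd.
Qed.

Let linear_part j w : R := \sum_(p < n.+1) sN * err p (psi j p) w.

Let bm_linear_part j : bounded_measurable (linear_part j).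
Proof. by apply: bm_sum => p; apply: bmZ; apply: bm_err; exact: bm_limit_function. Qed.

Let expansion_le j : \int[P]_w `|scaled_error j w - linear_part j w| <=
  expansion_bound mu rho delta tau n M / sN.
Proof.
have L w : linear_part j w =
    \sum_(p < n.+1) sN * err p (limit_potential mu m theta y (t j) n phi p) w.
  apply: eq_bigr => p _; rewrite (_ : psi j p = limit_potential mu m theta y (t j) n phi p) //.
  by rewrite /limit_function (minn_idPl _)// -ltnS.
under eq_Rintegral do rewrite L.
exact: (zeta_expansion reg (regt j) N_gt0 ps M1 bphi uM (hM j) (sM j)).
Qed.

Let linear_combination (a : 'rV[R]_D) w :
  \sum_j a 0 j * linear_part j w = \sum_(p < n.+1) sN * err p (combination a p) w.
Proof.
rewrite (eq_bigr (fun j => \sum_(p < n.+1) a 0 j * (sN * err p (psi j p) w))); last first.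
  by move=> j _; rewrite mulr_sumr.
rewrite exchange_big/=; apply: eq_bigr => p _.
have bp j : bounded_measurable (fun x => a 0 j * psi j p x).
  by apply: bmZ; exact: bm_limit_function.
have ap := averaging_predictive (e := e w) reg (avg w (nat_of_ord p).-1).
rewrite /combination /sampling_error.
rewrite (averaging_sum (avg w p) (index_enum 'I_D) bp) (averaging_sum ap (index_enum 'I_D) bp).
rewrite -sumrB mulr_sumr; apply: eq_bigr => j _.
rewrite (averagingZ (avg w p) _ (bm_limit_function j p)) (averagingZ ap _ (bm_limit_function j p)).
by rewrite -mulrBr mulrCA.
Qed.

Lemma scaled_error_abs j : \int[P]_w `|scaled_error j w| <=
  expansion_bound mu rho delta tau n M + n.+1%:R * (limit_bound ^+ 2 + 1).
Proof.
have eb0 : 0 <= expansion_bound mu rho delta tau n M.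
  have := le_trans (Rintegral_ge0 _ _) (expansion_le j).
  by move=> /(_ (fun _ _ => normr_ge0 _)); rewrite pmulr_lge0 ?invr_gt0.
have bZ := bm_scaled_error j; have bL := bm_linear_part j.
apply: (@le_trans _ _ (\int[P]_w (`|scaled_error j w - linear_part j w| +
    \sum_(p < n.+1) `|sN * err p (psi j p) w|))).
  apply: bm_le_Rintegral; first exact: bm_norm.
    apply: bmD; first by apply: bm_norm; exact: bmB.
    apply: bm_sum => p; apply: bm_norm; apply: bmZ; apply: bm_err; exact: bm_limit_function.
  move=> w; rewrite -[X in `|X| <= _](subrK (linear_part j w)).
  by apply: le_trans (ler_normD _ _) _; rewrite lerD2l; exact: ler_norm_sum.
have be p : bounded_measurable (fun w => `|sN * err p (psi j p) w|).
  by apply: bm_norm; apply: bmZ; apply: bm_err; exact: bm_limit_function.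
rewrite bm_RintegralD; [|by apply: bm_norm; exact: bmB|exact: bm_sum].
apply: lerD.
  by apply: le_trans (expansion_le j) _; rewrite ler_pdivrMr// ler_peMr.
rewrite bm_Rintegral_sum//.
have -> : n.+1%:R * (limit_bound ^+ 2 + 1) = \sum_(p < n.+1) (limit_bound ^+ 2 + 1).
  by rewrite sumr_const card_ord mulr_natl.
apply: ler_sum => p _; apply: (sampling_error_abs reg N_gt0 ps).
  exact: bm_limit_function.
exact: limit_function_bound.
Qed.

(** The cosine is 1-Lipschitz, so the expansion errors of the coordinates add; [iterated_clt] treats
    the linear part. *)
Lemma scaled_error_cos (a : 'rV[R]_D) (b : R) :
  `|\int[P]_w cos (\sum_j a 0 j * scaled_error j w + b) -
    expR (- ((\sum_(p < n.+1) asymptotic_variance mu m theta y (combination a) p) / 2)) * cos b| <=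
  (\sum_j `|a 0 j| * expansion_bound mu rho delta tau n M +
   \sum_(p < n.+1) clt_bound delta tau p (\sum_j `|a 0 j| * limit_bound)) / sN.
Proof.
have bZ := bm_scaled_error; have bL := bm_linear_part.
have H := iterated_clt reg reg0 N_gt0 ps (bm_combination a) (combination_bound a) b n.+1.
set E1 := \int[P]_w cos _ in H *; set E2 := \int[P]_w cos _.
set G := expR _ * _ in H *.
rewrite -(subrK E1 E2) -addrA [leRHS]mulrDl; apply: le_trans (ler_normD _ _) _; apply: lerD => //.
have bc1 : bounded_measurable (fun w => cos (\sum_j a 0 j * scaled_error j w + b)).
  apply: bm_cos; apply: bm_measurable; apply: bmD; last exact: bm_cst.
  by apply: bm_sum => j; exact: bmZ.
have bc2 : bounded_measurable (fun w => cos (b + \sum_(p < n.+1) sN * err p (combination a p) w)).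
  apply: bm_cos; apply: bm_measurable; apply: bmD; first exact: bm_cst.
  by apply: bm_sum => p; apply: bmZ; apply: bm_err; exact: bm_combination.
rewrite /E1 /E2 -bm_RintegralB//; apply: le_trans (bm_norm_Rintegral _ (bmB bc1 bc2)) _.
have bn j : bounded_measurable (fun w => `|a 0 j| * `|scaled_error j w - linear_part j w|).
  by apply: bmZ; apply: bm_norm; exact: bmB.
apply: (@le_trans _ _ (\int[P]_w \sum_j `|a 0 j| * `|scaled_error j w - linear_part j w|)).
  apply: bm_le_Rintegral; [by apply: bm_norm; exact: bmB|exact: bm_sum|move=> w].
  apply: le_trans (cos_lipschitz _ _) _.
  rewrite -linear_combination (_ : _ - _ = \sum_j a 0 j * (scaled_error j w - linear_part j w)).
    apply: le_trans (ler_norm_sum _ _ _) _; apply: ler_sum => j _.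
    by rewrite normrM.
  by rewrite opprD addrA addrK -sumrB; apply: eq_bigr => j _; rewrite mulrBr.
rewrite bm_Rintegral_sum// mulr_suml; apply: ler_sum => j _.
rewrite bm_RintegralZ; last by apply: bm_norm; exact: bmB.
by rewrite -mulrA; apply: ler_wpM2l.
Qed.

End multivariate_particle_limit.

(** * Sums and linear combinations of the Gaussian fields *)

Section gaussian_field_sums.
Context (R : realType) (dX : measure_display) (X : measurableType dX).
Context (dL : measure_display) (L : measurableType dL) (PL : probability L R).
Variables (e : nat -> (X -> R) -> R) (V : nat -> (X -> R) -> L -> R).
Hypothesis gV : gaussian_fields PL e V.

Let field_variance (chi : X -> R) p : R := e p (fun x => chi x ^+ 2) - (e p chi) ^+ 2.

Lemma measurable_field p chi : bounded_measurable chi -> measurable_fun setT (V p chi).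
Proof. by case: gV => /(_ p chi) H _ _ bc; have [] := H bc. Qed.

Lemma field_sum_cos (chi : nat -> X -> R) n a s :
  (forall p, bounded_measurable (chi p)) -> (forall p, 0 <= field_variance (chi p) p) ->
  \int[PL]_w cos (a + s * \sum_(p < n.+1) V p (chi p) w) =
  expR (- ((\sum_(p < n.+1) field_variance (chi p) p) * s ^+ 2 / 2)) * cos a.
Proof.
case: gV => gauss _ indep bchi v0.
apply: (@independent_sum_cos _ L R PL n.+1 (fun i => V i (chi i))
  (fun i => field_variance (chi i) i)).
- by move=> i; exact: measurable_field.
- move=> B mB; have mB' k : measurable (B (inord k)) by exact: mB.
  have := indep chi n (fun k => B (inord k)) bchi mB'.
  rewrite (_ : \bigcap_(k in `I_n.+1) _ =
    \bigcap_(i in [set: 'I_n.+1]) (V i (chi i) @^-1` B i)); last first.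
    apply/seteqP; split => w H.
      by move=> i _; have := H i (ltn_ord i); rewrite /= inord_val.
    by move=> k kn; have := H (Ordinal kn) Logic.I; rewrite /= -{1}(inord_val (Ordinal kn)).
  by move=> ->; apply: eq_bigr => i _; rewrite inord_val.
- move=> i b s'; apply: centered_gaussian_cos; first exact: v0.
  exact: gauss.
Qed.

(** Linearity holds almost surely, for two functions at a time. For the empty sum,
    [V(0) = V(0) + V(0)] gives [V(0) = 0] almost surely. *)
Lemma field_combination (I : Type) (r : seq I) p (c : I -> R) (f : I -> X -> R) :
  (forall i, bounded_measurable (f i)) ->
  {ae PL, forall w, V p (fun x => \sum_(i <- r) c i * f i x) w =
    \sum_(i <- r) c i * V p (f i) w}.
Proof.
case: gV => _ lin _ bf.
elim: r => [|i r IH].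
  have b0 : bounded_measurable (fun _ : X => 0 : R) by exact: bm_cst.
  have := lin p 1 _ _ b0 b0; apply: filterS => w.
  rewrite (_ : (fun x => \sum_(i <- [::]) _) = fun=> 0); last by apply/funext => x; rewrite big_nil.
  rewrite (_ : (fun x => 1 * 0 + 0) = fun=> 0); last by apply/funext => x; rewrite mulr0 addr0.
  by rewrite big_nil; lra.
have bs : bounded_measurable (fun x => \sum_(i <- r) c i * f i x).
  by apply: bm_sum => k; exact: bmZ.
have := lin p (c i) _ _ (bf i) bs; apply: filterS2 IH => w E1 E2.
rewrite big_cons -E1 -E2; congr (V p _ w).
by apply/funext => x; rewrite big_cons.
Qed.

End gaussian_field_sums.

Lemma ae_eq_Rintegral_cos (R : realType) d (T : measurableType d) (P : probability T R)
    (f g : T -> R) : measurable_fun setT f -> measurable_fun setT g ->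
  {ae P, forall w, f w = g w} -> \int[P]_w cos (f w) = \int[P]_w cos (g w).
Proof.
move=> mf mg fg; congr fine; apply: ae_eq_integral => //.
- by apply/measurable_EFinP; apply: bm_measurable; exact: bm_cos.
- by apply/measurable_EFinP; apply: bm_measurable; exact: bm_cos.
- by apply: filterS fg => w E _; rewrite E.
Qed.

Lemma cvg_of_rate (R : realType) (u : nat -> R) (l c : R) :
  (forall N, (0 < N)%N -> `|u N - l| <= c / Num.sqrt N%:R) -> u @ \oo --> l.
Proof.
move=> H; apply/cvgrPdist_le => e e0; near=> N.
have N0 : (0 < N)%N by near: N; exact: nbhs_infty_gt.
have s0 : 0 < Num.sqrt N%:R :> R by rewrite sqrtr_gt0 ltr0n.
rewrite distrC; apply: le_trans (H N N0) _; rewrite ler_pdivrMr//.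
apply: le_trans (ler_norm c) _; rewrite -ler_pdivrMl// -[leLHS]ger0_norm; last first.
  by rewrite mulr_ge0// invr_ge0 ltW.
rewrite -[leLHS]sqrtr_sqr.
apply: ler_wsqrtr; apply: le_trans (ltW (archi_boundP (sqr_ge0 _))) _.
by rewrite ler_nat; near: N; exact: nbhs_infty_ge.
Unshelve. all: by end_near. Qed.

Theorem theorem3p2 (R : realType) (d : nat)
    (dX dY : measure_display) (X : measurableType dX) (Y : measurableType dY)
    (mu : {measure set X -> \bar R}) (nu : {measure set Y -> \bar R})
    (Theta : set 'rV[R]_d) (m : densities R d X Y) :
  open Theta -> is_model mu nu Theta m -> condition_A mu nu Theta m ->
  exists C : R,
  forall (theta : 'rV[R]_d) (y : nat -> Y) (n : nat) (phi : X -> R),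
  Theta theta -> Osc1 phi ->
  forall (dO : nat -> measure_display) (O : forall N, measurableType (dO N))
    (P : forall N, probability (O N) R)
    (xi : forall N, nat -> 'I_N -> {RV (P N) >-> X}),
  (forall N, particle_system mu m theta y (xi N)) ->
  forall (dL : measure_display) (L : measurableType dL) (PL : probability L R)
    (V : nat -> (X -> R) -> L -> R),
  gaussian_fields PL (eta_flow mu m theta y) V ->
  let Z := fun (N : nat) (w : O N) =>
    Num.sqrt N%:R *:
      (zetaN m theta y (xi N) n phi w - zeta_flow mu m theta y n phi)
      : 'rV[R]_d in
  let limit := fun w : L =>
    \sum_(p < n.+1) componentwise (fun psi => V p psi w)
                      (limit_integrand mu m theta y p n phi) : 'rV[R]_d in
  [/\ cvg_in_law P Z PL limit,
      centered_gaussian_vector PL limit &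
      forall j : 'I_d, ('V_PL[fun w => limit w 0%R j] <= C%:E)%E].
Proof.
move=> oT model [muT _ [rho [delta [c [rho0 delta0 c0 cond]]]]].
have [muF muE] := finite_measure_of_lty muT; subst mu.
pose tau := c + c; pose lb := limit_bound rho delta tau.
(* [lb] and the rate depend on [rho], [delta] and [c] alone, all fixed before [theta], [y], [n] and
   [phi]. *)
exists (lb ^+ 2 / (1 - slow_rate rho delta)).
set C := lb ^+ 2 / _.
move=> theta y n phi Tth oscphi dO O P xi ps dL L PL V gV Z limit.
have bphi : bounded_measurable phi by case: oscphi.
have reg : regular_model muF m theta y rho delta := regular_model_condition model rho0 delta0 cond y Tth.
pose t (j : 'I_d) k x z := score m theta y k x z 0 j.
have regt j : regular_score (t j) tau := regular_score_condition oT model rho0 delta0 cond y Tth j.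
have tau0 : 0 <= tau by rewrite addr_ge0// ltW.
(* Serves for the statements about masses alone, also when [d = 0] and the score has no
   coordinate. *)
have reg0 : regular_score (fun (_ : nat) (_ _ : X) => 0 : R) tau.
  by split=> [k|k x z]; [exact: measurable_cst|rewrite normr0].
pose eta := exact_flow muF m theta y.
pose psi j p := limit_function muF m theta y t n phi j p.
have bpsi j p : bounded_measurable (psi j p) by exact: (bm_limit_function reg regt n oscphi j p).
have AE j : (fun x => (score_sum m theta y n x) 0 j) = additive_functional (t j) n.
  by apply/funext => x; rewrite summxE.
have zeta_exact j : zeta_flow muF m theta y n phi 0 j = score_covariance muF m theta y (t j) n phi.
  rewrite -(Qpath_test_additive reg (regt j) n bphi) mxE; congr (Qpath _ _ _ _ _ _).
  by apply/funext => x; rewrite mxE -AE.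
have ZE N (N0 : (0 < N)%N) j w : Z N w 0 j = scaled_error muF m theta y t n phi (xi N) j w.
  rewrite /scaled_error mxE; congr (_ * _); rewrite mxE [X in _ + X]mxE zeta_exact; congr (_ - _).
  rewrite -(Qpath_backward_test reg (regt j) n (averaging_particles muF (xi N) N0 w) bphi) mxE.
  congr (Qpath_backward _ _ _ _ _ _).
  by apply/funext => x; rewrite mxE -AE.
have limitE w j : limit w 0 j = \sum_(p < n.+1) V p (psi j p) w.
  rewrite summxE; apply: eq_bigr => p _; rewrite mxE; congr (V p _ w); apply/funext => u.
  have pn : (p <= n)%N by rewrite -ltnS.
  rewrite /psi /limit_function (minn_idPl pn) -(limit_potentialE reg (regt j) bphi u pn).
  rewrite /limit_integrand mxE; congr (_ * _); rewrite mxE.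
  have FE : (fun x => centered_F muF m theta y n phi x 0 j) = (fun x =>
      (phi (x n) - Qpath muF m theta y n (fun x' => phi (x' n))) *
      (additive_functional (t j) n x - Qpath muF m theta y n (additive_functional (t j) n))).
    apply/funext => x; rewrite /centered_F mxE; congr (_ * _).
    by rewrite mxE [X in _ + X]mxE mxE -AE.
  congr (Dop _ _ _ _ _ _ _ u); apply/funext => x.
  have subE (v w' : 'rV[R]_d) : (v - w') 0 j = v 0 j - w' 0 j by rewrite !mxE.
  have compE (T : Type) (K : (T -> R) -> R) F : componentwise K F 0 j = K (fun z => F z 0 j).
    by rewrite mxE.
  by rewrite subE compE FE (Qpath_centered reg (regt j) n bphi) -(congr1 (fun F => F x) FE).
pose fvar (chi : X -> R) p : R := eta_flow muF m theta y p (fun x => chi x ^+ 2) -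
  (eta_flow muF m theta y p chi) ^+ 2.
have fvarE (chi : nat -> X -> R) p : (forall q, bounded_measurable (chi q)) ->
    fvar (chi p) p = asymptotic_variance muF m theta y chi p.
  move=> bchi; rewrite /fvar /asymptotic_variance.
  by rewrite !(eta_flowE reg reg0)//; exact: bmX.
have sum_cos (chi : nat -> X -> R) B a s : (forall p, bounded_measurable (chi p)) ->
    (forall p x, `|chi p x| <= B) ->
    \int[PL]_w cos (a + s * \sum_(p < n.+1) V p (chi p) w) =
    expR (- ((\sum_(p < n.+1) asymptotic_variance muF m theta y chi p) * s ^+ 2 / 2)) * cos a.
  move=> bchi chiB; rewrite (field_sum_cos gV n a s bchi); last first.
    move=> p; rewrite -/(fvar (chi p) p) fvarE//.
    by have /andP[] := asymptotic_variance_bounds reg bchi chiB p.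
  have E : \sum_(p < n.+1) fvar (chi p) p =
      \sum_(p < n.+1) asymptotic_variance muF m theta y chi p.
    by apply: eq_bigr => p _; exact: fvarE.
  by rewrite -E.
have psiB j p x : `|psi j p x| <= lb by exact: (limit_function_bound reg tau0 regt n oscphi).
have mlimit j : measurable_fun setT (fun w => limit w 0 j).
  rewrite (_ : (fun w => _) = fun w => \sum_(p < n.+1) V p (psi j p) w); last first.
    by apply/funext => w; exact: limitE.
  by apply: measurable_sum => p; exact: (measurable_field gV).
have limit_cos j s : \int[PL]_w cos (s * limit w 0 j) =
    expR (- ((\sum_(p < n.+1) asymptotic_variance muF m theta y (psi j) p) * s ^+ 2 / 2)).
  have := sum_cos (psi j) lb 0 s (bpsi j) (psiB j); rewrite cos0 mulr1 => <-.
  by apply: eq_Rintegral => w _; rewrite limitE add0r.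
have var_le j := limit_variance_le reg regt n oscphi j.
pose comb (a : 'rV[R]_d) p := combination muF m theta y t n phi a p.
have bcomb (a : 'rV[R]_d) p : bounded_measurable (comb a p).
  exact: (bm_combination reg regt n oscphi).
have combB (a : 'rV[R]_d) p x := combination_bound reg tau0 regt n oscphi a p x.
pose s2 (a : 'rV[R]_d) := \sum_(p < n.+1) asymptotic_variance muF m theta y (comb a) p.
have s20 (a : 'rV[R]_d) : 0 <= s2 a.
  apply: sumr_ge0 => p _.
  by have /andP[] := asymptotic_variance_bounds reg (bcomb a) (combB a) p.
have mcomb (a : 'rV[R]_d) : measurable_fun setT (fun w => \sum_(j < d) a 0 j * limit w 0 j).
  by apply: measurable_sum => j; exact: measurable_funM.
have comb_cos (a : 'rV[R]_d) b s : \int[PL]_w cos (b + s * \sum_(j < d) a 0 j * limit w 0 j) =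
    expR (- (s2 a * s ^+ 2 / 2)) * cos b.
  rewrite -(sum_cos (comb a) _ b s (bcomb a) (combB a)).
  (* The fields are linear only up to null sets. *)
  apply: ae_eq_Rintegral_cos.
  - by apply: measurable_funD => //; exact: measurable_funM.
  - apply: measurable_funD => //; apply: measurable_funM => //.
    by apply: measurable_sum => p; exact: (measurable_field gV).
  have := ae_foralln (fun p => field_combination gV (index_enum 'I_d) p (fun j => a 0 j)
    (fun j => bpsi j p)).
  apply: filterS => w E; congr (_ + _ * _).
  under eq_bigr do rewrite limitE mulr_sumr.
  by rewrite exchange_big/=; apply: eq_bigr => p _; rewrite -E.
split; last first.
- move=> j; apply: le_trans (gaussian_variance (mlimit j) (limit_cos j)) _.
  by rewrite lee_fin.
- move=> a; exists (s2 a); first exact: s20.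
  by apply: centered_gaussian_of_cos.
(* From here on the bounds may depend on [theta], [y], [n] and [phi]: convergence in law is asserted
   for each choice separately. *)
have [Mu Mu0 uM] := bm_bound (bmB bphi (bm_cst X (eta n phi))).
pose Mj j := `|score_mean muF m theta y (t j) n| * (1 + Mu) +
  `|score_covariance muF m theta y (t j) n phi|.
pose M := 1 + Mu + \sum_j Mj j.
have Mj0 j : 0 <= Mj j by apply: addr_ge0 => //; apply: mulr_ge0 => //; exact: addr_ge0.
have S0 : 0 <= \sum_j Mj j by exact: sumr_ge0.
have MjM j : Mj j <= M.
  rewrite /M (bigD1 j)//= addrCA lerDl; apply: addr_ge0; first exact: addr_ge0.
  exact: sumr_ge0.
have M1 : 1 <= M by rewrite /M -addrA lerDl addr_ge0.
have uM' x : `|centered_test muF m theta y n phi x| <= M.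
  by apply: le_trans (uM x) _; rewrite /M -addrA addrCA lerDl addr_ge0.
have hM j x : `|centered_offset muF m theta y (t j) n phi x| <= M.
  apply: le_trans (ler_normB _ _) _; apply: le_trans (MjM j); rewrite /Mj lerD2r.
  rewrite normrM normrN; apply: ler_wpM2l => //.
  by apply: le_trans (uM x) _; rewrite lerDr.
have sM j : `|score_mean muF m theta y (t j) n| <= M.
  apply: le_trans (MjM j); rewrite /Mj mulrDr mulr1 -addrA lerDl.
  by apply: addr_ge0 => //; exact: mulr_ge0.
(* Without particles the factor [sqrt 0] annihilates the error, so the moment bounds hold for every
   [N]. *)
have Z0 w j : Z 0%N w 0 j = 0 by rewrite mxE sqrtr0 mul0r.
have bZ N j : bounded_measurable (fun w => Z N w 0 j).
  case: N => [|N].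
    by rewrite (_ : (fun w => _) = fun=> 0); [exact: bm_cst|apply/funext => w].
  rewrite (_ : (fun w => _) = scaled_error muF m theta y t n phi (xi N.+1) j).
    exact: (bm_scaled_error reg regt n oscphi).
  by apply/funext => w; exact: ZE.
pose A := expansion_bound muF rho delta tau n M + n.+1%:R * (lb ^+ 2 + 1).
(* First moments: 0 for [N = 0], [A] for the other particle systems, and [1 + C] for the limit
   because [|z| <= 1 + z ^ 2]. *)
apply: (@cvg_in_law_of_cos R d dO O P Z dL L PL limit (Num.max (Num.max 0 A) (1 + C))).
- by move=> N j; exact: bm_measurable.
- exact: mlimit.
- by move=> N j; exact: bm_integrable.
- by move=> j; exact: gaussian_integrable (mlimit j) (limit_cos j).
- move=> N j; rewrite le_max; apply/orP; left; rewrite le_max.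
  case: N => [|N]; apply/orP; [left|right].
    by under eq_Rintegral do rewrite Z0 normr0; rewrite Rintegral_prob_cst.
  under eq_Rintegral do rewrite ZE//.
  exact: (scaled_error_abs reg tau0 regt oscphi M1 uM' hM sM _ (ps N.+1)).
- move=> j; rewrite le_max; apply/orP; right.
  apply: le_trans (gaussian_abs_le (mlimit j) (limit_cos j)) _.
  by rewrite lerD2l.
move=> a b.
have -> : \int[PL]_w cos (\sum_j a 0 j * limit w 0 j + b) = expR (- (s2 a / 2)) * cos b.
  rewrite -[s2 a]mulr1 -[X in s2 a * X](expr1n _ 2) -comb_cos.
  by apply: eq_Rintegral => w _; rewrite addrC mul1r.
apply: cvg_of_rate => N N0.
under eq_Rintegral do under eq_bigr do rewrite ZE//.
exact: (scaled_error_cos reg tau0 regt oscphi M1 uM' hM sM N0 (ps N)).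
Qed.
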